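(* Let $q\in(1,\infty]$ and $r,s\in(1,\infty)$ with $q^{-1}+r^{-1}+s^{-1}=1$. Let $b\in L^1_t(W^{1,q}_x)$ (with values in $\mathbb R^d$), $u\in L^\infty_t(L^r_x)$ and $f\in L^\infty_t(W^{1,s}_x)$. Then $$\int_0^T\left|\int_{\mathbb R^d}u_t\,[\mathsf P^\alpha,b_t\cdot\nabla]f_t\,d\mathscr L^d\right|dt\le c\,\|\nabla b\|_{L^1_tL^q_x}\,\|u\|_{L^\infty_tL^r_x}\,\|f\|_{L^\infty_tL^s_x}\qquad\text{for every }\alpha\in(0,1),$$ where $c\in\mathbb R$ is some constant depending on the dimension $d$ only.
   Context: Fix $d\ge1$ and $T\in[0,\infty)$. $\mathscr L^d$ is Lebesgue measure on $\mathbb R^d$. $(\mathsf P^\alpha)_{\alpha\ge0}$ is the standard heat semigroup on $\mathbb R^d$ (with generator the Laplacian $\Delta$), acting on the variable $x$ at fixed $t$. The commutator is $[\mathsf P^\alpha,b_t\cdot\nabla]f=\mathsf P^\alpha(b_t\cdot\nabla f)-b_t\cdot\nabla(\mathsf P^\alpha f)$. $L^p_t(E)$ (or $L^p_tE$), for $E$ a space of functions of $x\in\mathbb R^d$ (e.g. $L^q_x=L^q(\mathbb R^d,\mathscr L^d)$), is the space of functions on $(0,T)\times\mathbb R^d$ with norm $\big\|\,\|f_t\|_E\,\big\|_{L^p(0,T)}<\infty$; $W^{1,p}_x=\{f\in L^p_x:\nabla f\in L^p_x\}$. *)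

(* Defs.v *)
From HB Require Import structures.
From mathcomp Require Import all_boot all_order all_algebra.
From mathcomp Require Import all_classical all_reals all_analysis.

Set Implicit Arguments.
Unset Strict Implicit.
Unset Printing Implicit Defensive.
Import Order.TTheory GRing.Theory Num.Theory.
Import numFieldNormedType.Exports.

Local Open Scope classical_set_scope.
Local Open Scope ring_scope.

Definition measure_rV_display : measure_display -> measure_display.
Proof. exact. Qed.

Section measurable_rV.
Context {d} {T : sigmaRingType d} (n : nat).

Let coors : 'I_n -> 'rV[T]_n -> T := fun i x => x ord0 i.

Let rV_set0 : g_sigma_preimage coors set0.
Proof. exact: sigma_algebra0. Qed.

Let rV_setC A : g_sigma_preimage coors A -> g_sigma_preimage coors (~` A).
Proof. exact: sigma_algebraC. Qed.

Let rV_bigcup (F : (set 'rV[T]_n)^nat) :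
  (forall i, g_sigma_preimage coors (F i)) ->
  g_sigma_preimage coors (\bigcup_i (F i)).
Proof. exact: sigma_algebra_bigcup. Qed.

HB.instance Definition _ := @isMeasurable.Build (measure_rV_display d)
  'rV[T]_n (g_sigma_preimage coors) rV_set0 rV_setC rV_bigcup.

End measurable_rV.


Lemma measurable_rVP d1 d2 (T1 : measurableType d1) (T2 : measurableType d2) n
    (f : T1 -> 'rV[T2]_n) :
  measurable_fun [set: T1] f <->
  forall i, measurable_fun [set: T1] (fun x => f x ord0 i).
Proof.
apply: (@iff_trans _ (g_sigma_preimage
    (fun i => (fun y : 'rV[T2]_n => y ord0 i) \o f) `<=` measurable)).
  rewrite g_sigma_preimage_comp; split=> [mf A [/= C preC <-]|prefS].
    exact: mf.
  by move=> _ A mA; apply: prefS; exists A.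
split=> [fS i|mf].
- move=> _ A mA; apply: fS; apply: sub_sigma_algebra.
  case: n i => [[] []//|n i] in f *.
  rewrite -bigcup_mkord_ord.
  exists i; first exact: ltn_ord.
  by exists A => //; rewrite inord_val.
- apply: smallest_sub; first exact: sigma_algebra_measurable.
  case: n => [|n] in f mf *; first by rewrite big_ord0.
  rewrite -bigcup_mkord_ord; apply: bigcup_sub => i Ii.
  by move=> A [B mB <-]; exact: mf.
Qed.

Section lebesgue_measure_rV.
Context {R : realType}.
Local Open Scope ereal_scope.

Definition rV_cons n (p : R * 'rV[R]_n) : 'rV[R]_n.+1 :=
  row_mx (const_mx p.1 : 'rV[R]_1) p.2.

Lemma rV_consE n (p : R * 'rV[R]_n) (i : 'I_n.+1) :
  rV_cons p ord0 i = if unlift ord0 i is Some j then p.2 ord0 j else p.1.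
Proof.
rewrite /rV_cons; case: unliftP => [j ->|->].
  have -> : lift ord0 j = rshift 1 j by apply/ord_inj.
  by rewrite (row_mxEr (const_mx p.1 : 'rV[R]_1)).
have -> : (ord0 : 'I_n.+1) = lshift n (ord0 : 'I_1) by apply/ord_inj.
by rewrite (row_mxEl (const_mx p.1 : 'rV[R]_1)) mxE.
Qed.

Lemma measurable_rV_cons n : measurable_fun [set: R * 'rV[R]_n] (@rV_cons n).
Proof.
apply/measurable_rVP => i; under eq_fun do rewrite rV_consE.
case: unliftP => [j _|_]; last exact: measurable_fst.
have /measurable_rVP/(_ j) // :
  measurable_fun [set: R * 'rV[R]_n] (snd : _ -> 'rV[R]_n).
exact: measurable_snd.
Qed.

Section step.
Context n (m : {sigma_finite_measure set 'rV[R]_n -> \bar R}).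

Definition rV_measureS : set 'rV[R]_n.+1 -> \bar R :=
  pushforward (lebesgue_measure \x m) (@rV_cons n).

Let rV_measureS0 : rV_measureS set0 = 0.
Proof. by rewrite /rV_measureS /pushforward preimage_set0 measure0. Qed.

Let rV_measureS_ge0 A : 0 <= rV_measureS A.
Proof. by rewrite /rV_measureS /pushforward. Qed.

Let rV_measureS_sigma_additive : semi_sigma_additive rV_measureS.
Proof.
have mcons A : measurable A -> measurable (@rV_cons n @^-1` A).
  by move=> mA; rewrite -[X in measurable X]setTI; exact: measurable_rV_cons.
move=> F mF tF mUF; rewrite /rV_measureS /pushforward preimage_bigcup.
apply: measure_semi_sigma_additive => [k| |]; first exact: mcons.
- apply/trivIsetP => /= i j _ _ ij; rewrite -preimage_setI.
  by move/trivIsetP : tF => /(_ _ _ _ _ ij) ->//; rewrite preimage_set0.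
- by rewrite -preimage_bigcup; exact: mcons.
Qed.

HB.instance Definition _ := isMeasure.Build _ _ _
  rV_measureS rV_measureS0 rV_measureS_ge0 rV_measureS_sigma_additive.

Let rV_measureS_sigma_finite : sigma_finite [set: 'rV[R]_n.+1] rV_measureS.
Proof.
have [F [FT ndF Foo]] := (sigma_finiteP _ _).1 (sigma_finiteT (@lebesgue_measure R)).
have [G [GT ndG Goo]] := (sigma_finiteP _ _).1 (sigma_finiteT m).
pose g (x : 'rV[R]_n.+1) : R * 'rV[R]_n := (x ord0 ord0, col' ord0 x).
have mg : measurable_fun [set: 'rV[R]_n.+1] g.
  apply/measurable_fun_pairP; split => /=.
    by have /measurable_rVP/(_ ord0) := @measurable_id _ 'rV[R]_n.+1 setT.
  apply/measurable_rVP => i; under eq_fun do rewrite mxE.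
  by have /measurable_rVP/(_ (lift ord0 i)) :=
    @measurable_id _ 'rV[R]_n.+1 setT.
have gK p : g (rV_cons p) = p.
  case: p => a x; congr pair; rewrite ?rV_consE ?unlift_none//.
  by apply/rowP => j; rewrite mxE rV_consE liftK.
exists (fun k => g @^-1` (F k `*` G k)) => [|k].
  rewrite -preimage_bigcup -[LHS](preimage_setT g); congr (_ @^-1` _).
  rewrite -setXTT FT GT predeqE => -[x y]; split=> [|[k _ [/= ? ?]]]; last first.
    by split; exists k.
  move=> [/= [i _ Fix] [k _ Gky]]; exists (maxn i k) => //; split.
    by move: x Fix; exact/subsetPset/ndF/leq_maxl.
  by move: y Gky; exact/subsetPset/ndG/leq_maxr.
have [[mF Foo'] [mG Goo']] := (Foo k, Goo k); split.
  by rewrite -[X in measurable X]setTI; apply: mg => //; exact: measurableX.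
rewrite /rV_measureS /pushforward -comp_preimage.
rewrite (_ : g \o _ = id) ?preimage_id; last by apply/funext => p /=; rewrite gK.
by rewrite product_measure1E// lte_mul_pinfty// ge0_fin_numE.
Qed.

HB.instance Definition _ := Measure_isSigmaFinite.Build _ _ _
  rV_measureS rV_measureS_sigma_finite.

End step.

Fixpoint lebesgue_rV n : {sigma_finite_measure set 'rV[R]_n -> \bar R} :=
  match n with
  | 0 => \d_(0%R : 'rV[R]_0)
  | k.+1 => rV_measureS (lebesgue_rV k)
  end.
Lemma lebesgue_rV_box n (A : 'I_n -> set R) :
  (forall i, measurable (A i)) ->
  lebesgue_rV n [set x | forall i, A i (x ord0 i)] =
  \prod_(i < n) lebesgue_measure (A i).
Proof.
elim: n A => [|n IHn] A mA /=.
  by rewrite diracE big_ord0 mem_set// => -[].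
have mB : measurable [set x : 'rV[R]_n | forall i, A (lift ord0 i) (x ord0 i)].
  rewrite (_ : [set _ | _] = \big[setI/setT]_(i < n)
    ((fun x : 'rV[R]_n => x ord0 i) @^-1` A (lift ord0 i))).
    apply: bigsetI_measurable => i _; rewrite -[X in measurable X]setTI.
    by have /measurable_rVP/(_ i) := @measurable_id _ 'rV[R]_n setT; exact.
  by rewrite -bigcap_seq predeqE => x; split=> [h i _|h i]; apply: h;
    rewrite /= mem_index_enum.
rewrite big_ord_recl -IHn; last by move=> i; exact: mA.
rewrite -product_measure1E//; last exact: mA.
rewrite /rV_measureS /pushforward; congr (product_measure1 _ _ _).
rewrite predeqE => -[x y] /=; split=> [h|[Ax Ay] i].
  split; first by have := h ord0; rewrite rV_consE unlift_none.
  by move=> i; have := h (lift ord0 i); rewrite rV_consE liftK.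
by rewrite rV_consE; case: unliftP => [j ->|->].
Qed.

End lebesgue_measure_rV.

Section weak_derivatives.
Context {R : realType} {n : nat}.
Implicit Types (f g phi : 'rV[R]_n -> R) (i : 'I_n).

Definition partial i f (x : 'rV[R]_n) : R := 'D_(delta_mx ord0 i) f x.

Definition smooth f := forall s : seq 'I_n,
  continuous (foldr partial f s) /\
  forall i x, derivable (foldr partial f s) x (delta_mx ord0 i).

Definition test_function phi :=
  smooth phi /\ compact (closure [set x | phi x != 0]).

Definition loc_integrable f := measurable_fun [set: 'rV[R]_n] f /\
  forall K, compact K -> (\int[lebesgue_rV n]_(x in K) `|f x|%:E < +oo)%E.

Definition is_weak_partial i f g :=
  [/\ loc_integrable f, loc_integrable g &
      forall phi, test_function phi ->
        \int[lebesgue_rV n]_x (f x * partial i phi x) =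
        - \int[lebesgue_rV n]_x (g x * phi x)].

Definition weakly_differentiable f := forall i, exists g, is_weak_partial i f g.

(* A representative of the i-th weak partial derivative, which is unique up to
   almost-everywhere equality; junk if it does not exist. *)
Definition weak_partial i f : 'rV[R]_n -> R :=
  get [set g | is_weak_partial i f g].

Definition gradient f (x : 'rV[R]_n) : 'rV[R]_n := \row_i weak_partial i f x.

Definition vgradient (b : 'rV[R]_n -> 'rV[R]_n) (x : 'rV[R]_n) : 'M[R]_n :=
  \matrix_(i, j) weak_partial j (fun y => b y ord0 i) x.

End weak_derivatives.

Section spaces.
Context {R : realType} {n : nat}.
Local Open Scope ereal_scope.
Implicit Types (T : R) (p : \bar R).

(* The norm `|A| of the library is the sup norm of the entries. *)
Definition euclidean_norm k l (A : 'M[R]_(k, l)) : R :=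
  Num.sqrt (\sum_i \sum_j A i j ^+ 2)%R.

Definition Lx_norm p (f : 'rV[R]_n -> R) : \bar R :=
  'N[lebesgue_rV n]_p[EFin \o f].

Definition Lx_mxnorm k l p (F : 'rV[R]_n -> 'M[R]_(k, l)) : \bar R :=
  'N[lebesgue_rV n]_p[EFin \o (@euclidean_norm k l) \o F].

Definition Lx p : set ('rV[R]_n -> R) :=
  [set f | measurable_fun [set: 'rV[R]_n] f /\ Lx_norm p f < +oo].

Definition W1x p : set ('rV[R]_n -> R) :=
  [set f | [/\ Lx p f, weakly_differentiable f &
               Lx_mxnorm p (gradient f) < +oo]].

Definition W1x_norm p (f : 'rV[R]_n -> R) : \bar R :=
  Lx_norm p f + Lx_mxnorm p (gradient f).

Definition vW1x p : set ('rV[R]_n -> 'rV[R]_n) :=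
  [set b | forall i, W1x p (fun x => b x ord0 i)].

Definition vW1x_norm p (b : 'rV[R]_n -> 'rV[R]_n) : \bar R :=
  Lx_mxnorm p b + Lx_mxnorm p (vgradient b).

Definition time_measure T : {measure set (measurableTypeR R) -> \bar R} :=
  mrestr lebesgue_measure (measurable_itv `]0%R, T[).

Definition Lt_norm T p (h : R -> \bar R) : \bar R := 'N[time_measure T]_p[h].

(* The space of jointly measurable (t, x) |-> F t x on ]0, T[ * R^n whose time
   slices are almost all in E, with t |-> norm (F t) in L^p(0, T). *)
Definition LtE d (Y : measurableType d) T p (E : set ('rV[R]_n -> Y))
    (norm : ('rV[R]_n -> Y) -> \bar R) : set (R -> 'rV[R]_n -> Y) :=
  [set F | [/\ measurable_fun (`]0%R, T[ `*` [set: 'rV[R]_n])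
                 (fun tx => F tx.1 tx.2),
               (\forall t \ae time_measure T, E (F t)) &
               Lt_norm T p (norm \o F) < +oo]].

End spaces.

Section heat_semigroup.
Context {R : realType} {n : nat}.
Implicit Types (f : 'rV[R]_n -> R) (b : 'rV[R]_n -> 'rV[R]_n).

Definition dotv (v w : 'rV[R]_n) : R := \sum_i v ord0 i * w ord0 i.

(* Fundamental solution of the heat equation with generator the Laplacian. *)
Definition heat_kernel (alpha : R) (z : 'rV[R]_n) : R :=
  (4 * pi * alpha) `^ (- (n%:R / 2)) * expR (- (dotv z z / (4 * alpha))).

Definition heat (alpha : R) f (x : 'rV[R]_n) : R :=
  if alpha == 0 then f x
  else \int[lebesgue_rV n]_y (heat_kernel alpha (x - y) * f y).

Definition advect b f (x : 'rV[R]_n) : R := dotv (b x) (gradient f x).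

Definition heat_commutator (alpha : R) b f (x : 'rV[R]_n) : R :=
  heat alpha (advect b f) x - advect b (heat alpha f) x.

End heat_semigroup.

(* Main.v *)
Require Import Defs.
From HB Require Import structures.
From mathcomp Require Import all_boot all_order all_algebra.
From mathcomp Require Import all_classical all_reals all_analysis.
From mathcomp Require Import measurable_realfun ess_sup_inf.
From mathcomp Require Import ring lra.

Set Implicit Arguments.
Unset Strict Implicit.
Unset Printing Implicit Defensive.
Import Order.TTheory GRing.Theory Num.Theory.
Import numFieldNormedType.Exports.

Local Open Scope classical_set_scope.
Local Open Scope ring_scope.
Local Open Scope ereal_scope.


(** At a fixed time the heat semigroup commutes with weak derivatives, so both terms
    of the commutator integrate the same functions against the heat kernel p, and
    only increments of b survive: the space integral is the sum over i of J_i(d_i f),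
    where J_i(V) is the double integral of u(x) p(x - y) (b_i(y) - b_i(x)) V(y).
    Everything rests on bounding J_i(d_i f) by the norm of f instead of the norm of
    its gradient, uniformly in alpha ([commutator_form_le]).

    The derivative is moved off f by difference quotients.  For h at most the square
    root of alpha, translating V by h along a coordinate axis changes J_i(V) by at
    most h C |u|_r |V|_s |grad b|_q ([commutator_form_lipschitz]).  Indeed the
    translation can be put on the kernel.  Where it falls on b it produces a
    difference of b over the distance h; where it falls on the Gaussian it produces
    a factor of order h / sqrt(alpha), and this is compensated by b(y) - b(x), a
    difference of b over a distance of order sqrt(alpha) ([heat_kernel_difference]).
    A difference of b over a segment is the average of its derivative along that
    segment, and translations preserve norms, so Hoelder's inequality with three
    factors controls both contributions ([difference_le]).

    Since f too satisfies the fundamental theorem of calculus along segments,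
    J_i(f(. + h e_i)) - J_i(f) is h times the average over l in [0, 1] of
    J_i((d_i f)(. + l h e_i)).  The Lipschitz bound at V = f therefore bounds this
    average by C |u|_r |f|_s |grad b|_q, while the Lipschitz bound at
    V = d_i f shows that the average tends to J_i(d_i f) as h goes to 0.

    That weakly differentiable functions satisfy the fundamental theorem of calculus
    along almost every segment ([weak_difference]) follows by testing: on a test
    function the statement is the classical theorem, and a locally integrable
    function that vanishes against all test functions is null
    ([du_bois_reymond]).  The latter needs enough test functions, which are products
    of one-dimensional plateaus built from exp(-1/x).

    The resulting estimate holds at almost every time.  Replacing the norms of u and
    f by their essential suprema and integrating gives the theorem
    ([ae_ge0_le_integral_mrestr]). *)

(** * Measurability and translation on row vectors *)

Section measurable_rV_theory.
Context {R : realType} {n : nat}.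

Lemma measurable_coord (i : 'I_n) :
  measurable_fun [set: 'rV[R]_n] (fun x => x ord0 i).
Proof. by have /measurable_rVP/(_ i) := @measurable_id _ 'rV[R]_n setT. Qed.

Lemma measurable_coordT d (T : measurableType d) (f : T -> 'rV[R]_n) (i : 'I_n) :
  measurable_fun setT f -> measurable_fun setT (fun t => f t ord0 i).
Proof. by move=> /measurable_rVP. Qed.

Lemma measurable_addv d (T : measurableType d) (f g : T -> 'rV[R]_n) :
  measurable_fun setT f -> measurable_fun setT g ->
  measurable_fun setT (fun t => (f t + g t)%R).
Proof.
move=> mf mg; apply/measurable_rVP => i; under eq_fun do rewrite mxE.
by apply: measurable_funD; exact: measurable_coordT.
Qed.

Lemma measurable_oppv d (T : measurableType d) (f : T -> 'rV[R]_n) :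
  measurable_fun setT f -> measurable_fun setT (fun t => (- f t)%R).
Proof.
move=> mf; apply/measurable_rVP => i; under eq_fun do rewrite mxE.
by apply: measurable_funN; exact: measurable_coordT.
Qed.

Lemma measurable_subv d (T : measurableType d) (f g : T -> 'rV[R]_n) :
  measurable_fun setT f -> measurable_fun setT g ->
  measurable_fun setT (fun t => (f t - g t)%R).
Proof. by move=> mf mg; apply: measurable_addv => //; exact: measurable_oppv. Qed.

Lemma measurable_scalev d (T : measurableType d) (a : T -> R) (f : T -> 'rV[R]_n) :
  measurable_fun setT a -> measurable_fun setT f ->
  measurable_fun setT (fun t => (a t *: f t)%R).
Proof.
move=> ma mf; apply/measurable_rVP => i; under eq_fun do rewrite mxE.
by apply: measurable_funM => //; exact: measurable_coordT.
Qed.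

Lemma measurable_box (A : 'I_n -> set R) : (forall i, measurable (A i)) ->
  measurable [set x : 'rV[R]_n | forall i, A i (x ord0 i)].
Proof.
move=> mA; rewrite (_ : [set _ | _] = \big[setI/setT]_(i < n)
    ((fun x : 'rV[R]_n => x ord0 i) @^-1` A i)).
  apply: bigsetI_measurable => i _; rewrite -[X in measurable X]setTI.
  exact: measurable_coord.
by rewrite -bigcap_seq predeqE => x; split=> [h i _|h i]; apply: h;
  rewrite /= mem_index_enum.
Qed.

(** Open sets of the sup-norm topology are countable unions of balls with rational
    centre and radius, and such balls are boxes. *)
Lemma open_measurable_rV (U : set 'rV[R]_n) : open U -> measurable U.
Proof.
move=> oU.
pose c (z : 'rV[rat]_n) : 'rV[R]_n := map_mx ratr z.
pose B (zk : 'rV[rat]_n * nat) : set 'rV[R]_n :=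
  [set x | forall i, (ball (c zk.1 ord0 i) (zk.2.+1%:R^-1 : R)) (x ord0 i)].
rewrite (_ : U = \bigcup_zk (if `[< B zk `<=` U >] then B zk else set0)).
  apply: countable_bigcupT_measurable => [|zk]; first exact: countableP.
  case: ifPn => // _; apply: (@measurable_box (fun i => ball _ _)) => i.
  exact: measurable_ball.
apply/seteqP; split => [x Ux|x [zk _]]; last by case: ifPn => // /asboolP; exact.
have /nbhs_ballP[e /= e0 eU] : nbhs x U by exact: open_nbhs_nbhs.
have [k ke] : exists k, (k.+1%:R^-1 < e / 2)%R.
  have [k _ /(_ k (leqnn k))] := near_infty_natSinv_lt (PosNum (divr_gt0 e0 (ltr0n _ 2))).
  by exists k.
have k0 : (0 < k.+1%:R^-1 :> R)%R by rewrite invr_gt0.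
have /choice[z hz] : forall i, exists q : rat, (ball (ratr q : R) k.+1%:R^-1) (x ord0 i).
  move=> i; have xlt : (x ord0 i < x ord0 i + k.+1%:R^-1)%R by rewrite ltrDl.
  have [q] := rat_in_itvoo xlt.
  rewrite in_itv/= => /andP[q1 q2]; exists q.
  by rewrite /ball/= ger0_norm ?subr_ge0 ?(ltW q1)// ltrBlDr addrC.
exists (\row_i z i, k) => //.
have -> : `[< B (\row_i z i, k) `<=` U >].
  apply/asboolP => y By; apply: eU; split => // a b; rewrite (ord1 a).
  have := By b; have := hz b; rewrite /c /= !mxE.
  rewrite /ball /= => h1 h2.
  rewrite (_ : _ - _ = - (ratr (z b) - x ord0 b) + (ratr (z b) - y ord0 b))%R; last by ring.
  apply: (le_lt_trans (ler_normD _ _)); rewrite normrN (splitr e).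
  by apply: ltrD; [exact: (lt_trans h1 ke)|exact: (lt_trans h2 ke)].
by move=> i; rewrite /c !mxE.
Qed.

Lemma continuous_measurable_rV (f : 'rV[R]_n -> R) :
  continuous f -> measurable_fun setT f.
Proof.
move=> /continuousP cf; apply: (measurability _ (@RGenOpens.measurableE R)).
move=> _ [_ [a [b ->] <-]]; rewrite setTI; apply: open_measurable_rV.
by apply: cf; exact: interval_open.
Qed.

End measurable_rV_theory.

Section shift.
Context {R : realType}.

Lemma lebesgue_measure_shift (a : R) (A : set R) : measurable A ->
  pushforward lebesgue_measure ((fun x => x + a)%R : measurableTypeR R -> measurableTypeR R) A
   = lebesgue_measure A.
Proof.
have ma : measurable_fun setT ((fun x => x + a)%R : measurableTypeR R -> measurableTypeR R).
  exact: measurable_funD.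
pose f : {mfun measurableTypeR R >-> measurableTypeR R} :=
  HB.pack (fun x : measurableTypeR R => (x + a)%R : measurableTypeR R)
    (isMeasurableFun.Build _ _ _ _ _ ma).
move=> mA; apply/esym/(@lebesgue_measure_unique R (pushforward lebesgue_measure f)) => //.
move=> _ [[b c]] _ <-.
rewrite /= /pushforward/=.
rewrite (_ : (fun x => _) @^-1` _ = `](b - a)%R, (c - a)%R]%classic); last first.
  by apply/seteqP; split => x /=; rewrite !in_itv/= ltrBlDr lerBrDr.
rewrite !lebesgue_measure_itv/= !lte_fin ltrD2r; case: ifPn => // _.
by rewrite -!EFinD; congr EFin; ring.
Qed.

Lemma ge0_integral_shift (a : R) (f : R -> \bar R) :
  measurable_fun setT f -> (forall x, 0 <= f x) ->
  \int[lebesgue_measure]_x f (x + a)%R = \int[lebesgue_measure]_x f x.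
Proof.
move=> mf f0.
have ma : measurable_fun setT ((fun x => x + a)%R : measurableTypeR R -> measurableTypeR R).
  by apply: measurable_funD.
have := ge0_integral_pushforward ma lebesgue_measure measurableT mf (in1W f0).
rewrite preimage_setT => <-; apply: eq_measure_integral => A mA _.
exact/lebesgue_measure_shift.
Qed.
End shift.

(** * Lebesgue measure on row vectors and the heat kernel *)

Section rV_integral.
Context {R : realType}.

Lemma rV_consD n (v x : 'rV[R]_n.+1) a (y : 'rV[R]_n) :
  (rV_cons (a, y) + v = rV_cons (a + v ord0 ord0, y + col' ord0 v))%R.
Proof.
apply/rowP => i; rewrite mxE !rV_consE/=.
by case: unliftP => [j ->|->]//=; rewrite !mxE.
Qed.

Lemma ge0_integral_rV_cons n (f : 'rV[R]_n.+1 -> \bar R) :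
  measurable_fun setT f -> (forall x, 0 <= f x) ->
  \int[lebesgue_rV n.+1]_x f x =
  \int[lebesgue_measure]_a \int[lebesgue_rV n]_y f (rV_cons (a, y)).
Proof.
move=> mf f0.
have mc : measurable_fun [set: measurableTypeR R * 'rV[R]_n] (@rV_cons R n).
  exact: measurable_rV_cons.
have := ge0_integral_pushforward mc
  (lebesgue_measure \x lebesgue_rV n) measurableT mf (in1W f0).
rewrite preimage_setT => -> /=.
rewrite fubini_tonelli1//.
by apply: measurableT_comp => //; exact: measurable_rV_cons.
Qed.

(** Lebesgue measure on row vectors is an iterated integral, so its translation
    invariance reduces to that of the line, one coordinate at a time. *)
Lemma ge0_integral_rV_shift n (v : 'rV[R]_n) (f : 'rV[R]_n -> \bar R) :
  measurable_fun setT f -> (forall x, 0 <= f x) ->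
  \int[lebesgue_rV n]_x f (x + v)%R = \int[lebesgue_rV n]_x f x.
Proof.
elim: n => [|n IHn] in v f * => mf f0.
  by apply: eq_integral => x _; congr f; apply/rowP => -[].
have mfv : measurable_fun setT (fun x : 'rV[R]_n.+1 => f (x + v)%R).
  apply: (measurableT_comp mf); apply: measurable_addv => //.
rewrite !ge0_integral_rV_cons//.
under eq_integral => a _.
  under eq_integral do rewrite rV_consD//.
  rewrite (IHn _ (fun y => f (rV_cons (a + v ord0 ord0, y)%R)))//; last first.
    apply: (measurableT_comp mf); apply: (measurableT_comp (@measurable_rV_cons R n)).
    exact: measurable_pair1.
  over.
rewrite (ge0_integral_shift _ (f := fun a => \int[lebesgue_rV n]_y f (rV_cons (a, y))))//.
- apply: (measurable_fun_fubini_tonelli_F (fun ay => f (rV_cons ay))) => //.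
  by apply: measurableT_comp => //; exact: measurable_rV_cons.
- by move=> a; exact: integral_ge0.
Qed.

Lemma integral_rV_shift n (v : 'rV[R]_n) (f : 'rV[R]_n -> \bar R) :
  measurable_fun setT f ->
  \int[lebesgue_rV n]_x f (x + v)%R = \int[lebesgue_rV n]_x f x.
Proof.
move=> mf; rewrite integralE [RHS]integralE.
rewrite -(ge0_integral_rV_shift v (measurable_funepos mf))//.
rewrite -(ge0_integral_rV_shift v (measurable_funeneg mf))//.
by congr (_ - _); apply: eq_integral => x _; rewrite ?funeposE ?funenegE.
Qed.

Lemma integral_rV_prod n (h : 'I_n -> R -> R) :
  (forall i, measurable_fun setT (h i)) -> (forall i x, (0 <= h i x)%R) ->
  \int[lebesgue_rV n]_x (\prod_(i < n) h i (x ord0 i))%:E =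
  \prod_(i < n) \int[lebesgue_measure]_a (h i a)%:E.
Proof.
elim: n => [|n IHn] in h * => mh h0.
  under eq_integral do rewrite big_ord0.
  by rewrite integral_cst//= diracT mule1 big_ord0.
rewrite ge0_integral_rV_cons//; last 2 first.
- apply/measurable_EFinP; apply: measurable_prod => i _.
  by apply: measurableT_comp => //; exact: measurable_coord.
- by move=> x; rewrite lee_fin prodr_ge0.
rewrite big_ord_recl.
under eq_integral => a _.
  under eq_integral => y _.
    rewrite big_ord_recl rV_consE unlift_none/= EFinM.
    under eq_bigr do rewrite rV_consE liftK/=.
    over.
  rewrite ge0_integralZl//; last 3 first.
  - apply/measurable_EFinP; apply: measurable_prod => i _.
    by apply: measurableT_comp => //; exact: measurable_coord.
  - by move=> x _; rewrite lee_fin prodr_ge0.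
  - by rewrite lee_fin.
  rewrite (IHn (fun i => h (lift ord0 i)))//.
  over.
rewrite ge0_integralZr//.
- by apply/measurable_EFinP; exact: (mh ord0).
- by move=> x _; rewrite lee_fin.
- by apply: prode_ge0 => i _; apply: integral_ge0 => x _; rewrite lee_fin.
Qed.

Lemma heat_kernel_ge0 n alpha (z : 'rV[R]_n) : (0 <= heat_kernel alpha z)%R.
Proof. by rewrite mulr_ge0// ?powR_ge0// expR_ge0. Qed.

(** The normalising constant and the exponent factor over the coordinates into
    centred normal densities of variance 2 alpha. *)
Lemma heat_kernelE n (alpha : R) (z : 'rV[R]_n) : (0 < alpha)%R ->
  heat_kernel alpha z = (\prod_(i < n) normal_pdf 0 (Num.sqrt (alpha *+ 2)) (z ord0 i))%R.
Proof.
move=> a0; have s0 : Num.sqrt (alpha *+ 2) != 0%R by rewrite gt_eqF// sqrtr_gt0 mulrn_wgt0.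
rewrite /heat_kernel normal_pdfE//.
rewrite big_split/= prodr_const card_ord; congr (_ * _)%R.
  rewrite /normal_peak sqr_sqrtr ?mulrn_wge0 ?ltW//.
  rewrite (_ : alpha *+ 2 * pi *+ 2 = 4 * pi * alpha)%R; last by ring.
  have p0 : (0 <= 4 * pi * alpha :> R)%R by rewrite !mulr_ge0 ?pi_ge0 ?ltW.
  rewrite -powR12_sqrt// -powRN -powR_mulrn ?powR_ge0// -powRrM.
  by congr (_ `^ _)%R; field.
rewrite -expR_sum; congr expR; rewrite /dotv mulr_suml -sumrN; apply: eq_bigr => i _.
rewrite sqr_sqrtr ?mulrn_wge0 ?ltW// subr0 expr2 mulNr; congr (- (_ / _))%R.
by ring.
Qed.

Lemma measurable_heat_kernel n (alpha : R) :
  measurable_fun setT (@heat_kernel R n alpha).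
Proof.
apply: measurable_funM => //; apply: measurableT_comp => //.
apply: measurable_funN; apply: measurable_funM => //.
apply: measurable_sum => i; apply: measurable_funM => //; exact: measurable_coord.
Qed.

Lemma integral_heat_kernel n (alpha : R) : (0 < alpha)%R ->
  \int[lebesgue_rV n]_z (heat_kernel alpha z)%:E = 1.
Proof.
move=> a0; under eq_integral do rewrite heat_kernelE//.
rewrite (integral_rV_prod (h := fun _ => normal_pdf _ _)).
- by under eq_bigr do rewrite integral_normal_pdf; rewrite big1.
- by move=> _; exact: measurable_normal_pdf.
- by move=> _ x; exact: normal_pdf_ge0.
Qed.

End rV_integral.

(** * Hoelder's inequality with three factors *)

Section hoelder3.
Context d (T : measurableType d) (R : realType) (mu : {measure set T -> \bar R}).
Implicit Types (f g U V W : T -> R) (r s : R) (q : \bar R).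

Lemma le_Lnorm p f g : 0 < p -> measurable_fun setT f -> measurable_fun setT g ->
  (forall x, (`|f x| <= `|g x|)%R) -> 'N[mu]_p[EFin \o f] <= 'N[mu]_p[EFin \o g].
Proof.
case: p => [p| |]// p0 mf mg fg; rewrite unlock /=; last first.
  case: ifPn => // _; apply: le_ess_sup; apply/nearW => x /=.
  by rewrite lee_fin.
have mp (h : T -> R) : measurable_fun setT h ->
    measurable_fun setT (fun x => `|(h x)%:E| `^ p).
  move=> mh; apply: (measurableT_comp (measurable_poweR p)).
  by apply: measurableT_comp => //; exact/measurable_EFinP.
apply: gt0_ler_poweR.
- by rewrite invr_ge0 ltW.
- by rewrite in_itv/= leey andbT integral_ge0// => x _; exact: poweR_ge0.
- by rewrite in_itv/= leey andbT integral_ge0// => x _; exact: poweR_ge0.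
- apply: ge0_le_integral => //.
  + exact: mp.
  + exact: mp.
  + by move=> x _; rewrite /= lee_fin ge0_ler_powR ?nnegrE// ltW.
Qed.

Lemma Lnorm_powR U p k : (0 < p)%R -> (0 < k)%R ->
  'N[mu]_(p / k)%:E[EFin \o (fun x => `|U x| `^ k)%R] = 'N[mu]_p%:E[EFin \o U] `^ k.
Proof.
move=> p0 k0; rewrite unlock /= -poweRrM; congr (_ `^ _); last by field; rewrite !gt_eqF.
apply: eq_integral => x _; rewrite /= ger0_norm ?powR_ge0//.
by rewrite -powRrM; congr (_ `^ _)%:E; field; rewrite gt_eqF.
Qed.

(** The product estimate with 1 / k = 1 / r + 1 / s is the classical inequality
    applied to |U|^k and |V|^k, whose conjugate exponents are r / k and s / k. *)
Lemma Lnorm_mul_le U V r s : measurable_fun setT U -> measurable_fun setT V ->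
  (0 < r)%R -> (0 < s)%R ->
  'N[mu]_((r^-1 + s^-1)^-1)%:E[EFin \o (U \* V)%R] <=
    'N[mu]_r%:E[EFin \o U] * 'N[mu]_s%:E[EFin \o V].
Proof.
move=> mU mV r0 s0; set k := ((r^-1 + s^-1)^-1)%R.
have k0 : (0 < k)%R by rewrite invr_gt0 addr_gt0 ?invr_gt0.
have mp (h : T -> R) : measurable_fun setT h ->
    measurable_fun setT (fun x => `|h x| `^ k)%R.
  move=> mh; apply: (measurableT_comp (measurable_powR k)).
  exact: measurableT_comp.
have := hoelder mu (mp _ mU) (mp _ mV) (divr_gt0 r0 k0) (divr_gt0 s0 k0).
have -> : ((r / k)^-1 + (s / k)^-1 = 1)%R.
  by rewrite !invf_div -mulrDr /k mulVf// gt_eqF// addr_gt0 ?invr_gt0.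
rewrite !Lnorm_powR// => /(_ erefl).
rewrite Lnorm1 -poweRM ?Lnorm_ge0// => h.
have -> : 'N[mu]_k%:E[EFin \o (U \* V)%R] =
    (\int[mu]_x (`|U x * V x| `^ k)%:E) `^ k^-1 by rewrite unlock.
apply: (@le_trans _ _ ((('N[mu]_r%:E[EFin \o U] * 'N[mu]_s%:E[EFin \o V]) `^ k) `^ k^-1)).
  apply: gt0_ler_poweR.
  - by rewrite invr_ge0 ltW.
  - by rewrite in_itv/= leey andbT integral_ge0// => x _; exact: poweR_ge0.
  - by rewrite in_itv/= leey andbT poweR_ge0.
  - apply: le_trans h; apply: ge0_le_integral => //.
    + by apply/measurable_EFinP; exact: (mp _ (measurable_funM mU mV)).
    + by apply: measurableT_comp => //; apply/measurable_EFinP; apply: measurable_funM; exact: mp.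
    + by move=> x _; rewrite /= lee_fin normrM powRM// ler_norm.
by rewrite -poweRrM divff ?gt_eqF// poweRe1// mule_ge0 ?Lnorm_ge0.
Qed.

Lemma hoelder_oo U W : measurable_fun setT U -> measurable_fun setT W ->
  \int[mu]_x `|(U x * W x)%:E| <= 'N[mu]_1[EFin \o U] * 'N[mu]_+oo[EFin \o W].
Proof.
move=> mU mW; rewrite Lnorm1 muleC.
have -> : 'N[mu]_+oo[EFin \o W] =
    if 0 < mu setT then ess_sup mu (abse \o (EFin \o W)) else 0 by rewrite unlock.
have mUa : measurable_fun setT (fun x => `|(U x)%:E|).
  by apply: measurableT_comp => //; exact/measurable_EFinP.
case: ifPn => [mu0|]; last first.
  rewrite -leNgt measure_le0 => /eqP mu0; rewrite mul0e.
  rewrite (@null_set_integral _ _ _ mu setT)//.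
  by apply: measurableT_comp => //; apply/measurable_EFinP; exact: measurable_funM.
rewrite -ge0_integralZl//; last first.
  by apply: ess_sup_gee => //; apply/nearW => x /=.
apply: ae_ge0_le_integral => //.
- by apply: measurableT_comp => //; apply/measurable_EFinP; exact: measurable_funM.
- move=> x _; rewrite mule_ge0//.
  by apply: ess_sup_gee => //; apply/nearW => y /=.
- exact: emeasurable_funM.
- have := ess_sup_ge mu (abse \o (EFin \o W)); apply: filterS => x /= h _.
  by rewrite normrM EFinM muleC lee_wpmul2r.
Qed.

(** For finite q, the product U V is placed in the space conjugate to that of W; for
    infinite q, r and s are conjugate and W is estimated by its essential supremum. *)
Lemma hoelder3 U V W r s q : measurable_fun setT U -> measurable_fun setT V ->
  measurable_fun setT W -> (1 < r)%R -> (1 < s)%R -> 1 < q ->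
  q^-1 + r%:E^-1 + s%:E^-1 = 1 ->
  \int[mu]_x `|(U x * V x * W x)%:E| <=
  'N[mu]_r%:E[EFin \o U] * 'N[mu]_s%:E[EFin \o V] * 'N[mu]_q[EFin \o W].
Proof.
move=> mU mV mW r1 s1 q1.
have r0 : (0 < r)%R by apply: lt_trans r1.
have s0 : (0 < s)%R by apply: lt_trans s1.
rewrite !inver !gt_eqF//.
have mUV : measurable_fun setT (U \* V)%R by exact: measurable_funM.
case: q => [q| |]// in q1 *; last first.
  rewrite (_ : +oo^-1 = 0 :> \bar R); last by rewrite /inve.
  rewrite add0e => -[rs1].
  apply: le_trans (hoelder_oo mUV mW) _.
  apply: lee_wpmul2r; first exact: Lnorm_ge0.
  by have := Lnorm_mul_le mU mV r0 s0; rewrite rs1 invr1.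
have q0 : (0 < q)%R by move: q1; rewrite lte_fin; exact: lt_trans.
rewrite inver gt_eqF// => -[qrs].
apply: (@le_trans _ _ ('N[mu]_((r^-1 + s^-1)^-1)%:E[EFin \o (U \* V)%R] * 'N[mu]_q%:E[EFin \o W])).
  have := hoelder mu (p := (r^-1 + s^-1)^-1) (q := q) mUV mW.
  rewrite Lnorm1; apply => //.
    by rewrite invr_gt0 addr_gt0 ?invr_gt0.
  by rewrite invrK; lra.
by apply: lee_wpmul2r; [exact: Lnorm_ge0|exact: Lnorm_mul_le].
Qed.

End hoelder3.

(** * Smooth plateau functions on the line *)

Section smooth1.
Local Open Scope ring_scope.
Context {R : realType}.
Implicit Types (f g : R -> R).

(** C^k with the derivative under an existential, which makes closure under
    algebraic operations a plain induction. *)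
Fixpoint Ck k f : Prop :=
  if k is k'.+1 then
    exists2 f', (forall x, is_derive x (1 : R) f (f' x)) & Ck k' f'
  else continuous f.

Definition smooth1 f := forall k, Ck k f.

Lemma Ck_continuous k f : Ck k f -> continuous f.
Proof.
case: k => [//|k] [f' df _] x; apply: differentiable_continuous.
by apply/derivable1_diffP; exact: ex_derive.
Qed.

Lemma CkS k f : Ck k.+1 f -> Ck k f.
Proof.
elim: k f => [|k IHk] f; first by move=> /Ck_continuous.
by move=> [f' df Cf']; exists f' => //; exact: IHk.
Qed.

Lemma Ck_cst k (c : R) : Ck k (fun=> c).
Proof.
elim: k c => [|k IHk] c; first by move=> x; exact: cvg_cst.
by exists (fun=> 0) => [x|]; [exact: is_derive_cst|exact: IHk].
Qed.

Lemma CkD k f g : Ck k f -> Ck k g -> Ck k (fun x => f x + g x).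
Proof.
elim: k f g => [|k IHk] f g /=; first by move=> cf cg x; exact: (cvgD (cf x) (cg x)).
move=> [f' df Cf] [g' dg Cg]; exists (fun x => f' x + g' x); last exact: IHk.
by move=> x; exact: is_deriveD.
Qed.

Lemma CkM k f g : Ck k f -> Ck k g -> Ck k (fun x => f x * g x).
Proof.
elim: k f g => [|k IHk] f g; first by move=> cf cg x; exact: (cvgM (cf x) (cg x)).
move=> Cf Cg; have [cf cg] := (CkS Cf, CkS Cg).
move: Cf Cg => [f' df Cf'] [g' dg Cg'].
exists (fun x => f x * g' x + g x * f' x).
  by move=> x; exact: is_deriveM.
by apply: CkD; exact: IHk.
Qed.

Lemma Ck_affine k f (a c : R) : Ck k f -> Ck k (fun x => f (c * x + a)).
Proof.
have d x : is_derive x (1 : R) (fun x => c * x + a) c.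
  have : is_derive x (1 : R) ((c *: id) + cst a : R -> R) (c *: 1 + 0).
    by apply: is_deriveD.
  by rewrite addr0 /GRing.scale/= mulr1.
elim: k f => [|k IHk] f.
  move=> cf x; apply: (@continuous_comp _ _ _ (fun x => c * x + a)); last exact: cf.
  apply: differentiable_continuous; apply/derivable1_diffP.
  exact: ex_derive.
move=> [f' df Cf']; exists (fun x => c * f' (c * x + a)).
  move=> x; rewrite mulrC.
  exact: is_derive1_comp.
by apply: CkM; [exact: Ck_cst|exact: IHk].
Qed.

(** The inverse powers of x times exp(-1/x) form a family spanning its own
    derivatives. *)
Definition flat (n : nat) (x : R) : R :=
  if 0 < x then x^-1 ^+ n * expR (- x^-1) else 0.

Lemma flat_le n (x : R) : 0 < x -> `|flat n x| <= n.+2`!%:R * x ^+ 2.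
Proof.
move=> x0; rewrite /flat x0 ger0_norm; last by rewrite mulr_ge0 ?expR_ge0// exprn_ge0// invr_ge0 ltW.
have xi : 0 <= x^-1 by rewrite invr_ge0 ltW.
have := expR_ge1Dxn n.+1 xi.
move=> h.
have {h} h : x^-1 ^+ n.+2 <= n.+2`!%:R * expR x^-1.
  rewrite -ler_pdivrMl ?ltr0n ?fact_gt0// mulrC; apply: le_trans h.
  by rewrite lerDr.
rewrite expRN ler_pdivrMr ?expR_gt0//.
rewrite (_ : x^-1 ^+ n = x^-1 ^+ n.+2 * x ^+ 2); last first.
  by rewrite -addn2 exprD -mulrA -exprMn mulVf ?gt_eqF// expr1n mulr1.
by rewrite [leRHS]mulrAC ler_wpM2r// exprn_ge0// ltW.
Qed.

(** Away from 0 this is calculus; at 0 both sides vanish, the left one because flat n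
    is of order x^2 there. *)
Lemma is_derive_flat n x :
  is_derive x (1 : R) (flat n) (- n%:R * flat n.+1 x + flat n.+2 x).
Proof.
have [x0|x0|->] := ltgtP x 0.
- have E : \near x, (fun=> 0) x = flat n x.
    near=> y; rewrite /flat ltNge ltW//.
    by near: y; exact: lt_nbhsl.
  apply: (near_eq_is_derive E).
  by rewrite /flat ltNge (ltW x0) /= mulr0 addr0; exact: is_derive_cst.
- have E : \near x, (fun x => x^-1 ^+ n * expR (- x^-1)) x = flat n x.
    near=> y; rewrite /flat (_ : 0 < y)//.
    by near: y; exact: lt_nbhsr.
  apply: (near_eq_is_derive E).
  have xn0 : x != 0 by rewrite gt_eqF.
  have dV : is_derive x (1 : R) (fun y => y^-1) (- x ^- 2).
    apply: is_derive_eq; first exact: is_deriveV.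
    by rewrite /GRing.scale/= mulr1.
  have dN : is_derive x (1 : R) (fun y => - y^-1) (- - x ^- 2) by exact: is_deriveN.
  have dE : is_derive x (1 : R) (fun y => expR (- y^-1)) (expR (- x^-1) * - - x ^- 2).
    exact: (@is_derive1_comp _ expR (fun y => - y^-1)).
  have dX : is_derive x (1 : R) (fun y => y^-1 ^+ n) (n%:R * x^-1 ^+ n.-1 * (- x ^- 2)).
    rewrite (_ : (fun y => _) = (@GRing.inv R : R -> R) ^+ n).
      exact: is_deriveX.
    by apply/funext => y; rewrite exprfctE.
  apply: (is_derive_eq (is_deriveM dX dE)).
  rewrite /flat x0 /GRing.scale/= -!exprVn.
  set y := x^-1; set ex := expR _.
  case: n {dX E} => [|n] /=; first by rewrite !expr0; ring.
  rewrite !(exprS _ n.+2) !(exprS _ n.+1) !(exprS _ n); set z := y ^+ n.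
  by set c : R := n.+1%:R; ring.
- have f0 m : flat m 0 = 0 by rewrite /flat ltxx.
  rewrite !f0 mulr0 addr0.
  have L : h^-1 *: (flat n (h *: (1 : R) + 0) - flat n 0) @[h --> 0^'] --> (0 : R).
    pose C : R := n.+2`!%:R.
    have C0 : 0 < C by rewrite ltr0n fact_gt0.
    apply/cvgrPdist_lt => e e0; near=> h.
    rewrite sub0r normrN f0 subr0 addr0 /GRing.scale/= mulr1.
    have [h0|h0] := leP h 0.
      by rewrite /flat [0 < h]ltNge h0 mulr0 normr0.
    rewrite normrM ger0_norm ?invr_ge0 ?ltW// ltr_pdivrMl//.
    rewrite (le_lt_trans (flat_le n h0))// expr2 mulrA mulrC ltr_pM2l//.
    rewrite mulrC -ltr_pdivlMr// -[ltLHS]ger0_norm ?(ltW h0)//.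
    by near: h; apply: dnbhs0_lt; rewrite divr_gt0.
  by apply: DeriveDef; [exact: cvgP L|exact: cvg_lim L].
Unshelve. all: by end_near. Qed.

Lemma smooth1_flat n : smooth1 (flat n).
Proof.
move=> k; elim: k n => [|k IHk] n.
  move=> x; apply: differentiable_continuous; apply/derivable1_diffP.
  exact: (@ex_derive _ _ _ _ _ _ _ (is_derive_flat n x)).
exists (fun x => - n%:R * flat n.+1 x + flat n.+2 x); first exact: is_derive_flat.
by apply: CkD => //; apply: CkM => //; exact: Ck_cst.
Qed.

Lemma smooth1_derive f : smooth1 f ->
  (forall x, is_derive x (1 : R) f (derive1 f x)) /\ smooth1 (derive1 f).
Proof.
move=> sf; have df x : is_derive x (1 : R) f (derive1 f x).
  have [f' /(_ x) df _] := sf 1%N; rewrite derive1E derive_val; exact: df.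
split => // k; have [f' df' Cf'] := sf k.+1.
rewrite (_ : derive1 f = f') //; apply/funext => x.
by rewrite derive1E derive_val.
Qed.

(** Smooth functions with values in [0, 1], supported in [a, b], that increase
    to the indicator of the open interval as N grows. *)
Definition plateau (a b : R) (N : nat) (x : R) : R :=
  1 - (1 - flat 0 (x - a) * flat 0 (b - x)) ^+ N.+1.

Lemma flat_ge0_le1 x : 0 <= flat 0 x <= 1.
Proof.
rewrite /flat; case: ifPn => x0; last by rewrite lexx ler01.
by rewrite expr0 mul1r expR_ge0/= -expR0 ler_expR oppr_le0 invr_ge0 ltW.
Qed.

Lemma smooth1_plateau a b N : smooth1 (plateau a b N).
Proof.
move=> k; have Cb : Ck k (fun x => 1 + (-1) * (flat 0 (1 * x + (- a)) * flat 0 ((-1) * x + b))).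
  apply: CkD; first exact: Ck_cst.
  apply: CkM; first exact: Ck_cst.
  by apply: CkM; apply: Ck_affine; exact: smooth1_flat.
rewrite (_ : plateau _ _ _ = fun x => 1 + (-1) * (1 + (-1) *
  (flat 0 (1 * x + (- a)) * flat 0 ((-1) * x + b))) ^+ N.+1); last first.
  by apply/funext => x; rewrite /plateau !mulN1r mul1r [(- x + b)%R]addrC.
apply: CkD; first exact: Ck_cst.
apply: CkM; first exact: Ck_cst.
elim: N => [|N IHN]; first by under eq_fun do rewrite expr1.
by under eq_fun do rewrite exprS; exact: CkM.
Qed.

Lemma plateau_base a b x : 0 <= 1 - flat 0 (x - a) * flat 0 (b - x) <= 1.
Proof.
have /andP[u0 u1] := flat_ge0_le1 (x - a); have /andP[v0 v1] := flat_ge0_le1 (b - x).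
by rewrite subr_ge0 mulr_ile1//= gerBl mulr_ge0.
Qed.

Lemma plateau_ge0_le1 a b N x : 0 <= plateau a b N x <= 1.
Proof.
have /andP[h0 h1] := plateau_base a b x.
by rewrite subr_ge0 exprn_ile1//= gerBl exprn_ge0.
Qed.

Lemma plateau_out a b N x : x \notin `]a, b[ -> plateau a b N x = 0.
Proof.
rewrite in_itv/= negb_and -!leNgt => h; rewrite /plateau.
rewrite (_ : _ * _ = 0) ?subr0 ?expr1n ?subrr//.
by case/orP: h => h; rewrite /flat ?[0 < x - a]ltNge ?[0 < b - x]ltNge ?subr_le0 h ?mul0r ?mulr0.
Qed.

Lemma plateau_cvg a b x : plateau a b N x @[N --> \oo] --> (\1_`]a, b[ x : R).
Proof.
have [xab|xab] := boolP (x \in `]a, b[); last first.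
  under eq_fun do rewrite plateau_out//.
  by rewrite indicE memNset//=; [exact: cvg_cst|exact/negP].
rewrite indicE mem_set// -[1%:R]subr0; apply: cvgB; first exact: cvg_cst.
have : (1 - flat 0 (x - a) * flat 0 (b - x)) ^+ N @[N --> \oo] --> (0 : R).
  apply: cvg_expr; have /andP[h0 _] := plateau_base a b x.
  rewrite ger0_norm// gtrBl mulr_gt0//.
    by rewrite /flat subr_gt0 (itvP xab) mulr_gt0 ?expR_gt0 ?exprn_gt0 ?invr_gt0 ?subr_gt0 ?(itvP xab).
  by rewrite /flat subr_gt0 (itvP xab) mulr_gt0 ?expR_gt0 ?exprn_gt0 ?invr_gt0 ?subr_gt0 ?(itvP xab).
by rewrite -(cvg_shiftS).
Qed.

End smooth1.

(** * The fundamental lemma of the calculus of variations *)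

Section product_test.
Local Open Scope ring_scope.
Context {R : realType} {n : nat}.
Implicit Types (psi : 'I_n -> R -> R) (x : 'rV[R]_n).

Definition prodf psi x : R := \prod_(i < n) psi i (x ord0 i).

Lemma is_derive_prodf psi (i : 'I_n) g x :
  is_derive (x ord0 i) (1 : R) (psi i) (g (x ord0 i)) ->
  is_derive x (delta_mx ord0 i) (prodf psi)
    (prodf (fun j => if j == i then g else psi j) x).
Proof.
move=> [/cvg_ex[/= l hl] dv].
have {dv} lE : l = g (x ord0 i) by rewrite -dv; apply/esym/(cvg_lim _ hl).
pose c := \prod_(j < n | j != i) psi j (x ord0 j).
have L : h^-1 *: (prodf psi (h *: delta_mx ord0 i + x) - prodf psi x) @[h --> 0^'] --> c * l.
  rewrite (_ : (fun h => _) =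
      (fun h => c * (h^-1 *: (psi i (h *: (1 : R) + x ord0 i) - psi i (x ord0 i))))).
    by apply: cvgM => //; exact: cvg_cst.
  apply/funext => h; rewrite /prodf (bigD1 i)//= [X in _ *: (_ - X)](bigD1 i)//= -/c.
  rewrite !mxE !eqxx /=.
  rewrite (eq_bigr (fun j => psi j (x ord0 j))) -/c; last first.
    by move=> j ji; rewrite !mxE eqxx /= (negbTE ji) mulr0 add0r.
  rewrite /GRing.scale/=; set A := psi i _; set B := psi i _; ring.
have -> : prodf (fun j => if j == i then g else psi j) x = c * l.
  rewrite /prodf (bigD1 i)//= eqxx lE mulrC; congr (_ * _).
  by apply: eq_bigr => j /negbTE ->.
by apply: DeriveDef; [exact: cvgP L|exact: cvg_lim L].
Qed.

Lemma continuous_prodf psi : (forall i, continuous (psi i)) -> continuous (prodf psi).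
Proof.
move=> cpsi; rewrite /prodf; elim: (index_enum _) => [|i s IHs].
  by under eq_fun do rewrite big_nil; exact: cst_continuous.
under eq_fun do rewrite big_cons.
move=> x.
have cx : psi i (y ord0 i) @[y --> x] --> psi i (x ord0 i).
  exact: (cvg_comp (fun y : 'rV[R]_n => y ord0 i) (psi i)
    (@coord_continuous R 1 n ord0 i x) (cpsi i (x ord0 i))).
exact: (@continuousM R _ (fun y : 'rV[R]_n => psi i (y ord0 i)) _ x cx (IHs x)).
Qed.

Lemma smooth_prodf psi : (forall i, smooth1 (psi i)) -> smooth (prodf psi).
Proof.
move=> spsi s.
have [psi' [spsi' ->]] : exists psi', (forall i, smooth1 (psi' i)) /\
    foldr partial (prodf psi) s = prodf psi'.
  elim: s => [|i s [psi' [spsi' /= ->]]]; first by exists psi.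
  exists (fun j => if j == i then derive1 (psi' i) else psi' j); split.
    by move=> j; case: ifPn => // _; exact: (smooth1_derive (spsi' i)).2.
  apply/funext => x; rewrite /partial; apply: derive_val.
  by apply: is_derive_prodf; exact: (smooth1_derive (spsi' i)).1.
split; first by apply: continuous_prodf => i; exact: (Ck_continuous (spsi' i 0%N)).
move=> i x; apply: ex_derive.
by apply: is_derive_prodf; exact: (smooth1_derive (spsi' i)).1.
Qed.

Lemma compact_cbox (a b : 'I_n -> R) :
  compact [set x : 'rV[R]_n | forall i, x ord0 i \in `[a i, b i]].
Proof.
by apply: (@rV_compact R n (fun i => `[a i, b i]%classic)) => i; exact: segment_compact.
Qed.

Lemma test_prodf psi (a b : 'I_n -> R) : (forall i, smooth1 (psi i)) ->
  (forall i t, t \notin `]a i, b i[ -> psi i t = 0) -> test_function (prodf psi).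
Proof.
move=> spsi psi0; split; first exact: smooth_prodf.
apply: (subclosed_compact _ (@compact_cbox a b)); first exact: closed_closure.
have /closure_id -> : closed [set x : 'rV[R]_n | forall i, x ord0 i \in `[a i, b i]].
  by apply: compact_closed; [exact: norm_hausdorff|exact: (@compact_cbox a b)].
apply: closureS => x /= px i; apply: subset_itv_oo_cc.
apply/negPn/negP => /psi0 h; move/eqP: px; apply.
by rewrite /prodf (bigD1 i)//= h mul0r.
Qed.

End product_test.

Section du_bois_reymond.
Context {R : realType} {n : nat}.
Implicit Types (g : 'rV[R]_n -> R) (a b : 'I_n -> R).
Local Notation m := (@lebesgue_rV R n).

Definition obox a b := [set x : 'rV[R]_n | forall i, x ord0 i \in `]a i, b i[%R].
Definition cbox a b := [set x : 'rV[R]_n | forall i, x ord0 i \in `[a i, b i]%R].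

Lemma obox_exhaust x : exists k : nat, obox (fun=> - k%:R)%R (fun=> k%:R) x.
Proof.
exists (\max_(j < n) (Num.truncn `|x ord0 j|).+1)%N => j.
rewrite in_itv/= -ltr_norml (lt_le_trans (truncnS_gt _))// ler_nat.
exact: (leq_bigmax j).
Qed.

Lemma measurable_obox a b : measurable (obox a b).
Proof. by apply: (@measurable_box _ _ (fun i => `]a i, b i[%classic)) => i. Qed.

Lemma measurable_cbox a b : measurable (cbox a b).
Proof. by apply: (@measurable_box _ _ (fun i => `[a i, b i]%classic)) => i. Qed.

Lemma obox_sub_cbox a b : obox a b `<=` cbox a b.
Proof. by move=> x h i; apply: subset_itv_oo_cc; exact: h. Qed.

Lemma loc_integrable_cbox g a b : loc_integrable g ->
  m.-integrable (cbox a b) (EFin \o g).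
Proof.
move=> [mg /(_ _ (@compact_cbox R n a b)) lg]; apply/integrableP; split => //.
by apply/measurable_EFinP; exact: measurable_funS mg.
Qed.

Lemma cvg_prod (I : Type) (s : seq I) (F : I -> nat -> R) (l : I -> R) :
  (forall i, F i N @[N --> \oo] --> l i) ->
  (\prod_(i <- s) F i N)%R @[N --> \oo] --> (\prod_(i <- s) l i)%R.
Proof.
move=> Fl; elim: s => [|i s IHs].
  by under eq_fun do rewrite big_nil; rewrite big_nil; exact: cvg_cst.
under eq_fun do rewrite big_cons.
by rewrite big_cons; exact: (cvgM (Fl i) IHs).
Qed.

Lemma integral_support (D : set 'rV[R]_n) (f : 'rV[R]_n -> \bar R) :
  (forall x, ~ D x -> f x = 0) -> \int[m]_x f x = \int[m]_(x in D) f x.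
Proof.
move=> f0; rewrite [RHS]integral_mkcond; apply: eq_integral => x _.
by rewrite patchE; case: ifPn => // /negP xD; apply: f0; apply: contra_not xD => /mem_set.
Qed.

Definition box_test a b N := prodf (fun i => plateau (a i) (b i) N).

(** Products of plateaus increase to the indicator of the box, so dominated convergence
    passes to the limit in the integrals against them. *)
Lemma integral_obox_eq0 g a b : loc_integrable g ->
  (forall phi, test_function phi -> (\int[m]_x (g x * phi x) = 0)%R) ->
  \int[m]_(x in obox a b) (g x)%:E = 0.
Proof.
move=> lg gphi; have ig := loc_integrable_cbox a b lg.
have mg : measurable_fun setT g by case: lg.
pose phi := box_test a b.
have tphi N : test_function (phi N).
  apply: (@test_prodf _ _ _ a b) => [i|i x]; first exact: smooth1_plateau.
  exact: plateau_out.
have mphi N : measurable_fun setT (phi N).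
  by apply: continuous_measurable_rV; have [/(_ [::])[]] := tphi N.
have phi01 N x : (`|phi N x| <= 1)%R.
  rewrite /phi/box_test/prodf normr_prod prodr_ile1// => i _.
  by have /andP[h0 h1] := plateau_ge0_le1 (a i) (b i) N (x ord0 i); rewrite normr_ge0 ger0_norm.
have phi_out N x : ~ cbox a b x -> phi N x = 0%R.
  move=> /existsNP[i /negP xi]; rewrite /phi/box_test/prodf (bigD1 i)//= plateau_out ?mul0r//.
  by apply: contra xi; exact: subset_itv_oo_cc.
have gphi_le N x : (`|(g x * phi N x)%:E| <= `|(g x)%:E|).
  by rewrite lee_fin normrM ler_piMr.
have mgphi N : measurable_fun (cbox a b) (fun x => (g x * phi N x)%:E).
  by apply/measurable_EFinP; apply: measurable_funTS; exact: measurable_funM.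
have igphi N : m.-integrable (cbox a b) (fun x => (g x * phi N x)%:E).
  apply: le_integrable ig => //; first exact: measurable_cbox.
have int0 N : \int[m]_(x in cbox a b) (g x * phi N x)%:E = 0.
  have := gphi _ (tphi N); rewrite /Rintegral (integral_support (D := cbox a b)); last first.
    by move=> x /phi_out ->; rewrite mulr0.
  move=> h; rewrite -[LHS]fineK ?h//.
  by apply: integrable_fin_num => //; exact: measurable_cbox.
have cvgf x : (g x * phi N x)%:E @[N --> \oo] --> (g x * \1_(obox a b) x)%:E.
  apply: cvg_EFin; first exact: nearW.
  apply: cvgM; first exact: cvg_cst.
  rewrite (_ : \1_(obox a b) x = (\prod_(i < n) (\1_`]a i, b i[ (x ord0 i)))%R).
    by apply: cvg_prod => i; exact: plateau_cvg.
  have [h|/existsNP[i /negP xi]] := pselect (obox a b x).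
    by rewrite indicE mem_set// big1// => i _; rewrite indicE mem_set//; exact: h.
  rewrite indicE memNset; last by move/(_ i); exact/negP.
  by rewrite (bigD1 i)//= indicE memNset ?mul0r//; exact/negP.
have mlim : measurable_fun (cbox a b) (fun x => (g x * \1_(obox a b) x)%:E).
  apply/measurable_EFinP; apply: measurable_funTS; apply: measurable_funM => //.
  by apply: measurable_indic; exact: measurable_obox.
have [_ _ ] := dominated_convergence (measurable_cbox a b) mgphi mlim
  (aeW m (fun x _ => cvgf x)) (integrable_abse ig)
  (aeW m (fun x N _ => gphi_le N x)).
under [X in X @ _ --> _]eq_fun do rewrite int0.
move=> /(cvg_lim (@ereal_hausdorff R)); rewrite lim_cst// => /esym <-.
rewrite -[RHS](integral_support); last first.
  move=> x xc; rewrite indicE memNset ?mulr0//; apply: contra_not xc; exact: obox_sub_cbox.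
rewrite (integral_support (D := obox a b)); last first.
  by move=> x xo; rewrite indicE memNset ?mulr0.
by apply: eq_integral => x xo; rewrite indicE xo mulr1.
Qed.

(** Every strip in one coordinate direction is a countable increasing union of
    open boxes. *)
Lemma obox_generate :
  @measurable _ 'rV[R]_n = <<s [set A | exists a b, A = obox a b] >>.
Proof.
set G := [set A | _].
apply/seteqP; split; last first.
  apply: smallest_sub; first exact: sigma_algebra_measurable.
  by move=> _ [a [b ->]]; exact: measurable_obox.
have mid : measurable_fun [set: g_sigma_algebraType G] (id : _ -> 'rV[R]_n).
  apply/measurable_rVP => i.
  apply: (measurability _ (@RGenOpens.measurableE R)) => _ [_ [s [t ->]] <-].
  rewrite setTI.
  pose lo (k : nat) j : R := if j == i then s else (- k%:R)%R.
  pose hi (k : nat) j : R := if j == i then t else k%:R.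
  rewrite (_ : _ @^-1` _ = \bigcup_k (obox (lo k) (hi k))); last first.
    apply/seteqP; split => x /=; last first.
      by move=> [k _ /(_ i)]; rewrite /lo/hi eqxx.
    move=> xi; have [k hk] := obox_exhaust x.
    by exists k => // j; rewrite /lo/hi; case: eqP => [->//|_]; exact: hk.
  apply: bigcupT_measurable => k; apply: sub_sigma_algebra.
  by exists (lo k), (hi k).
by move=> A mA; have := mid measurableT _ mA; rewrite setTI.
Qed.

Lemma oboxI a b a' b' : obox a b `&` obox a' b' =
  obox (fun i => Num.max (a i) (a' i)) (fun i => Num.min (b i) (b' i)).
Proof.
apply/seteqP; split => x /=.
  move=> [h h'] i; have := h i; have := h' i; rewrite !in_itv/=.
  by rewrite gt_max lt_min => /andP[-> ->] /andP[-> ->].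
move=> h; split=> i; have := h i; rewrite !in_itv/= gt_max lt_min.
  by move=> /andP[/andP[-> _] /andP[-> _]].
by move=> /andP[/andP[_ ->] /andP[_ ->]].
Qed.

(** The fundamental lemma of the calculus of variations: the integral vanishes on
    open boxes, hence by Dynkin's theorem on all bounded measurable sets. *)
Lemma du_bois_reymond g : loc_integrable g ->
  (forall phi, test_function phi -> (\int[m]_x (g x * phi x) = 0)%R) ->
  {ae m, forall x, g x = 0%R}.
Proof.
move=> lg gphi; have mg : measurable_fun setT g by case: lg.
pose Q (k : nat) := obox (fun=> - k%:R)%R (fun=> k%:R).
have mQ k : measurable (Q k) by exact: measurable_obox.
have iQ k : m.-integrable (Q k) (EFin \o g).
  apply: (@integrableS _ _ _ _ (cbox (fun=> - k%:R)%R (fun=> k%:R))).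
  - exact: measurable_cbox.
  - exact: mQ.
  - exact: obox_sub_cbox.
  - exact: loc_integrable_cbox.
have PQ k (S : set 'rV[R]_n) : measurable S -> \int[m]_(x in S `&` Q k) (g x)%:E = 0.
  rewrite {1}obox_generate; move: S; apply: (@dynkin_induction _ _ _
    (fun S => \int[m]_(x in S `&` Q k) (g x)%:E = 0) obox_generate).
  - move=> _ _ [a [b ->]] [a' [b' ->]]; rewrite oboxI; by eexists; eexists.
  - by rewrite setTI; exact: integral_obox_eq0.
  - by move=> _ [a [b ->]]; rewrite oboxI; exact: integral_obox_eq0.
  - move=> S mS S0.
    have : \int[m]_(x in (S `&` Q k) `|` (~` S `&` Q k)) (g x)%:E = 0.
      by rewrite -setIUl setUCr setTI; exact: integral_obox_eq0.
    rewrite integral_setU ?S0 ?add0e//.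
    + exact: measurableI.
    + by apply: measurableI => //; exact: measurableC.
    + by apply/measurable_EFinP; exact: measurable_funTS.
    + by apply/disj_setPS => x [[Sx _] [nSx _]]; exact: nSx.
  - move=> F mF tF F0; rewrite setI_bigcupl integral_bigcup.
    + by rewrite eseries0// => i _ _; exact: F0.
    + by apply: trivIset_setIr.
    + by move=> i; exact: measurableI.
    + apply: integrableS (iQ k) => //.
        by apply: bigcupT_measurable => i; exact: measurableI.
      by apply: bigcup_sub => i _; exact: subIsetr.
have ae0 k : {ae m, forall x, Q k x -> g x = 0%R}.
  have intE E : E `<=` Q k -> measurable E ->
      \int[m]_(x in E) (g x)%:E = \int[m]_(x in E) cst 0 x.
    by move=> EQ mE; rewrite integral0 -[X in \int[m]_(_ in X) _](setIidl EQ); exact: PQ.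
  have := integral_ae_eq (mQ k) (iQ k) (measurable_cst _) intE.
  by apply: filterS => x h /h [].
have : {ae m, forall x k, Q k x -> g x = 0%R}.
  apply/ae_foralln => k; exact: ae0.
by apply: filterS => x h; have [k] := obox_exhaust x; exact: h.
Qed.

End du_bois_reymond.

(** * Test functions *)

Section test_tools.
Local Open Scope ring_scope.
Context {R : realType} {n : nat}.
Implicit Types (phi : 'rV[R]_n -> R) (x v : 'rV[R]_n) (i : 'I_n).

Definition cube (M : R) : set 'rV[R]_n := cbox (fun=> - M) (fun=> M).

Lemma cubeP M x : cube M x <-> forall i, `|x ord0 i| <= M.
Proof. by split=> h i; have := h i; rewrite in_itv/= -ler_norml. Qed.

Lemma cube_exhaust x : exists k : nat, cube k%:R x.
Proof. by have [k] := obox_exhaust x; exists k; exact: obox_sub_cbox. Qed.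

Lemma coord_le_norm x i : `|x ord0 i| <= `|x|.
Proof.
rewrite [leRHS](_ : _ = mx_norm x)// mx_normE -[leLHS]nngE num_le.
exact: (@le_bigmax _ _ _ _ (fun ij => `|x ij.1 ij.2|%:nng) (ord0, i)).
Qed.

Lemma compact_sub_cube (K : set 'rV[R]_n) : compact K ->
  exists2 M, 0 < M & K `<=` cube M.
Proof.
move=> /compact_bounded[M [_ hM]]; exists (`|M| + 1); first by rewrite ltr_wpDl.
move=> x Kx; apply/cubeP => i; apply: (le_trans (coord_le_norm x i)).
by apply: hM => //; rewrite ltr_pwDr// ler_norm.
Qed.

Lemma cube_shift M N x v : (forall i, `|v ord0 i| <= N) ->
  cube M (x + v) -> cube (M + N) x.
Proof.
move=> vN /cubeP h; apply/cubeP => i; have := h i; rewrite mxE => {}h.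
rewrite -[x ord0 i](addrK (v ord0 i)).
by rewrite (le_trans (ler_normB _ _))// lerD.
Qed.

Lemma test_function_bounded phi : test_function phi ->
  (exists2 C, 0 < C & forall x, `|phi x| <= C) /\
  (exists2 M, 0 < M & forall x, ~ cube M x -> phi x = 0).
Proof.
move=> [sphi cK]; have cphi : continuous phi by case: (sphi [::]).
set K := closure _ in cK.
have phi0 x : ~ K x -> phi x = 0.
  move=> nK; apply/eqP; apply: contra_notT nK => px.
  by apply: subset_closure.
split; last first.
  have [M M0 KM] := compact_sub_cube cK; exists M => // x Mx; apply: phi0.
  by move=> /KM.
have [C [_ hC]] : bounded_set (phi @` K : set R).
  apply: compact_bounded; apply: continuous_compact => //.
  by apply: continuous_subspaceT.
exists (`|C| + 1); first by rewrite ltr_wpDl.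
move=> x; have [Kx|/phi0 ->] := pselect (K x); last by rewrite normr0 addr_ge0.
by apply: hC; [rewrite ltr_pwDr// ler_norm|exists x].
Qed.

Lemma test_function_continuous phi : test_function phi -> continuous phi.
Proof. by move=> [/(_ [::])[]]. Qed.

Lemma measurable_test_function phi : test_function phi -> measurable_fun setT phi.
Proof. by move=> /test_function_continuous/continuous_measurable_rV. Qed.

Lemma test_function_partial phi i : test_function phi -> test_function (partial i phi).
Proof.
move=> [sphi cK]; split.
  by move=> s; have := sphi (rcons s i); rewrite foldr_rcons.
apply: (subclosed_compact _ cK); first exact: closed_closure.
rewrite [X in _ `<=` X]((closure_id _).1 (@closed_closure _ _)).
apply: closureS => x /=; apply: contraNP => xK; apply/eqP.
have : \near x, phi x = cst 0 x.
  have : nbhs x (~` closure [set x | phi x != 0]).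
    by apply: open_nbhs_nbhs; split => //; apply: closed_openC; exact: closed_closure.
  apply: filterS => y yK; apply/eqP; apply: contra_notT yK => ?; exact: subset_closure.
by move=> /(near_eq_derive (delta_mx ord0 i)); rewrite /partial => ->; exact: derive_cst.
Qed.

Lemma growth_rate_shift phi v w x :
  (fun h : R => h^-1 *: (phi (h *: w + x + v) - phi (x + v))) =
  (fun h : R => h^-1 *: (phi (h *: w + (x + v)) - phi (x + v))).
Proof. by apply/funext => h; rewrite addrA. Qed.

Lemma partial_shift phi v i : partial i (fun y => phi (y + v)) = (fun y => partial i phi (y + v)).
Proof. by apply/funext => x; rewrite /partial /derive growth_rate_shift. Qed.

Lemma test_function_shift phi v : test_function phi -> test_function (fun y => phi (y + v)).
Proof.
move=> tphi; have [sphi _] := tphi; split.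
  move=> s.
  have -> : foldr partial (fun y => phi (y + v)) s = fun y => foldr partial phi s (y + v).
    by elim: s => [//|i s /= ->]; rewrite partial_shift.
  have [c d] := sphi s; split => [x|i x].
    have cx : y + v @[y --> x] --> x + v.
      by have := @continuousD R _ _ (@id 'rV[R]_n) (cst v) x (@cvg_id _ _) (@cst_continuous _ _ _ _).
    exact: (cvg_comp (fun y => y + v) (foldr partial phi s) cx (c (x + v))).
  by have := d i (x + v); rewrite /derivable growth_rate_shift.
have [_ [M M0 hM]] := test_function_bounded tphi.
pose N := `|v|.
have vN i : `|v ord0 i| <= N by exact: coord_le_norm.
apply: (@subclosed_compact _ _ (cube (M + N))); first exact: closed_closure.
  exact: compact_cbox.
have -> : cube (M + N) = closure (cube (M + N)).
  apply/closure_id; apply: compact_closed; first exact: norm_hausdorff.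
  exact: compact_cbox.
apply: closureS => x /=; apply: contraNP => xc; apply/eqP; apply: hM.
by apply: contra_not xc; exact: cube_shift.
Qed.

(** The chain rule along a segment parametrised by the unit interval, for use in
    [FTC_line]. *)
Lemma is_derive_line phi x (k : R) i (l : R) : test_function phi ->
  is_derive l (1 : R) (fun l => phi (x + (l * k) *: delta_mx ord0 i))
    (k * partial i phi (x + (l * k) *: delta_mx ord0 i)).
Proof.
move=> [sphi _]; set e := delta_mx ord0 i.
have d1 s : is_derive s (1 : R) (fun s => phi (x + s *: e)) (partial i phi (x + s *: e)).
  have [_ /(_ i (x + s *: e))] := sphi [::].
  rewrite /derivable /= => /cvg_ex[a ha].
  have E : (fun h => h^-1 *: (phi (x + (h *: (1 : R) + s) *: e) - phi (x + s *: e))) =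
      (fun h => h^-1 *: (phi (h *: e + (x + s *: e)) - phi (x + s *: e))).
    apply/funext => h; congr (_ *: (phi _ - _)).
    by rewrite scalerDl [h *: 1]mulr1 addrCA.
  have -> : partial i phi (x + s *: e) = a by apply: cvg_lim ha.
  apply: DeriveDef; first by rewrite /derivable E; exact: cvgP ha.
  by rewrite /derive E; exact: cvg_lim ha.
rewrite mulrC.
have d2 : is_derive l (1 : R) (fun l => l * k) k.
  have : is_derive l (1 : R) (k *: id : R -> R) (k *: 1) by exact: is_deriveZ.
  rewrite /GRing.scale/= mulr1.
  by rewrite (_ : (fun l => l * k) = (k \*: id)%R)//; apply/funext => y; rewrite mulrC.
exact: (@is_derive1_comp R (fun s => phi (x + s *: e)) (fun l => l * k)).
Qed.

End test_tools.

(** * Parametric integrals and the unit interval *)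

Lemma measurable_integral_snd d1 d2 (T1 : measurableType d1) (T2 : measurableType d2)
    (R : realType) (m2 : {sigma_finite_measure set T2 -> \bar R}) (f : T1 * T2 -> \bar R) :
  measurable_fun setT f -> measurable_fun setT (fun x => \int[m2]_y f (x, y)).
Proof.
move=> mf; under eq_fun do rewrite integralE.
apply: emeasurable_funB.
- have := @measurable_fun_fubini_tonelli_F _ _ _ _ _ m2 _ (measurable_funepos mf) (funepos_ge0 f).
  by congr (measurable_fun _ _); apply/funext => x; apply: eq_integral => y _; rewrite !funeposE.
- have := @measurable_fun_fubini_tonelli_F _ _ _ _ _ m2 _ (measurable_funeneg mf) (funeneg_ge0 f).
  by congr (measurable_fun _ _); apply/funext => x; apply: eq_integral => y _; rewrite !funenegE.
Qed.

Lemma measurable_integral_fst d1 d2 (T1 : measurableType d1) (T2 : measurableType d2)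
    (R : realType) (m1 : {sigma_finite_measure set T1 -> \bar R}) (f : T1 * T2 -> \bar R) :
  measurable_fun setT f -> measurable_fun setT (fun y => \int[m1]_x f (x, y)).
Proof.
move=> mf; apply: (@measurable_integral_snd _ _ _ _ _ m1 (fun yx => f (yx.2, yx.1))).
by apply: (measurableT_comp mf); apply/measurable_fun_pairP; split => /=;
  [exact: measurable_snd|exact: measurable_fst].
Qed.

Section unit_interval.
Context {R : realType} {n : nat}.
Implicit Types (phi : 'rV[R]_n -> R) (x v : 'rV[R]_n) (i : 'I_n).
Local Notation U := (uniform_prob (@ltr01 R)).

Lemma integral_unit (F : measurableTypeR R -> \bar R) : measurable_fun setT F ->
  \int[U]_l F l = \int[lebesgue_measure]_(l in `[0%R, 1%R]) F l.
Proof.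
move=> mF; rewrite integralE [RHS]integralE.
rewrite !integral_uniform//; [|exact: measurable_funeneg|exact: measurable_funepos].
by rewrite subr0 invr1 !mul1e.
Qed.

Lemma ge0_unit_le (F : measurableTypeR R -> \bar R) c : measurable_fun setT F ->
  (forall l, 0 <= F l) -> (forall l, l \in `[0%R, 1%R] -> F l <= c) ->
  \int[U]_l F l <= c.
Proof.
move=> mF F0 Fc; have c0 : 0 <= c.
  by apply: le_trans (Fc 0%R _) => //; rewrite in_itv/= lexx ler01.
rewrite integral_unit//.
apply: (@le_trans _ _ (\int[lebesgue_measure]_(l in `[0%R, 1%R]) (fun=> c) l)).
  by apply: ge0_le_integral => //; exact: measurable_funTS.
by rewrite integral_cst//= lebesgue_measure_itv/= lte01 oppr0 adde0 mule1.
Qed.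

Lemma measurable_segment (k : R) v :
  measurable_fun setT (fun yl : 'rV[R]_n * measurableTypeR R => (yl.1 + (yl.2 * k) *: v)%R).
Proof.
apply: measurable_addv; first exact: measurable_fst.
apply: measurable_scalev => //.
by apply: measurable_funM => //; exact: measurable_snd.
Qed.

Lemma measurable_line (k : R) x v :
  measurable_fun setT (fun l : measurableTypeR R => (x + (l * k) *: v)%R).
Proof.
apply: measurable_addv => //; apply: measurable_scalev => //.
by apply: measurable_funM.
Qed.

Lemma continuous_line phi x (k : R) i : test_function phi ->
  continuous (fun l : R => phi (x + (l * k) *: delta_mx ord0 i)%R).
Proof.
move=> tphi l; apply: differentiable_continuous; apply/derivable1_diffP.
by have [] := is_derive_line x k i l tphi.
Qed.

Lemma FTC_line phi x (k : R) i : test_function phi ->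
  \int[U]_l (k * partial i phi (x + (l * k) *: delta_mx ord0 i))%:E =
  (phi (x + k *: delta_mx ord0 i) - phi x)%:E.
Proof.
move=> tphi; set e := delta_mx ord0 i.
have mphi' := measurable_test_function (test_function_partial i tphi).
rewrite integral_unit; last first.
  apply/measurable_EFinP; apply: measurable_funM => //.
  exact: (measurableT_comp mphi' (measurable_line k x e)).
pose F (l : R) := phi (x + (l * k) *: e)%R.
have dF l := is_derive_line x k i l tphi.
have cF : continuous F by exact: continuous_line.
rewrite (@continuous_FTC2 _ _ F)//; last 3 first.
- apply: continuous_subspaceT => l.
  exact: (@continuousM R R (fun=> k) _ l (@cst_continuous _ _ _ _)
    (@continuous_line _ x k i (test_function_partial i tphi) l)).
- split => [l _||]; first by have [] := dF l.
  + exact/cvg_at_right_filter/cF.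
  + exact/cvg_at_left_filter/cF.
- by move=> l _; rewrite derive1E; exact: derive_val.
by rewrite -EFinB /F mul1r mul0r scale0r addr0.
Qed.

End unit_interval.

(** * Local integrability and segment averages *)

Section local_integrability.
Context {R : realType} {n : nat}.
Implicit Types (f g psi phi : 'rV[R]_n -> R) (x v : 'rV[R]_n) (i : 'I_n).
Local Notation m := (@lebesgue_rV R n).
Local Notation U := (uniform_prob (@ltr01 R)).
Local Notation e_ i := (delta_mx ord0 i : 'rV[R]_n).

Lemma measurable_cube M : measurable (@cube R n M).
Proof. exact: measurable_cbox. Qed.

Lemma segment_coord_le (l k : R) i : l \in `[0%R, 1%R] ->
  forall j, (`|((l * k) *: e_ i) ord0 j| <= `|k|)%R.
Proof.
rewrite in_itv/= => /andP[l0 l1] j; rewrite !mxE normrM normrM.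
rewrite (_ : `|_%:R| = (j == i)%:R)%R; last by rewrite eqxx /= normr_nat.
rewrite (ger0_norm l0); case: eqP => _; rewrite ?mulr1 ?mulr0//.
by rewrite ler_piMl.
Qed.

Lemma loc_integrable_lt f (M C : R) : loc_integrable f -> (0 <= C)%R ->
  \int[m]_(x in cube M) (C * `|f x|)%:E < +oo.
Proof.
move=> [mf lf] C0; have := lf _ (@compact_cbox R n (fun=> - M)%R (fun=> M)).
rewrite -/(cbox _ _) -/(cube _) => lt.
under eq_integral do rewrite EFinM.
rewrite ge0_integralZl//; first by rewrite lte_mul_pinfty// lee_fin.
- exact: measurable_cube.
- by apply/measurable_EFinP; apply: measurable_funTS; exact: measurableT_comp.
Qed.

Lemma bounded_support_le (c : R) psi M (C : R) x : (0 <= c)%R ->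
  (forall x, (`|psi x| <= C)%R) -> (forall x, ~ cube M x -> psi x = 0%R) ->
  (`|c * psi x| <= C * c * \1_(@cube R n M) x)%R.
Proof.
move=> c0 psiC psi0; have [xM|xM] := pselect (cube M x).
  by rewrite indicE mem_set// mulr1 normrM (ger0_norm c0) mulrC ler_wpM2r.
by rewrite psi0// indicE memNset// mulr0 normr0 mulr0.
Qed.

Lemma loc_integrable_mul f psi M (C : R) : loc_integrable f -> measurable_fun setT psi ->
  (forall x, (`|psi x| <= C)%R) -> (forall x, ~ cube M x -> psi x = 0%R) ->
  m.-integrable setT (fun x => (f x * psi x)%:E).
Proof.
move=> lf mpsi psiC psi0; have mf : measurable_fun setT f by case: lf.
have C0 : (0 <= C)%R by apply: le_trans (psiC 0%R).
apply/integrableP; split; first by apply/measurable_EFinP; exact: measurable_funM.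
apply: le_lt_trans (loc_integrable_lt M lf C0).
rewrite (integral_support (D := cube M)); last first.
  by move=> x /psi0 ->; rewrite mulr0 abse0.
apply: ge0_le_integral => //.
- exact: measurable_cube.
- apply: measurable_funTS; apply: measurableT_comp => //; apply/measurable_EFinP.
  exact: measurable_funM.
- apply: measurable_funTS; apply/measurable_EFinP; apply: measurable_funM => //.
  exact: measurableT_comp.
- by move=> x _; rewrite lee_fin normrM mulrC ler_wpM2r.
Qed.

Lemma weak_partialE i f g phi : is_weak_partial i f g -> test_function phi ->
  \int[m]_x (f x * partial i phi x)%:E = - \int[m]_x (g x * phi x)%:E.
Proof.
move=> [lf lg fg] tphi; have := fg _ tphi; rewrite /Rintegral => fgphi.
have int h psi : loc_integrable h -> test_function psi ->
    m.-integrable setT (fun x => (h x * psi x)%:E).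
  move=> lh tpsi; have [[C _ psiC] [M _ psi0]] := test_function_bounded tpsi.
  exact: (loc_integrable_mul lh (measurable_test_function tpsi) psiC psi0).
have i1 := integrable_fin_num measurableT (int _ _ lf (test_function_partial i tphi)).
have i2 := integrable_fin_num measurableT (int _ _ lg tphi).
by rewrite -[LHS]fineK// fgphi EFinN fineK.
Qed.

(** Only points of the cube of size M + |k|, on which f is integrable, start a segment
    that meets the support of psi. *)
Lemma segment_test_integrable f psi M (C k : R) i : loc_integrable f ->
  measurable_fun setT psi -> (forall x, (`|psi x| <= C)%R) ->
  (forall x, ~ cube M x -> psi x = 0%R) ->
  (m \x U).-integrable setT
    (fun yl => (f yl.1 * psi (yl.1 + (yl.2 * k) *: e_ i))%:E).
Proof.
move=> lf mpsi psiC psi0; have mf : measurable_fun setT f by case: lf.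
have C0 : (0 <= C)%R by apply: le_trans (psiC 0%R).
have mF : measurable_fun setT (fun yl : 'rV[R]_n * measurableTypeR R =>
    (f yl.1 * psi (yl.1 + (yl.2 * k) *: e_ i))%:E).
  apply/measurable_EFinP; apply: measurable_funM.
    exact: (measurableT_comp mf measurable_fst).
  exact: (measurableT_comp mpsi (measurable_segment _ _)).
apply/integrable12ltyP => //=.
have mB : measurable_fun setT (fun x => (C * `|f x| * \1_(@cube R n (M + `|k|)) x)%:E).
  apply/measurable_EFinP; apply: measurable_funM.
    by apply: measurable_funM => //; exact: measurableT_comp.
  by apply: measurable_indic; exact: measurable_cube.
apply: (@le_lt_trans _ _ (\int[m]_x (C * `|f x| * \1_(@cube R n (M + `|k|)) x)%:E)).
  apply: ge0_le_integral => //.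
  - by move=> x _; exact: integral_ge0.
  - apply: (@measurable_integral_snd _ _ _ _ _ U (fun yl : 'rV[R]_n * measurableTypeR R =>
      `|(f yl.1 * psi (yl.1 + (yl.2 * k) *: e_ i))%:E|)).
    exact: measurableT_comp.
  - move=> x _; apply: ge0_unit_le => //.
      have mFx : measurable_fun setT (fun l : measurableTypeR R =>
          (f x * psi (x + (l * k) *: e_ i))%:E) by exact: (measurableT_comp mF (pair1_measurable x)).
      exact: (measurableT_comp (@abse_measurable _ _) mFx).
    move=> l l01; rewrite lee_fin.
    have -> : (`|f x * psi (x + (l * k) *: e_ i)| =
        `| `|f x| * psi (x + (l * k) *: e_ i)|)%R by rewrite !normrM normr_id.
    apply: (@bounded_support_le _ (fun x => psi (x + (l * k) *: e_ i)%R)) => // y yM.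
    by apply: psi0; apply: contra_not yM; apply: cube_shift; exact: segment_coord_le.
rewrite (integral_support (D := cube (M + `|k|))); last first.
  by move=> x xM; rewrite indicE memNset// mulr0.
under eq_integral => x xM do rewrite indicE xM mulr1.
exact: loc_integrable_lt.
Qed.

Lemma segment_loc_integrable g psi M (C k : R) i : loc_integrable g ->
  measurable_fun setT psi -> (forall x, (`|psi x| <= C)%R) ->
  (forall x, ~ cube M x -> psi x = 0%R) ->
  (m \x U).-integrable setT
    (fun yl => (g (yl.1 + (yl.2 * k) *: e_ i) * psi yl.1)%:E).
Proof.
move=> lg mpsi psiC psi0; have mg : measurable_fun setT g by case: lg.
have C0 : (0 <= C)%R by apply: le_trans (psiC 0%R).
have mF : measurable_fun setT (fun yl : 'rV[R]_n * measurableTypeR R =>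
    (g (yl.1 + (yl.2 * k) *: e_ i) * psi yl.1)%:E).
  apply/measurable_EFinP; apply: measurable_funM.
    exact: (measurableT_comp mg (measurable_segment _ _)).
  exact: (measurableT_comp mpsi measurable_fst).
apply/integrable21ltyP => //=.
apply: le_lt_trans (loc_integrable_lt (M + `|k|) lg C0).
apply: ge0_unit_le => //.
- apply: (@measurable_integral_fst _ _ _ _ _ m (fun yl : 'rV[R]_n * measurableTypeR R =>
    `|(g (yl.1 + (yl.2 * k) *: e_ i) * psi yl.1)%:E|)) => //.
  exact: measurableT_comp.
- by move=> l; exact: integral_ge0.
- move=> l l01.
  pose v : 'rV[R]_n := ((l * k) *: e_ i)%R.
  have mh : measurable_fun setT (fun y : 'rV[R]_n => `|(g y * psi (y - v))%:E|).
    apply: measurableT_comp => //; apply/measurable_EFinP; apply: measurable_funM => //.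
    by apply: (measurableT_comp mpsi); exact: measurable_subv.
  have := integral_rV_shift v mh.
  under eq_integral do rewrite addrK.
  move=> ->.
  have vM x : ~ cube (M + `|k|) x -> psi (x - v)%R = 0%R.
    move=> xM; apply: psi0; apply: contra_not xM; apply: cube_shift => j.
    by rewrite mxE normrN; exact: segment_coord_le.
  rewrite (integral_support (D := cube (M + `|k|))); last first.
    by move=> x xM; rewrite vM// mulr0 abse0.
  apply: ge0_le_integral => //.
  + exact: measurable_cube.
  + exact: measurable_funTS.
  + apply: measurable_funTS; apply/measurable_EFinP; apply: measurable_funM => //.
    exact: measurableT_comp.
  + by move=> x _; rewrite lee_fin normrM mulrC ler_wpM2r.
Qed.

End local_integrability.

Lemma integrable_integral_fst d1 d2 (T1 : measurableType d1) (T2 : measurableType d2)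
    (R : realType) (m1 : {sigma_finite_measure set T1 -> \bar R})
    (m2 : {sigma_finite_measure set T2 -> \bar R}) (f : T1 * T2 -> \bar R) :
  (m1 \x m2).-integrable setT f -> m2.-integrable setT (fun y => \int[m1]_x f (x, y)).
Proof.
move=> fi; have mf := measurable_int _ fi.
apply/integrableP; split; first exact: (@measurable_integral_fst _ _ _ _ _ m1).
apply: le_lt_trans ((integrable21ltyP _ _ mf).1 fi).
apply: ge0_le_integral => //.
- exact: (measurableT_comp (@abse_measurable _ _) (@measurable_integral_fst _ _ _ _ _ m1 _ mf)).
- by apply: (@measurable_integral_fst _ _ _ _ _ m1 (abse \o f)); exact: measurableT_comp.
- move=> y _; apply: le_abse_integral => //.
  exact: (measurableT_comp mf (pair2_measurable y)).
Qed.

Section segment_average.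
Context {R : realType} {n : nat}.
Implicit Types (f g psi phi : 'rV[R]_n -> R) (x : 'rV[R]_n) (i : 'I_n).
Local Notation m := (@lebesgue_rV R n).
Local Notation U := (uniform_prob (@ltr01 R)).
Local Notation e_ i := (delta_mx ord0 i : 'rV[R]_n).

Lemma loc_integrable_cubeP f : measurable_fun setT f ->
  (forall M, \int[m]_(x in cube M) `|f x|%:E < +oo) -> loc_integrable f.
Proof.
move=> mf fM; split => // K cK; have [M _ KM] := compact_sub_cube cK.
apply: le_lt_trans (fM M); apply: ge0_subset_integral => //.
- rewrite -[K]setCK; apply: measurableC; apply: open_measurable_rV; apply: closed_openC.
  by apply: compact_closed => //; exact: norm_hausdorff.
- exact: measurable_cube.
- by apply/measurable_EFinP; apply: measurable_funTS; exact: measurableT_comp.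
Qed.

(** The function g is integrable along the segment only for almost every
    starting point y; elsewhere the value is meaningless. *)
Definition segment_mean g (h : R) i (y : 'rV[R]_n) : R :=
  fine (\int[U]_l (g (y + (l * h) *: e_ i)%R)%:E).

Lemma ae_segment_integrable g (h : R) i : loc_integrable g ->
  {ae m, forall y, U.-integrable setT (fun l => (g (y + (l * h) *: e_ i)%R)%:E)}.
Proof.
move=> lg; have : {ae m, forall y k, U.-integrable setT
    (fun l => (g (y + (l * h) *: e_ i) * \1_(@cube R n k%:R) y)%:E)}.
  apply/ae_foralln => k.
  pose psi : 'rV[R]_n -> R := \1_(@cube R n k%:R).
  have mpsi : measurable_fun setT psi by apply: measurable_indic; exact: measurable_cube.
  have psi1 x : (`|psi x| <= 1)%R by rewrite /psi indicE normr_nat; case: (_ \in _).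
  have psi0 x : ~ cube k%:R x -> psi x = 0%R by move=> xk; rewrite /psi indicE memNset.
  exact: (ae_integrable1 (segment_loc_integrable h i lg mpsi psi1 psi0)).
apply: filterS => y hy.
have [k yk] := cube_exhaust y; have := hy k; rewrite indicE mem_set//.
by under eq_fun do rewrite mulr1.
Qed.

Lemma measurable_segment_mean g (h : R) i : measurable_fun setT g ->
  measurable_fun setT (segment_mean g h i).
Proof.
move=> mg; apply: measurableT_comp => //.
apply: (@measurable_integral_snd _ _ _ _ _ U
  (fun yl : 'rV[R]_n * measurableTypeR R => (g (yl.1 + (yl.2 * h) *: e_ i))%:E)).
by apply/measurable_EFinP; exact: (measurableT_comp mg (measurable_segment _ _)).
Qed.

Lemma segment_mean_mul g psi (h : R) i (M C : R) : loc_integrable g ->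
  measurable_fun setT psi -> (forall x, (`|psi x| <= C)%R) ->
  (forall x, ~ cube M x -> psi x = 0%R) ->
  m.-integrable setT (fun y => (segment_mean g h i y * psi y)%:E) /\
  \int[m]_y (segment_mean g h i y * psi y)%:E =
  \int[U]_l \int[m]_y (g (y + (l * h) *: e_ i) * psi y)%:E.
Proof.
move=> lg mpsi psiC psi0; have mg : measurable_fun setT g by case: lg.
have int := segment_loc_integrable h i lg mpsi psiC psi0.
have E : ae_eq m setT (fun y => \int[U]_l (g (y + (l * h) *: e_ i) * psi y)%:E)
    (fun y => (segment_mean g h i y * psi y)%:E).
  have := ae_segment_integrable h i lg; apply: filterS => y iy _.
  under eq_integral do rewrite EFinM.
  rewrite integralZr// EFinM; congr (_ * _).
  by rewrite /segment_mean fineK//; exact: integrable_fin_num.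
have mS : measurable_fun setT (fun y => (segment_mean g h i y * psi y)%:E).
  by apply/measurable_EFinP; apply: measurable_funM => //; exact: measurable_segment_mean.
have iF := integrable_fubini_F int.
split.
  apply/integrableP; split => //.
  have /integrableP[mF] := iF; apply: le_lt_trans.
  apply: ae_ge0_le_integral => //; [exact: measurableT_comp|exact: measurableT_comp|].
  by move: E; apply: filterS => y /(_ I) <- _.
rewrite -(ae_eq_integral _ _ measurableT (measurable_int _ iF) mS E).
exact: (Fubini int).
Qed.

(** Tested against a smooth function, a translation difference of f is moved onto
    the test function, expanded there by the fundamental theorem of calculus, and
    the weak derivative brings the differentiated integral back as a mean of g. *)
Lemma weak_difference_test f g (h : R) i phi :
  is_weak_partial i f g -> test_function phi ->
  \int[m]_y (f y * (phi (y - h *: e_ i) - phi y))%:E =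
  h%:E * \int[m]_y (segment_mean g h i y * phi y)%:E.
Proof.
move=> fg tphi; have [lf lg _] := fg.
have mf : measurable_fun setT f by case: lf.
have mg : measurable_fun setT g by case: lg.
have [[C _ phiC] [M _ phi0]] := test_function_bounded tphi.
have [[C' _ phiC'] [M' _ phi0']] := test_function_bounded (test_function_partial i tphi).
have mphi := measurable_test_function tphi.
have mphi' := measurable_test_function (test_function_partial i tphi).
have [_ ->] := segment_mean_mul h i lg mphi phiC phi0.
pose k := (- h)%R.
have int := segment_test_integrable k i lf mphi' phiC' phi0'.
transitivity (\int[m]_y (k%:E * \int[U]_l (f y * partial i phi (y + (l * k) *: e_ i))%:E)).
  apply: eq_integral => y _; rewrite -scaleNr -/k EFinM -(FTC_line y k i tphi).
  have bl : U.-integrable setT (fun l => (partial i phi (y + (l * k) *: e_ i)%R)%:E).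
    apply: measurable_bounded_integrable => //.
    - by apply: (le_lt_trans (probability_le1 U measurableT)); rewrite ltry.
    - exact: (measurableT_comp mphi' (measurable_line k y (e_ i))).
    - exists C'; split; first exact: num_real.
      by move=> c Cc l _ /=; apply: le_trans (ltW Cc).
  under eq_integral do rewrite EFinM.
  rewrite integralZl// muleCA; congr (_ * _).
  by rewrite -integralZl.
rewrite integralZl//; last exact: (integrable_fubini_F int).
rewrite (Fubini int)/=.
have -> : h%:E = - k%:E by rewrite EFinN oppeK.
rewrite mulNe -muleN; congr (_ * _).
have intg := segment_test_integrable k i lg mphi phiC phi0.
transitivity (\int[U]_l - \int[m]_y (g y * phi (y + (l * k) *: e_ i))%:E).
  apply: eq_integral => l _.
  rewrite -(weak_partialE fg (test_function_shift ((l * k) *: e_ i)%R tphi)).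
  by apply: eq_integral => y _; rewrite partial_shift.
rewrite integralN; last exact/integrable_add_def/(integrable_integral_fst intg).
congr (- _); apply: eq_integral => l _.
have mh : measurable_fun setT (fun y => (g y * phi (y + (l * k) *: e_ i))%:E).
  apply/measurable_EFinP; apply: measurable_funM => //.
  by apply: (measurableT_comp mphi); exact: measurable_addv.
rewrite -(integral_rV_shift ((l * h) *: e_ i)%R mh).
by apply: eq_integral => y _; rewrite -addrA -scalerDl mulrN subrr scale0r addr0.
Qed.

End segment_average.

(** * Weak derivatives as difference quotients *)

Section weak_difference.
Context {R : realType} {n : nat}.
Implicit Types (f g psi phi : 'rV[R]_n -> R) (x v : 'rV[R]_n) (i : 'I_n).
Local Notation m := (@lebesgue_rV R n).
Local Notation e_ i := (delta_mx ord0 i : 'rV[R]_n).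

Lemma loc_integrableP f : loc_integrable f <->
  measurable_fun setT f /\ forall M, m.-integrable (cube M) (EFin \o f).
Proof.
split=> [lf|[mf fi]]; first by split; [case: lf|move=> M; exact: loc_integrable_cbox].
by apply: loc_integrable_cubeP => // M; have /integrableP[] := fi M.
Qed.

Lemma loc_integrableD f g : loc_integrable f -> loc_integrable g ->
  loc_integrable (fun x => f x + g x)%R.
Proof.
move=> /loc_integrableP[mf fi] /loc_integrableP[mg gi]; apply/loc_integrableP; split.
  exact: measurable_funD.
by move=> M; apply: (integrableD _ (fi M) (gi M)); exact: measurable_cube.
Qed.

Lemma loc_integrableZ (c : R) f : loc_integrable f -> loc_integrable (fun x => c * f x)%R.
Proof.
move=> /loc_integrableP[mf fi]; apply/loc_integrableP; split; first exact: measurable_funM.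
by move=> M; apply: (integrableZl _ c (fi M)); exact: measurable_cube.
Qed.

Lemma loc_integrable_shift f v : loc_integrable f -> loc_integrable (fun x => f (x + v)%R).
Proof.
move=> lf; have mf : measurable_fun setT f by case: lf.
have mfv : measurable_fun setT (fun x : 'rV[R]_n => f (x + v)%R).
  by apply: (measurableT_comp mf); exact: measurable_addv.
apply: loc_integrable_cubeP => // M.
apply: le_lt_trans (loc_integrable_lt (M + `|v|) lf ler01).
rewrite integral_mkcond.
pose F x := ((fun x => `|f x|%:E) \_ [set x | cube M (x - v)%R]) x.
have mMv : measurable [set x : 'rV[R]_n | cube M (x - v)%R].
  have mv : measurable_fun setT (fun x : 'rV[R]_n => (x - v)%R) by exact: measurable_subv.
  by rewrite -[X in measurable X]setTI; apply: mv => //; exact: measurable_cube.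
have mF : measurable_fun setT F.
  apply/(measurable_restrictT _ _).1 => //.
  by apply/measurable_EFinP; apply: measurable_funTS; exact: measurableT_comp.
have <- : \int[m]_x F (x + v)%R = \int[m]_x ((fun x => `|f (x + v)|%:E) \_ (cube M)) x.
  apply: eq_integral => x _; rewrite /F !patchE; congr (if _ then _ else _).
  by apply/idP/idP; rewrite !inE/= addrK.
rewrite integral_rV_shift//.
rewrite [leRHS]integral_mkcond; apply: ge0_le_integral => //.
- by move=> x _; rewrite /F patchE; case: ifPn.
- apply/(measurable_restrictT _ _).1; first exact: measurable_cube.
  apply/measurable_EFinP; apply: measurable_funTS; apply: measurable_funM => //.
  exact: measurableT_comp.
- move=> x _; rewrite /F !patchE; case: ifPn => [|_]; last by case: ifPn => // _; rewrite lee_fin mulr_ge0.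
  rewrite inE/= => xM; rewrite mul1r mem_set//.
  by apply: cube_shift xM => j; rewrite mxE normrN; exact: coord_le_norm.
Qed.

Lemma loc_integrable_segment_mean g (h : R) i : loc_integrable g ->
  loc_integrable (segment_mean g h i).
Proof.
move=> lg; have mg : measurable_fun setT g by case: lg.
apply/loc_integrableP; split; first exact: measurable_segment_mean.
move=> M; pose psi : 'rV[R]_n -> R := \1_(cube M).
have mpsi : measurable_fun setT psi by apply: measurable_indic; exact: measurable_cube.
have psi1 x : (`|psi x| <= 1)%R by rewrite /psi indicE normr_nat; case: (_ \in _).
have psi0 x : ~ cube M x -> psi x = 0%R by move=> xk; rewrite /psi indicE memNset.
have [iS _] := segment_mean_mul h i lg mpsi psi1 psi0.
have := integrableS measurableT (measurable_cube M) (@subsetT _ _) iS.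
apply: eq_integrable => [|x xM]; first exact: measurable_cube.
by rewrite /psi indicE xM mulr1.
Qed.

Lemma loc_integrable_test f phi : loc_integrable f -> test_function phi ->
  m.-integrable setT (fun x => (f x * phi x)%:E).
Proof.
move=> lf tphi; have [[C _ phiC] [M _ phi0]] := test_function_bounded tphi.
exact: loc_integrable_mul (measurable_test_function tphi) phiC phi0.
Qed.

(** Both sides have the same integral against every test function. The identity is
    the absolute continuity of f along coordinate lines, up to null sets. *)
Lemma weak_difference f g (h : R) i : is_weak_partial i f g ->
  {ae m, forall y, (f (y + h *: e_ i) - f y = h * segment_mean g h i y)%R}.
Proof.
move=> fg; have [lf lg _] := fg.
have mf : measurable_fun setT f by case: lf.
have lfh := loc_integrable_shift (h *: e_ i) lf.
have lS := loc_integrable_segment_mean h i lg.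
have lG := loc_integrableD (loc_integrableD lfh (loc_integrableZ (-1) lf)) (loc_integrableZ (- h) lS).
have : {ae m, forall y, (f (y + h *: e_ i) + -1 * f y + - h * segment_mean g h i y = 0)%R}.
  apply: (du_bois_reymond lG) => phi tphi.
  have mphi := measurable_test_function tphi.
  have i1 := loc_integrable_test lfh tphi.
  have i2 := loc_integrable_test lf tphi.
  have i3 := loc_integrable_test lS tphi.
  rewrite /Rintegral.
  rewrite (_ : \int[m]_x _ = \int[m]_x ((f (x + h *: e_ i)%R * phi x)%:E - (f x * phi x)%:E -
      h%:E * (segment_mean g h i x * phi x)%:E)); last first.
    by apply: eq_integral => x _; rewrite -EFinM -!EFinB; congr EFin; ring.
  rewrite integralB//; last 2 first.
  - exact: integrableB.
  - exact: integrableZl.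
  rewrite integralB// integralZl//.
  rewrite -(weak_difference_test h fg tphi).
  have mh : measurable_fun setT (fun y => (f y * phi (y - h *: e_ i))%:E).
    apply/measurable_EFinP; apply: measurable_funM => //.
    by apply: (measurableT_comp mphi); exact: measurable_subv.
  have E1 : \int[m]_y (f (y + h *: e_ i) * phi y)%:E = \int[m]_y (f y * phi (y - h *: e_ i))%:E.
    rewrite -(integral_rV_shift (h *: e_ i)%R mh).
    by apply: eq_integral => y _; rewrite addrK.
  have i1' := loc_integrable_test lf (test_function_shift (- (h *: e_ i))%R tphi).
  have -> : \int[m]_y (f y * (phi (y - h *: e_ i) - phi y))%:E =
      \int[m]_y (f y * phi (y - h *: e_ i))%:E - \int[m]_y (f y * phi y)%:E.
    rewrite -integralB//; apply: eq_integral => y _; rewrite mulrBr EFinB//.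
  rewrite E1 subee//.
  by rewrite fin_numB !integrable_fin_num.
apply: filterS => y hy; apply/eqP; rewrite -subr_eq0 -hy; apply/eqP; ring.
Qed.

End weak_difference.

(** * The heat semigroup *)

Section heat.
Context {R : realType} {n : nat}.
Implicit Types (f g psi phi : 'rV[R]_n -> R) (x v : 'rV[R]_n) (i : 'I_n).
Local Notation m := (@lebesgue_rV R n).

Lemma measurable_shear :
  measurable_fun setT (fun zy : 'rV[R]_n * 'rV[R]_n => (zy.2 + zy.1, zy.2)%R).
Proof.
apply/measurable_fun_pairP; split => /=; last exact: measurable_snd.
by apply: measurable_addv; [exact: measurable_snd|exact: measurable_fst].
Qed.

Lemma ge0_integral_shear (F : 'rV[R]_n * 'rV[R]_n -> \bar R) :
  measurable_fun setT F -> (forall xy, 0 <= F xy) ->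
  \int[m]_x \int[m]_y F (x, y) = \int[m]_z \int[m]_y F (y + z, y)%R.
Proof.
move=> mF F0; rewrite (fubini_tonelli F)//.
rewrite (fubini_tonelli (m1 := m) (m2 := m) (fun zy => F (zy.2 + zy.1, zy.2)%R))//; last first.
  exact: (measurableT_comp mF measurable_shear).
apply: eq_integral => y _.
rewrite -(ge0_integral_rV_shift y (f := fun x => F (x, y)))//.
  by apply: eq_integral => z _; rewrite addrC.
exact: (measurableT_comp mF (pair2_measurable y)).
Qed.

Lemma integrable_shear (F : 'rV[R]_n * 'rV[R]_n -> \bar R) :
  (m \x m).-integrable setT F ->
  (m \x m).-integrable setT (fun zy => F (zy.2 + zy.1, zy.2)%R).
Proof.
move=> iF; have mF := measurable_int _ iF.
apply/integrable12ltyP => /=; first exact: (measurableT_comp mF measurable_shear).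
rewrite -(@ge0_integral_shear (abse \o F))//=; last exact: measurableT_comp.
exact/(integrable12ltyP _ _ mF).
Qed.

(** Writing x = y + z turns convolution with a kernel in x - y into an average over z of
    translations by z. *)
Lemma integral_shear (F : 'rV[R]_n * 'rV[R]_n -> \bar R) :
  (m \x m).-integrable setT F ->
  \int[m]_x \int[m]_y F (x, y) = \int[m]_z \int[m]_y F (y + z, y)%R.
Proof.
move=> iF; have mF := measurable_int _ iF.
rewrite (Fubini iF) (Fubini (integrable_shear iF))/=.
apply: eq_integral => y _.
rewrite -(integral_rV_shift y (f := fun x => F (x, y)))//.
  by apply: eq_integral => z _; rewrite addrC.
exact: (measurableT_comp mF (pair2_measurable y)).
Qed.

(** A local condition, uniform under translation, that makes the convolution of f
    with the heat kernel converge almost everywhere. *)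
Definition uloc_integrable f := measurable_fun setT f /\
  forall M, exists C : R, forall v,
    \int[m]_y (`|f y| * \1_(@cube R n M) (y + v)%R)%:E <= C%:E.

Lemma uloc_loc_integrable f : uloc_integrable f -> loc_integrable f.
Proof.
move=> [mf uf]; apply: loc_integrable_cubeP => // M; have [C /(_ 0%R) hC] := uf M.
apply: (@le_lt_trans _ _ C%:E); last by rewrite ltry.
apply: le_trans hC; rewrite le_eqVlt; apply/orP; left; apply/eqP.
rewrite (integral_support (D := cube M)); last first.
  by move=> x xM; rewrite addr0 indicE memNset// mulr0.
by apply: eq_integral => x xM; rewrite addr0 indicE xM mulr1.
Qed.

Section fixed_time.
Variables (alpha : R).
Hypothesis alpha0 : (0 < alpha)%R.
Local Notation p := (@heat_kernel R n alpha).

Lemma measurable_heat_integrand f psi : measurable_fun setT f -> measurable_fun setT psi ->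
  measurable_fun setT (fun xy : 'rV[R]_n * 'rV[R]_n => (p (xy.1 - xy.2) * f xy.2 * psi xy.1)%:E).
Proof.
move=> mf mpsi; apply/measurable_EFinP; apply: measurable_funM.
  apply: measurable_funM; last exact: (measurableT_comp mf measurable_snd).
  apply: (measurableT_comp (measurable_heat_kernel alpha)).
  by apply: measurable_subv; [exact: measurable_fst|exact: measurable_snd].
exact: (measurableT_comp mpsi measurable_fst).
Qed.

Lemma heat_test_integrable f psi M (C : R) : uloc_integrable f ->
  measurable_fun setT psi -> (forall x, (`|psi x| <= C)%R) ->
  (forall x, ~ cube M x -> psi x = 0%R) ->
  (m \x m).-integrable setT (fun xy => (p (xy.1 - xy.2) * f xy.2 * psi xy.1)%:E).
Proof.
move=> [mf uf] mpsi psiC psi0.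
have C0 : (0 <= C)%R by apply: le_trans (psiC 0%R).
have mF := measurable_heat_integrand mf mpsi.
apply/integrable12ltyP => //.
rewrite (@ge0_integral_shear (fun xy => `|(p (xy.1 - xy.2) * f xy.2 * psi xy.1)%:E|))//=; last first.
  exact: (measurableT_comp (@abse_measurable _ _) mF).
have [A hA] := uf M.
apply: (@le_lt_trans _ _ (\int[m]_z ((C * A)%:E * (p z)%:E))); last first.
  rewrite ge0_integralZl//.
  - by rewrite integral_heat_kernel// mule1 ltry.
  - by apply/measurable_EFinP; exact: measurable_heat_kernel.
  - by move=> z _; rewrite lee_fin heat_kernel_ge0.
  - rewrite lee_fin mulr_ge0//.
    have := hA 0%R; rewrite -lee_fin; apply: le_trans.
    by apply: integral_ge0 => y _; rewrite lee_fin mulr_ge0.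
have mz z : measurable_fun setT (fun y : 'rV[R]_n => (`|f y| * \1_(@cube R n M) (y + z)%R)%:E).
  apply/measurable_EFinP; apply: measurable_funM; first exact: measurableT_comp.
  have mi : measurable_fun setT (\1_(@cube R n M) : 'rV[R]_n -> R).
    by apply: measurable_indic; exact: measurable_cube.
  by apply: (measurableT_comp mi); exact: measurable_addv.
apply: ge0_le_integral => //.
- by move=> z _; exact: integral_ge0.
- apply: (@measurable_integral_snd _ _ _ _ _ m (fun zy : 'rV[R]_n * 'rV[R]_n =>
    `|(p (zy.2 + zy.1 - zy.2) * f zy.2 * psi (zy.2 + zy.1)%R)%:E|)).
  apply: measurableT_comp => //.
  exact: (measurableT_comp mF measurable_shear).
- apply: emeasurable_funM => //; apply/measurable_EFinP; exact: measurable_heat_kernel.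
- move=> z _.
  apply: (@le_trans _ _ (\int[m]_y ((C * p z)%:E * (`|f y| * \1_(@cube R n M) (y + z)%R)%:E))).
    apply: ge0_le_integral => //.
    + apply: measurableT_comp => //; apply: measurableT_comp => //.
      have mzy : measurable_fun setT (fun y : 'rV[R]_n => (p (y + z - y) * f y * psi (y + z))%:E).
        exact: (measurableT_comp (measurableT_comp mF measurable_shear) (pair1_measurable z)).
      exact/measurable_EFinP.
    + exact: emeasurable_funM.
    + move=> y _; rewrite -EFinM /= lee_fin [(y + z)%R]addrC addrK.
      rewrite normrM (normrM (p z)) (ger0_norm (heat_kernel_ge0 _ _)).
      have [yM|yM] := pselect (cube M (z + y)%R).
        rewrite indicE mem_set// mulr1 [leRHS](_ : _ = p z * `|f y| * C)%R; last by ring.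
        by apply: ler_wpM2l; [rewrite mulr_ge0// heat_kernel_ge0|exact: psiC].
      by rewrite psi0// normr0 mulr0 indicE memNset// !mulr0.
  rewrite ge0_integralZl//.
  + rewrite [leRHS](_ : _ = (C * p z)%:E * A%:E); last by rewrite -!EFinM; congr EFin; ring.
    apply: lee_wpmul2l; last exact: hA.
    by rewrite lee_fin mulr_ge0// heat_kernel_ge0.
  + by rewrite lee_fin mulr_ge0// heat_kernel_ge0.
Qed.

Lemma heatE f x : heat alpha f x = fine (\int[m]_y (p (x - y) * f y)%:E).
Proof. by rewrite /heat gt_eqF. Qed.

Lemma measurable_heat f : measurable_fun setT f -> measurable_fun setT (heat alpha f).
Proof.
move=> mf; rewrite (funext (heatE f)).
apply: measurableT_comp => //.
apply: (@measurable_integral_snd _ _ _ _ _ m (fun xy : 'rV[R]_n * 'rV[R]_n =>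
    (p (xy.1 - xy.2) * f xy.2)%:E)).
have := measurable_heat_integrand mf (measurable_cst (1%R : R)).
by under eq_fun do rewrite mulr1.
Qed.

Lemma ae_heat_integrable f : uloc_integrable f ->
  {ae m, forall x, m.-integrable setT (fun y => (p (x - y) * f y)%:E)}.
Proof.
move=> uf; have : {ae m, forall x k, m.-integrable setT
    (fun y => (p (x - y) * f y * \1_(@cube R n k%:R) x)%:E)}.
  apply/ae_foralln => k.
  pose psi : 'rV[R]_n -> R := \1_(@cube R n k%:R).
  have mpsi : measurable_fun setT psi by apply: measurable_indic; exact: measurable_cube.
  have psi1 x : (`|psi x| <= 1)%R by rewrite /psi indicE normr_nat; case: (_ \in _).
  have psi0 x : ~ cube k%:R x -> psi x = 0%R by move=> xk; rewrite /psi indicE memNset.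
  exact: (ae_integrable1 (heat_test_integrable uf mpsi psi1 psi0)).
apply: filterS => y hy.
have [k yk] := cube_exhaust y; have := hy k; rewrite indicE mem_set//.
by under eq_fun do rewrite mulr1.
Qed.

Lemma heat_mul f psi M (C : R) : uloc_integrable f ->
  measurable_fun setT psi -> (forall x, (`|psi x| <= C)%R) ->
  (forall x, ~ cube M x -> psi x = 0%R) ->
  m.-integrable setT (fun x => (heat alpha f x * psi x)%:E) /\
  \int[m]_x (heat alpha f x * psi x)%:E =
  \int[m]_z \int[m]_y (p z * (f y * psi (y + z)%R))%:E.
Proof.
move=> uf mpsi psiC psi0; have mf : measurable_fun setT f by case: uf.
have int := heat_test_integrable uf mpsi psiC psi0.
have E : ae_eq m setT (fun x => \int[m]_y (p (x - y) * f y * psi x)%:E)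
    (fun x => (heat alpha f x * psi x)%:E).
  have := ae_heat_integrable uf; apply: filterS => x ix _.
  under eq_integral do rewrite EFinM.
  rewrite integralZr// EFinM; congr (_ * _).
  by rewrite heatE fineK//; exact: integrable_fin_num.
have mS : measurable_fun setT (fun x => (heat alpha f x * psi x)%:E).
  by apply/measurable_EFinP; apply: measurable_funM => //; exact: measurable_heat.
have iF := integrable_fubini_F int.
split.
  apply/integrableP; split => //.
  have /integrableP[mF] := iF; apply: le_lt_trans.
  apply: ae_ge0_le_integral => //; [exact: measurableT_comp|exact: measurableT_comp|].
  by move: E; apply: filterS => y /(_ I) <- _.
rewrite -(ae_eq_integral _ _ measurableT (measurable_int _ iF) mS E).
rewrite [LHS](integral_shear int)/=; apply: eq_integral => z _; apply: eq_integral => y _.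
by rewrite [(y + z - y)%R]addrAC subrr add0r mulrA.
Qed.

Lemma loc_integrable_heat f : uloc_integrable f -> loc_integrable (heat alpha f).
Proof.
move=> uf; have mf : measurable_fun setT f by case: uf.
apply/loc_integrableP; split; first exact: measurable_heat.
move=> M; pose psi : 'rV[R]_n -> R := \1_(cube M).
have mpsi : measurable_fun setT psi by apply: measurable_indic; exact: measurable_cube.
have psi1 x : (`|psi x| <= 1)%R by rewrite /psi indicE normr_nat; case: (_ \in _).
have psi0 x : ~ cube M x -> psi x = 0%R by move=> xk; rewrite /psi indicE memNset.
have [iS _] := heat_mul uf mpsi psi1 psi0.
have := integrableS measurableT (measurable_cube M) (@subsetT _ _) iS.
apply: eq_integrable => [|x xM]; first exact: measurable_cube.
by rewrite /psi indicE xM mulr1.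
Qed.

(** The semigroup commutes with weak derivatives: it is an average of translations,
    and a translate of a test function is a test function. *)
Lemma is_weak_partial_heat i f g : uloc_integrable f -> uloc_integrable g ->
  is_weak_partial i f g -> is_weak_partial i (heat alpha f) (heat alpha g).
Proof.
move=> uf ug fg; split; [exact: loc_integrable_heat|exact: loc_integrable_heat|].
move=> phi tphi; have [[C _ phiC] [M _ phi0]] := test_function_bounded tphi.
have tphi' := test_function_partial i tphi.
have [[C' _ phiC'] [M' _ phi0']] := test_function_bounded tphi'.
rewrite /Rintegral (heat_mul uf (measurable_test_function tphi') phiC' phi0').2.
have ig := heat_test_integrable ug (measurable_test_function tphi) phiC phi0.
have [ih ->] := heat_mul ug (measurable_test_function tphi) phiC phi0.
rewrite -fineN; congr fine.
have isg := integrable_fubini_F (integrable_shear ig).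
rewrite -integralN; last first.
  apply: integrable_add_def => //.
  move: isg; apply: eq_integrable => // z _.
  apply: eq_integral => y _ /=.
  by rewrite [(y + z - y)%R]addrAC subrr add0r mulrA.
apply: eq_integral => z _.
have i1 := loc_integrable_test (uloc_loc_integrable uf) (test_function_shift z tphi').
have i2 := loc_integrable_test (uloc_loc_integrable ug) (test_function_shift z tphi).
under eq_integral do rewrite EFinM.
rewrite integralZl//.
under [X in _ = - X]eq_integral do rewrite EFinM.
rewrite [X in _ = - X]integralZl// -muleN; congr (_ * _).
rewrite -(weak_partialE fg (test_function_shift z tphi)).
by apply: eq_integral => y _; rewrite partial_shift.
Qed.

End fixed_time.

Lemma weak_partial_unique i f g g' :
  is_weak_partial i f g -> is_weak_partial i f g' -> {ae m, forall x, g x = g' x}.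
Proof.
move=> fg fg'; have [lf lg _] := fg; have [_ lg' _] := fg'.
have : {ae m, forall x, (g x + -1 * g' x = 0)%R}.
  apply: (du_bois_reymond (loc_integrableD lg (loc_integrableZ (-1) lg'))) => phi tphi.
  have i1 := loc_integrable_test lg tphi.
  have i2 := loc_integrable_test lg' tphi.
  rewrite /Rintegral.
  rewrite (_ : \int[m]_x _ = \int[m]_x ((g x * phi x)%:E - (g' x * phi x)%:E)); last first.
    by apply: eq_integral => x _; rewrite -EFinB; congr EFin; ring.
  rewrite integralB//.
  have := weak_partialE fg tphi; rewrite (weak_partialE fg' tphi) => /(congr1 oppe).
  rewrite !oppeK => <-; rewrite subee//.
  exact: integrable_fin_num.
apply: filterS => x hx; apply/eqP; rewrite -subr_eq0 -hx; apply/eqP; ring.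
Qed.

End heat.

(** * The Gaussian at nearby points *)

Section gaussian_difference.
Local Open Scope ring_scope.
Context {R : realType} {n : nat}.
Local Notation e_ i := (delta_mx ord0 i : 'rV[R]_n).

Lemma expR_sub1_le (t : R) : `|expR t - 1| <= `|t| * expR `|t|.
Proof.
have e1 (s : R) : expR s - 1 <= s * expR s.
  have := expR_ge1Dx (- s); rewrite expRN => h.
  have s0 := expR_gt0 s.
  have : (1 - s) * expR s <= 1 by rewrite -ler_pdivlMr// mul1r.
  by rewrite mulrBl mul1r lerBlDr addrC => h'; rewrite lerBlDr.
have [t0|t0] := leP 0 t.
  by rewrite (ger0_norm t0) [leLHS]ger0_norm ?subr_ge0 -?expR0 ?ler_expR// expR0; exact: e1.
rewrite (ltr0_norm t0) ltr0_norm ?subr_lt0 ?expR_lt1// opprB.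
have := expR_ge1Dx t => h.
apply: (@le_trans _ _ (- t)); first by rewrite lerBlDr addrC -lerBlDr opprK.
by rewrite ler_peMr ?oppr_ge0 ?(ltW t0)// -expR0 ler_expR oppr_ge0 ltW.
Qed.

(** Doubling alpha halves the Gaussian exponent; the half given up dominates every
    polynomial in z / sqrt(alpha). *)
Lemma heat_kernel_double (alpha : R) (z : 'rV[R]_n) : 0 < alpha ->
  heat_kernel alpha z * expR (dotv z z / alpha / 8) =
  2 `^ (n%:R / 2) * heat_kernel (2 * alpha) z.
Proof.
move=> a0; rewrite /heat_kernel -mulrA -expRD.
rewrite (_ : - (dotv z z / (4 * alpha)) + dotv z z / alpha / 8 =
  - (dotv z z / (4 * (2 * alpha)))); last by field; rewrite gt_eqF.
rewrite [RHS]mulrA; congr (_ * _).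
rewrite (_ : 4 * pi * (2 * alpha) = 2 * (4 * pi * alpha)); last by ring.
have p0 : 0 <= 4 * pi * alpha :> R by rewrite !mulr_ge0 ?pi_ge0// ltW.
rewrite (powRM _ _ p0)// mulrA -powRD.
  by rewrite subrr powRr0 mul1r.
by rewrite pnatr_eq0 implybT.
Qed.

Definition gauss_const : R := n%:R * expR 9 * 2 `^ (n%:R / 2).

Lemma gauss_const_ge0 : 0 <= gauss_const.
Proof. by rewrite !mulr_ge0 ?expR_ge0 ?powR_ge0. Qed.

Lemma sqr_le_dotv (z : 'rV[R]_n) j : z ord0 j ^+ 2 <= dotv z z.
Proof.
rewrite /dotv (bigD1 j)//= -expr2 lerDl.
by apply: sumr_ge0 => k _; rewrite -expr2 sqr_ge0.
Qed.

(** With z measured in units of the square root of alpha, the relative variation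
    of the kernel and the weight are absorbed by half of the Gaussian exponent. *)
Lemma heat_kernel_difference (alpha h : R) (z : 'rV[R]_n) i :
  0 < alpha -> 0 < h <= Num.sqrt alpha ->
  `|heat_kernel alpha (z + h *: e_ i) - heat_kernel alpha z| * (\sum_j (`|z ord0 j| + h))
    <= h * gauss_const * heat_kernel (2 * alpha) z.
Proof.
move=> a0 /andP[h0 ha].
set a := Num.sqrt alpha in ha; have s0 : 0 < a by rewrite sqrtr_gt0.
have aE : alpha = a ^+ 2 by rewrite sqr_sqrtr// ltW.
pose v j := `|z ord0 j| / a.
have v0 j : 0 <= v j by rewrite divr_ge0// ltW.
have zv j : `|z ord0 j| = v j * a by rewrite divfK// gt_eqF.
pose S := dotv z z / alpha.
have vS j : v j ^+ 2 <= S.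
  by rewrite /v expr_div_n -aE real_normK ?num_real// ler_pM2r ?invr_gt0// sqr_le_dotv.
pose t := - ((2 * h * z ord0 i + h ^+ 2) / (4 * alpha)).
have pE : heat_kernel alpha (z + h *: e_ i) = heat_kernel alpha z * expR t.
  rewrite /heat_kernel -[RHS]mulrA -expRD; congr (_ * expR _).
  have -> : dotv (z + h *: e_ i) (z + h *: e_ i) = dotv z z + (2 * h * z ord0 i + h ^+ 2).
    rewrite /dotv (bigD1 i)//= [in RHS](bigD1 i)//= !mxE !eqxx /= mulr1.
    rewrite (eq_bigr (fun j => z ord0 j * z ord0 j)); last first.
      by move=> j ji; rewrite !mxE eqxx (negbTE ji) /= mulr0 addr0.
    by set X := \sum_(_ | _) _; ring.
  by rewrite /t; field; rewrite gt_eqF.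
have tle : `|t| <= h / a * ((2 * v i + 1) / 4).
  rewrite normrN normrM [X in _ * X <= _]ger0_norm; last by rewrite invr_ge0 mulr_ge0// ltW.
  apply: (@le_trans _ _ ((2 * h * `|z ord0 i| + h * a) * (4 * alpha)^-1)).
    rewrite ler_pM2r ?invr_gt0 ?mulr_gt0//.
    apply: (le_trans (ler_normD _ _)); rewrite (ger0_norm (sqr_ge0 h)).
    by rewrite !normrM normr_nat (gtr0_norm h0) lerD2l expr2 ler_pM2l.
  rewrite zv aE le_eqVlt; apply/orP; left; apply/eqP.
  by field; rewrite gt_eqF.
rewrite pE -[X in _ - X]mulr1 -mulrBr normrM (ger0_norm (heat_kernel_ge0 _ _)).
have texp : `|expR t - 1| <= h / a * expR (v i + 2^-1).
  apply: (le_trans (expR_sub1_le t)).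
  set w := (2 * v i + 1) / 4 in tle.
  have w0 : 0 <= w by rewrite divr_ge0// addr_ge0// mulr_ge0.
  have ha1 : h / a <= 1 by rewrite ler_pdivrMr// mul1r.
  have ha0 : 0 <= h / a by rewrite divr_ge0 ?ltW.
  have tw : `|t| <= w by apply: (le_trans tle); rewrite ler_piMl.
  apply: (@le_trans _ _ (h / a * w * expR w)).
    by apply: ler_pM => //; rewrite ler_expR.
  rewrite -mulrA; apply: ler_wpM2l => //.
  have -> : v i + 2^-1 = w + w by rewrite /w; field.
  rewrite expRD; apply: ler_wpM2r; first exact: expR_ge0.
  by apply: le_trans (expR_ge1Dx w); rewrite lerDr.
have sumle : \sum_j (`|z ord0 j| + h) <= a * \sum_j expR (v j).
  rewrite mulr_sumr; apply: ler_sum => j _; rewrite zv.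
  apply: (@le_trans _ _ (a * (v j + 1))); first by rewrite mulrDr mulr1 mulrC lerD2l.
  apply: ler_wpM2l; first exact: ltW.
  by rewrite addrC; exact: expR_ge1Dx.
have sum0 : 0 <= \sum_j (`|z ord0 j| + h).
  by apply: sumr_ge0 => j _; rewrite addr_ge0// ltW.
apply: (@le_trans _ _ (heat_kernel alpha z * (h / a * expR (v i + 2^-1)) * (a * \sum_j expR (v j)))).
  apply: ler_pM => //; first by rewrite mulr_ge0// heat_kernel_ge0.
  by apply: ler_wpM2l => //; exact: heat_kernel_ge0.
have expS j : expR (v i + 2^-1) * expR (v j) <= expR 9 * expR (S / 8).
  (* The exponents add up to v i + v j + 1 / 2 <= S / 8 + 8 + 1 / 2. *)
  have vle k : v k <= S / 16 + 4.
    have := sqr_ge0 (v k - 8); rewrite sqrrB; have := vS k; lra.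
  rewrite -!expRD ler_expR; have := vle i; have := vle j; lra.
have sumS : expR (v i + 2^-1) * \sum_j expR (v j) <= n%:R * (expR 9 * expR (S / 8)).
  rewrite mulr_sumr; apply: (@le_trans _ _ (\sum_(j < n) expR 9 * expR (S / 8))).
    by apply: ler_sum => j _.
  by rewrite sumr_const card_ord mulr_natl.
have := heat_kernel_double z a0; rewrite -/S => dbl.
have P0 := heat_kernel_ge0 alpha z.
move: P0 dbl sumS; rewrite /gauss_const.
set P := heat_kernel alpha z; set P2 := heat_kernel _ _; set c := 2 `^ _.
set X := \sum_j expR (v j); set y := expR (v i + 2^-1) => P0 dbl sumS.
rewrite [leLHS](_ : _ = h * (P * (y * X))); last by field; rewrite gt_eqF.
rewrite [leRHS](_ : _ = h * (P * (n%:R * (expR 9 * expR (S / 8))))).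
  by rewrite ler_pM2l//; exact: ler_wpM2l.
transitivity (h * (n%:R * expR 9) * (c * P2)); first by ring.
by rewrite -dbl; ring.
Qed.

End gaussian_difference.

(** * Trilinear bounds for translation differences *)

Section trilinear.
Context {R : realType} {n : nat}.
Implicit Types (U V W F G : 'rV[R]_n -> R) (x v : 'rV[R]_n) (i : 'I_n).
Local Notation m := (@lebesgue_rV R n).
Local Notation e_ i := (delta_mx ord0 i : 'rV[R]_n).
Local Notation I01 := (uniform_prob (@ltr01 R)).
Local Notation "'Nm_ p [ F ]" := (Lnorm (@lebesgue_rV R n) p (EFin \o F))
  (at level 8, p at level 2).

Lemma measurable_fun_shift F v : measurable_fun setT F ->
  measurable_fun setT (fun x => F (x + v)%R).
Proof. by move=> mF; apply: (measurableT_comp mF); exact: measurable_addv. Qed.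

Lemma Lnorm_shift (r : R) F v : measurable_fun setT F ->
  'Nm_r%:E [fun x => F (x + v)%R] = 'Nm_r%:E [F].
Proof.
move=> mF; rewrite unlock /=; congr (_ `^ _).
rewrite -(integral_rV_shift v (f := fun x => (`|F x| `^ r)%:E))//.
apply/measurable_EFinP; apply: (measurableT_comp (measurable_powR r)).
exact: measurableT_comp.
Qed.

Variables (q : \bar R) (r s : R).
Hypotheses (r1 : (1 < r)%R) (s1 : (1 < s)%R) (q1 : 1 < q).
Hypothesis qrs : q^-1 + r%:E^-1 + s%:E^-1 = 1.

Local Notation NUV U V := ('Nm_r%:E [U] * 'Nm_s%:E [V]).

Lemma hoelder3_shift U V W v : measurable_fun setT U -> measurable_fun setT V ->
  measurable_fun setT W ->
  \int[m]_x `|(U x * V x * W (x + v)%R)%:E| <= NUV U V * 'Nm_q [W].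
Proof.
move=> mU mV mW.
have mU' := measurable_fun_shift (- v)%R mU; have mV' := measurable_fun_shift (- v)%R mV.
have := hoelder3 m mU' mV' mW r1 s1 q1 qrs.
rewrite (Lnorm_shift _ (- v)%R mU) (Lnorm_shift _ (- v)%R mV); apply: le_trans.
have mh : measurable_fun setT (fun x => `|(U (x - v) * V (x - v) * W x)%:E|).
  apply: measurableT_comp => //; apply/measurable_EFinP.
  by apply: measurable_funM => //; exact: measurable_funM.
rewrite -(integral_rV_shift v mh) le_eqVlt; apply/orP; left; apply/eqP.
by apply: eq_integral => x _; rewrite addrK.
Qed.

(** Difference quotients are controlled by the derivative: average the trilinear
    bound over the segment joining the two points. *)
Lemma coordinate_difference_le U V F G (k : R) i :
  measurable_fun setT U -> measurable_fun setT V -> is_weak_partial i F G ->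
  \int[m]_x `|(U x * V x * (F (x + k *: e_ i) - F x))%:E| <=
    `|k|%:E * (NUV U V * 'Nm_q [G]).
Proof.
move=> mU mV FG; have [lF lG _] := FG.
have mF : measurable_fun setT F by case: lF.
have mG : measurable_fun setT G by case: lG.
have mUV : measurable_fun setT (U \* V)%R by exact: measurable_funM.
pose Phi (xl : 'rV[R]_n * measurableTypeR R) :=
  `|(U xl.1 * V xl.1 * G (xl.1 + (xl.2 * k) *: e_ i))%:E|.
have mPhi : measurable_fun setT Phi.
  apply: measurableT_comp => //; apply/measurable_EFinP; apply: measurable_funM.
    exact: (measurableT_comp mUV measurable_fst).
  exact: (measurableT_comp mG (measurable_segment _ _)).
have Phi0 xl : 0 <= Phi xl by exact: abse_ge0.
have mI := measurable_integral_snd I01 mPhi.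
apply: (@le_trans _ _ (\int[m]_x (`|k|%:E * \int[I01]_l Phi (x, l)))).
  apply: ae_ge0_le_integral => //.
  - apply: measurableT_comp => //; apply/measurable_EFinP; apply: measurable_funM => //.
    by apply: measurable_funB => //; exact: measurable_fun_shift.
  - by move=> x _; rewrite mule_ge0//; apply: integral_ge0 => l _; exact: abse_ge0.
  - exact: emeasurable_funM.
  have := ae_segment_integrable k i lG; have := weak_difference k FG.
  apply: filterS2 => x -> iG _.
  rewrite mulrCA EFinM abseM; apply: lee_wpmul2l => //.
  rewrite EFinM /segment_mean fineK; last exact: integrable_fin_num.
  rewrite -integralZl//.
  have mUVG : measurable_fun setT (fun l : measurableTypeR R =>
      (U x * V x)%:E * (G (x + (l * k) *: e_ i)%R)%:E).
    by apply: emeasurable_funM => //; exact: (measurable_int _ iG).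
  exact: (le_abse_integral I01 measurableT mUVG).
rewrite ge0_integralZl//; last by move=> x _; apply: integral_ge0 => l _; exact: abse_ge0.
apply: lee_wpmul2l => //.
rewrite (fubini_tonelli (m1 := m) (m2 := I01) Phi mPhi Phi0).
apply: ge0_unit_le.
- exact: (measurable_integral_fst m mPhi).
- by move=> l; apply: integral_ge0 => x _; exact: abse_ge0.
- by move=> l _; exact: (hoelder3_shift ((l * k) *: e_ i)%R mU mV mG).
Qed.

(** An arbitrary translation is split into coordinate steps. *)
Lemma difference_le U V F (G : 'I_n -> 'rV[R]_n -> R) (z : 'rV[R]_n) :
  measurable_fun setT U -> measurable_fun setT V ->
  (forall i, is_weak_partial i F (G i)) ->
  \int[m]_x `|(U x * V x * (F (x + z)%R - F x))%:E| <=
    NUV U V * \sum_i (`|z ord0 i|%:E * 'Nm_q [G i]).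
Proof.
move=> mU mV FG.
have nN i (c : R) : 0 <= `|c|%:E * 'Nm_q [G i] by rewrite mule_ge0 ?Lnorm_ge0 ?lee_fin.
rewrite {1}[z]row_sum_delta.
have mF (i : 'I_n) : measurable_fun setT F by have [[]] := FG i.
elim: (index_enum _) U V mU mV => [|i t IHt] U V mU mV.
  rewrite !big_nil mule0 integral0_eq// => x _.
  by rewrite addr0 subrr mulr0 abse0.
have {}mF := mF i.
rewrite !big_cons; set w := (\sum_(_ <- t) _)%R; set c := z ord0 i.
have mFs v := measurable_fun_shift v mF.
rewrite ge0_muleDr//; last by apply: sume_ge0.
rewrite muleCA.
pose A x := `|(U x * V x * (F (x + (c *: e_ i + w)) - F (x + w)))%:E|.
pose B x := `|(U x * V x * (F (x + w) - F x))%:E|.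
have mA : measurable_fun setT A.
  apply: measurableT_comp => //; apply/measurable_EFinP.
  apply: measurable_funM; first exact: measurable_funM.
  exact: measurable_funB.
have mB : measurable_fun setT B.
  apply: measurableT_comp => //; apply/measurable_EFinP.
  apply: measurable_funM; first exact: measurable_funM.
  exact: measurable_funB.
apply: (@le_trans _ _ (\int[m]_x (A x + B x))).
  apply: ge0_le_integral => //.
  - apply: measurableT_comp => //; apply/measurable_EFinP.
    apply: measurable_funM; first exact: measurable_funM.
    exact: measurable_funB.
  - exact: emeasurable_funD.
  - move=> x _; rewrite /A /B -EFinD lee_fin.
    rewrite (_ : F (x + (c *: e_ i + w)) - F x =
      (F (x + (c *: e_ i + w)) - F (x + w)) + (F (x + w) - F x))%R; last by ring.
    by rewrite mulrDr ler_normD.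
have A0 x : 0 <= A x by exact: abse_ge0.
have B0 x : 0 <= B x by exact: abse_ge0.
rewrite ge0_integralD//; apply: leeD; last exact: IHt.
have mU' := measurable_fun_shift (- w)%R mU; have mV' := measurable_fun_shift (- w)%R mV.
rewrite -(integral_rV_shift (- w)%R mA).
have := coordinate_difference_le c mU' mV' (FG i).
rewrite (Lnorm_shift _ (- w)%R mU) (Lnorm_shift _ (- w)%R mV); apply: le_trans.
rewrite le_eqVlt; apply/orP; left; apply/eqP; apply: eq_integral => x _.
by rewrite /A addrA subrK addrAC subrK.
Qed.

End trilinear.

(** * The commutator form and its kernel *)

Section commutator_form.
Context {R : realType} {n : nat}.
Implicit Types (V : 'rV[R]_n -> R) (x : 'rV[R]_n) (i : 'I_n).
Local Notation m := (@lebesgue_rV R n).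
Local Notation e_ i := (delta_mx ord0 i : 'rV[R]_n).
Local Notation "'Nm_ p [ F ]" := (Lnorm (@lebesgue_rV R n) p (EFin \o F))
  (at level 8, p at level 2).

Context (q : \bar R) (r s : R) (r1 : (1 < r)%R) (s1 : (1 < s)%R) (q1 : 1 < q)
  (qrs : q^-1 + r%:E^-1 + s%:E^-1 = 1).
Context (alpha : R) (alpha0 : (0 < alpha)%R).
Local Notation p := (@heat_kernel R n alpha).

Context (u B : 'rV[R]_n -> R) (D : 'I_n -> 'rV[R]_n -> R).
Hypotheses (mu : measurable_fun setT u) (mB : measurable_fun setT B).
Hypothesis BD : forall j, is_weak_partial j B (D j).
Local Notation NB := (\sum_j 'Nm_q [D j]).
Local Notation NUV V := ('Nm_r%:E [u] * 'Nm_s%:E [V]).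

Definition increment_kernel (xy : 'rV[R]_n * 'rV[R]_n) : R :=
  (p (xy.1 - xy.2) * (B xy.2 - B xy.1))%R.
Local Notation K := increment_kernel.

Lemma sum_Lnorm_ge0 : 0 <= NB.
Proof. by apply: sume_ge0 => j _; exact: Lnorm_ge0. Qed.

Lemma measurable_increment_kernel : measurable_fun setT K.
Proof.
apply: measurable_funM.
  apply: (measurableT_comp (measurable_heat_kernel alpha)).
  by apply: measurable_subv; [exact: measurable_fst|exact: measurable_snd].
apply: measurable_funB.
  exact: (measurableT_comp mB measurable_snd).
exact: (measurableT_comp mB measurable_fst).
Qed.

Lemma measurable_form V : measurable_fun setT V ->
  measurable_fun setT (fun xy => (u xy.1 * K xy * V xy.2)%:E).
Proof.
move=> mV; apply/measurable_EFinP; apply: measurable_funM; last first.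
  exact: (measurableT_comp mV measurable_snd).
apply: measurable_funM; last exact: measurable_increment_kernel.
exact: (measurableT_comp mu measurable_fst).
Qed.

Lemma ge0_integral_heat_kernelZr a c : (0 < a)%R -> 0 <= c ->
  \int[m]_z ((heat_kernel a z)%:E * c) = c.
Proof.
move=> a0 c0; rewrite ge0_integralZr//.
- by rewrite integral_heat_kernel// mul1e.
- by apply/measurable_EFinP; exact: measurable_heat_kernel.
- by move=> z _; rewrite lee_fin heat_kernel_ge0.
Qed.

(** Without using any derivative of B, its increment is bounded by the two values of B
    separately, hence the factor 2.  This only serves to make the form finite. *)
Lemma form_abs_le V : measurable_fun setT V ->
  \int[m]_x \int[m]_y `|(u x * K (x, y) * V y)%:E| <= 2%:E * (NUV V * 'Nm_q [B]).
Proof.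
move=> mV; have mW := measurable_form mV.
rewrite (@ge0_integral_shear _ _ (fun xy => `|(u xy.1 * K xy * V xy.2)%:E|))//; last first.
  exact: measurableT_comp.
set N := NUV V * _; have N0 : 0 <= N by rewrite !mule_ge0 ?Lnorm_ge0.
have N20 : 0 <= 2%:E * N by rewrite mule_ge0.
rewrite -[leRHS](ge0_integral_heat_kernelZr alpha0 N20).
have mS := measurableT_comp (measurableT_comp (@abse_measurable _ _) mW) (@measurable_shear R n).
apply: ge0_le_integral => //.
- by move=> z _; apply: integral_ge0 => y _; exact: abse_ge0.
- exact: (measurable_integral_snd m mS).
- by apply: emeasurable_funM => //; apply/measurable_EFinP; exact: measurable_heat_kernel.
move=> z _; have mu' := measurable_fun_shift z mu.
have mB' := measurable_fun_shift z mB.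
pose A (y : 'rV[R]_n) := `|(u (y + z) * V y * B (y + 0))%:E|.
pose A' (y : 'rV[R]_n) := `|(u (y + z) * V y * B (y + z))%:E|.
have mAm c : measurable_fun setT (fun y : 'rV[R]_n => `|(u (y + z) * V y * B (y + c))%:E|).
  apply: measurableT_comp => //; apply/measurable_EFinP; apply: measurable_funM.
    exact: measurable_funM.
  exact: measurable_fun_shift.
have mA : measurable_fun setT A by exact: mAm.
have mA' : measurable_fun setT A' by exact: mAm.
have A0 y : 0 <= A y by exact: abse_ge0.
have A'0 y : 0 <= A' y by exact: abse_ge0.
apply: (@le_trans _ _ (\int[m]_y ((p z)%:E * (A y + A' y)))).
  apply: ge0_le_integral => //.
  - exact: (measurableT_comp mS (pair1_measurable z)).
  - by apply: emeasurable_funM => //; exact: emeasurable_funD.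
  - move=> y _; rewrite /= /A /A' /K/= addr0 -EFinD -EFinM lee_fin.
    rewrite [(y + z - y)%R]addrAC subrr add0r.
    rewrite (_ : (u (y + z) * (p z * (B y - B (y + z))) * V y =
      p z * (u (y + z) * V y * B y - u (y + z) * V y * B (y + z)))%R); last by ring.
    rewrite normrM (ger0_norm (heat_kernel_ge0 _ _)).
    by apply: ler_wpM2l; [exact: heat_kernel_ge0|exact: ler_normB].
rewrite ge0_integralZl//; last 3 first.
- exact: emeasurable_funD.
- by move=> y _; rewrite adde_ge0.
- by rewrite lee_fin heat_kernel_ge0.
apply: lee_wpmul2l; first by rewrite lee_fin heat_kernel_ge0.
rewrite ge0_integralD// (_ : 2%:E = 1%:E + 1%:E)// ge0_muleDl// mul1e.
have := Lnorm_shift r z mu => Nu.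
apply: leeD.
  by have := hoelder3_shift r1 s1 q1 qrs 0%R mu' mV mB; rewrite Nu.
by have := hoelder3_shift r1 s1 q1 qrs z mu' mV mB; rewrite Nu.
Qed.

(** The kernel is Lipschitz in its second variable, in the trilinear sense: a
    translation of it falls either on the Gaussian, where the increment of B
    contributes a factor absorbed by the Gaussian, or on B itself. *)
Lemma increment_kernel_shift_le V (h : R) i : measurable_fun setT V ->
  (0 < h <= Num.sqrt alpha)%R ->
  \int[m]_x \int[m]_y `|(u x * (K (x, (y - h *: e_ i)%R) - K (x, y)) * V y)%:E| <=
    (h * (@gauss_const R n + 1))%:E * (NUV V * NB).
Proof.
move=> mV hh; have /andP[h0 _] := hh.
pose Phi (xy : 'rV[R]_n * 'rV[R]_n) :=
  `|(u xy.1 * (K (xy.1, xy.2 - h *: e_ i) - K xy) * V xy.2)%:E|%E.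
have mPhi : measurable_fun setT Phi.
  apply: measurableT_comp => //; apply/measurable_EFinP; apply: measurable_funM; last first.
    exact: (measurableT_comp mV measurable_snd).
  apply: measurable_funM; first exact: (measurableT_comp mu measurable_fst).
  apply: measurable_funB; last exact: measurable_increment_kernel.
  apply: (measurableT_comp measurable_increment_kernel).
  apply/measurable_fun_pairP; split => /=; first exact: measurable_fst.
  by apply: measurable_subv => //; exact: measurable_snd.
rewrite (@ge0_integral_shear _ _ Phi)//; last by move=> xy; exact: abse_ge0.
set N := NUV V * NB; have N0 : 0 <= N by rewrite !mule_ge0 ?Lnorm_ge0 ?sum_Lnorm_ge0.
have mS := measurableT_comp mPhi (@measurable_shear R n).
pose c1 (z : 'rV[R]_n) := (`|p (z + h *: e_ i) - p z| * (\sum_j (`|z ord0 j| + h)))%R.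
have p0 a z := @heat_kernel_ge0 R n a z.
have c10 z : (0 <= c1 z)%R.
  by rewrite mulr_ge0// sumr_ge0// => j _; rewrite addr_ge0// ltW.
have gc0 : (0 <= @gauss_const R n)%R by exact: gauss_const_ge0.
apply: (@le_trans _ _ (\int[m]_z ((heat_kernel (2 * alpha) z)%:E * ((h * @gauss_const R n)%:E * N)
    + (p z)%:E * (h%:E * N)))); last first.
  rewrite ge0_integralD//; last 4 first.
  - by move=> z _; rewrite mule_ge0 ?lee_fin// mule_ge0// lee_fin mulr_ge0// ltW.
  - by apply: emeasurable_funM => //; apply/measurable_EFinP; exact: measurable_heat_kernel.
  - by move=> z _; rewrite mule_ge0 ?lee_fin// mule_ge0// lee_fin ltW.
  - by apply: emeasurable_funM => //; apply/measurable_EFinP; exact: measurable_heat_kernel.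
  rewrite !ge0_integral_heat_kernelZr ?mulr_gt0//.
  - by rewrite mulrDr mulr1 EFinD ge0_muleDl// lee_fin ?mulr_ge0// ltW.
  - by rewrite mule_ge0// lee_fin ltW.
  - by rewrite mule_ge0// lee_fin mulr_ge0// ltW.
apply: ge0_le_integral => //.
- by move=> z _; apply: integral_ge0 => y _; exact: abse_ge0.
- exact: (measurable_integral_snd m mS).
- by apply: emeasurable_funD; apply: emeasurable_funM => //; apply/measurable_EFinP; exact: measurable_heat_kernel.
move=> z _; have mu' := measurable_fun_shift z mu.
have Nu := Lnorm_shift r z mu.
pose A1 (y : 'rV[R]_n) := `|(u (y + z) * V y * (B (y - h *: e_ i) - B (y + z)))%:E|.
pose A2 (y : 'rV[R]_n) := `|(u (y + z) * V y * (B (y + (- h) *: e_ i) - B y))%:E|.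
have mA1 : measurable_fun setT A1.
  apply: measurableT_comp => //; apply/measurable_EFinP; apply: measurable_funM.
    exact: measurable_funM.
  by apply: measurable_funB; exact: measurable_fun_shift.
have mA2 : measurable_fun setT A2.
  apply: measurableT_comp => //; apply/measurable_EFinP; apply: measurable_funM.
    exact: measurable_funM.
  by apply: measurable_funB => //; exact: measurable_fun_shift.
have A10 y : 0 <= A1 y by exact: abse_ge0.
have A20 y : 0 <= A2 y by exact: abse_ge0.
pose dp := (`|p (z + h *: e_ i) - p z|)%R.
have dp0 : (0 <= dp)%R by exact: normr_ge0.
have intA1 : \int[m]_y A1 y <= (\sum_j (`|z ord0 j| + h))%:E * N.
  pose w := (h *: e_ i)%R.
  have mU1 := measurable_fun_shift (w + z)%R mu; have mV1 := measurable_fun_shift w mV.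
  have := difference_le r1 s1 q1 qrs (z + w)%R mU1 mV1 BD.
  rewrite (Lnorm_shift _ (w + z)%R mu) (Lnorm_shift _ w mV).
  move=> hle; rewrite -(integral_rV_shift w mA1).
  apply: (@le_trans _ _ (NUV V * (\sum_j (`|(z + w)%R ord0 j|%:E * 'Nm_q [D j])))).
    apply: le_trans hle; rewrite le_eqVlt; apply/orP; left; apply/eqP.
    apply: eq_integral => y _; rewrite /A1 addrK -[RHS]abseN -EFinN; congr (`|_%:E|).
    by rewrite -mulrN opprB [(z + w)%R]addrC !addrA.
  rewrite /N muleCA; apply: lee_wpmul2l; first by rewrite mule_ge0 ?Lnorm_ge0.
  rewrite ge0_sume_distrr; last by move=> j _; exact: Lnorm_ge0.
  apply: lee_sum => j _; apply: lee_wpmul2r; first exact: Lnorm_ge0.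
  rewrite lee_fin (bigD1 j)//= !mxE.
  apply: (@le_trans _ _ (`|z ord0 j| + h)%R).
    apply: (le_trans (ler_normD _ _)); rewrite lerD2l normrM (gtr0_norm h0).
    by rewrite eqxx /=; case: eqP => _; rewrite ?normr1 ?normr0 ?mulr1// mulr0 ltW.
  by rewrite lerDl sumr_ge0// => k _; rewrite addr_ge0// ltW.
have intA2 : \int[m]_y A2 y <= h%:E * N.
  have := coordinate_difference_le r1 s1 q1 qrs (- h)%R mu' mV (BD i).
  rewrite normrN (gtr0_norm h0) Nu => hle; apply: (le_trans hle).
  apply: lee_wpmul2l; first by rewrite lee_fin ltW.
  apply: lee_wpmul2l; first by rewrite mule_ge0 ?Lnorm_ge0.
  rewrite (bigD1 i)//= leeDl// sume_ge0// => j _; exact: Lnorm_ge0.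
apply: (@le_trans _ _ (\int[m]_y (dp%:E * A1 y + (p z)%:E * A2 y))).
  apply: ge0_le_integral => //.
  - by move=> y _; exact: abse_ge0.
  - exact: (measurableT_comp mS (pair1_measurable z)).
  - by apply: emeasurable_funD; exact: emeasurable_funM.
  - move=> y _; rewrite /= /Phi /A1 /A2 /K /= -!EFinM -EFinD lee_fin.
    have -> : (y + z - (y - h *: e_ i) = z + h *: e_ i)%R.
      by rewrite opprB addrC addrA subrK addrC.
    rewrite [(y + z - y)%R]addrAC subrr add0r -scaleNr.
    rewrite (_ : (u (y + z) * (p (z + h *: e_ i) * (B (y + (- h) *: e_ i) - B (y + z)) -
         p z * (B y - B (y + z))) * V y =
       (p (z + h *: e_ i) - p z) * (u (y + z) * V y * (B (y + (- h) *: e_ i) - B (y + z))) +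
       p z * (u (y + z) * V y * (B (y + (- h) *: e_ i) - B y)))%R); last by ring.
    apply: (le_trans (ler_normD _ _)); rewrite normrM lerD2l normrM.
    by rewrite (ger0_norm (heat_kernel_ge0 _ _)).
rewrite ge0_integralD//; last 4 first.
- by move=> y _; apply: mule_ge0; rewrite ?lee_fin.
- exact: emeasurable_funM.
- by move=> y _; apply: mule_ge0; rewrite ?lee_fin.
- exact: emeasurable_funM.
rewrite !ge0_integralZl// ?lee_fin//.
apply: leeD; last by apply: lee_wpmul2l; rewrite ?lee_fin.
apply: (@le_trans _ _ ((c1 z)%:E * N)).
  by rewrite /c1 EFinM -muleA; apply: lee_wpmul2l; rewrite ?lee_fin.
rewrite [leRHS]muleA -EFinM; apply: lee_wpmul2r => //; rewrite lee_fin mulrC.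
exact: heat_kernel_difference.
Qed.

End commutator_form.

Section iterated_product.
Context d1 d2 d3 (T1 : measurableType d1) (T2 : measurableType d2)
  (T3 : measurableType d3) (R : realType).
Variable m1 : {sigma_finite_measure set T1 -> \bar R}.
Variable m2 : {sigma_finite_measure set T2 -> \bar R}.
Variable m3 : {sigma_finite_measure set T3 -> \bar R}.

(** An alias of the product measure that carries its sigma-finiteness, so that
    Fubini's theorem applies to a product of three factors. *)
Definition sigma_product : set (T1 * T2) -> \bar R := m1 \x m2.

HB.instance Definition _ := Measure.on sigma_product.

Let sigma_product_sigma_finite : sigma_finite setT sigma_product.
Proof.
have /sigma_finiteP[F [TF ndF Foo]] := sigma_finiteT m1.
have /sigma_finiteP[G [TG ndG Goo]] := sigma_finiteT m2.
exists (fun n => F n `*` G n) => [|k].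
  rewrite -setXTT TF TG predeqE => -[x y]; split=> [|[k _ []/= ? ?]]; last by split; exists k.
  move=> [/= [k _ Fkx] [l _ Gly]]; exists (maxn k l) => //; split.
    by move: x Fkx; exact/subsetPset/ndF/leq_maxl.
  by move: y Gly; exact/subsetPset/ndG/leq_maxr.
have [[? ?] [? ?]] := (Foo k, Goo k); split; first exact: measurableX.
by rewrite /sigma_product product_measure1E// lte_mul_pinfty// ge0_fin_numE.
Qed.

HB.instance Definition _ := Measure_isSigmaFinite.Build _ _ _ sigma_product
  sigma_product_sigma_finite.

Lemma measurable_integral_prod (f : (T1 * T2) * T3 -> \bar R) : measurable_fun setT f ->
  measurable_fun setT (fun z => \int[m1 \x m2]_xy f (xy, z)).
Proof. exact: (@measurable_integral_fst _ _ _ _ _ sigma_product). Qed.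

Lemma integrable_prod_swap (f : (T1 * T2) * T3 -> \bar R) : measurable_fun setT f ->
  \int[m3]_z \int[m1 \x m2]_xy `|f (xy, z)| < +oo ->
  (m1 \x m2).-integrable setT (fun xy => \int[m3]_z f (xy, z)) /\
  \int[m1 \x m2]_xy \int[m3]_z f (xy, z) = \int[m3]_z \int[m1 \x m2]_xy f (xy, z).
Proof.
move=> mf foo; have [_ toint] := integrable21ltyP sigma_product m3 mf.
have fi := toint foo; split; first exact: (integrable_fubini_F fi).
exact: (Fubini fi).
Qed.

End iterated_product.

(** * The form bounded without the derivative of its last argument *)

Section commutator_form_bound.
Context {R : realType} {n : nat}.
Implicit Types (V f g : 'rV[R]_n -> R) (x v : 'rV[R]_n) (i : 'I_n).
Local Notation m := (@lebesgue_rV R n).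
Local Notation e_ i := (delta_mx ord0 i : 'rV[R]_n).
Local Notation I01 := (uniform_prob (@ltr01 R)).
Local Notation "'Nm_ p [ F ]" := (Lnorm (@lebesgue_rV R n) p (EFin \o F))
  (at level 8, p at level 2).

Context (q : \bar R) (r s : R) (r1 : (1 < r)%R) (s1 : (1 < s)%R) (q1 : 1 < q)
  (qrs : q^-1 + r%:E^-1 + s%:E^-1 = 1).
Context (alpha : R) (alpha0 : (0 < alpha)%R).
Context (u B : 'rV[R]_n -> R) (D : 'I_n -> 'rV[R]_n -> R).
Hypotheses (mu : measurable_fun setT u) (mB : measurable_fun setT B).
Hypothesis BD : forall j, is_weak_partial j B (D j).
Hypotheses (uoo : 'Nm_r%:E [u] < +oo) (Boo : 'Nm_q [B] < +oo).
Local Notation NB := (\sum_j 'Nm_q [D j]).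
Hypothesis Doo : NB < +oo.
Local Notation NUV V := ('Nm_r%:E [u] * 'Nm_s%:E [V]).
Local Notation K := (increment_kernel alpha B).
Local Notation M := (m \x m).

Let fin_norm (p : \bar R) F : 'Nm_p [F] < +oo -> 'Nm_p [F] \is a fin_num.
Proof. by move=> Foo; rewrite ge0_fin_numE// Lnorm_ge0. Qed.

Let fin_NB : NB \is a fin_num.
Proof. by rewrite ge0_fin_numE// sum_Lnorm_ge0. Qed.

Definition commutator_form V := \int[m]_x \int[m]_y (u x * K (x, y) * V y)%:E.
Local Notation J := commutator_form.

Lemma form_integrable V : measurable_fun setT V -> 'Nm_s%:E [V] < +oo ->
  M.-integrable setT (fun xy => (u xy.1 * K xy * V xy.2)%:E).
Proof.
move=> mV Voo; apply/integrable12ltyP; first exact: measurable_form.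
apply: (le_lt_trans (form_abs_le r1 s1 q1 qrs alpha0 mu mB mV)).
by rewrite ltey_eq !fin_numM// fin_norm.
Qed.

Lemma commutator_formE V : measurable_fun setT V -> 'Nm_s%:E [V] < +oo ->
  J V = \int[M]_xy (u xy.1 * K xy * V xy.2)%:E.
Proof.
by move=> mV Voo; rewrite -(integral12_prod_meas1 (form_integrable mV Voo)).
Qed.

Lemma commutator_form_fin_num V : measurable_fun setT V -> 'Nm_s%:E [V] < +oo ->
  J V \is a fin_num.
Proof.
move=> mV Voo; rewrite commutator_formE//; apply: integrable_fin_num => //.
exact: form_integrable.
Qed.

Lemma form_shift_integrable V v : measurable_fun setT V -> 'Nm_s%:E [V] < +oo ->
  M.-integrable setT (fun xy => (u xy.1 * K (xy.1, xy.2 - v)%R * V xy.2)%:E).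
Proof.
move=> mV Voo.
have mVv := measurable_fun_shift v mV.
have Vvoo : 'Nm_s%:E [fun y => V (y + v)%R] < +oo by rewrite Lnorm_shift.
have mF : measurable_fun setT (fun xy : 'rV[R]_n * 'rV[R]_n =>
    (u xy.1 * K (xy.1, xy.2 - v)%R * V xy.2)%:E).
  have mW := measurable_form alpha mu mB mVv.
  have ms : measurable_fun setT (fun xy : 'rV[R]_n * 'rV[R]_n => (xy.1, xy.2 - v)%R).
    apply/measurable_fun_pairP; split => /=; first exact: measurable_fst.
    by apply: measurable_subv => //; exact: measurable_snd.
  have := measurableT_comp mW ms; congr measurable_fun; apply/funext => xy /=.
  by rewrite subrK.
apply/integrable12ltyP => //.
have [lt _] := integrable12ltyP m m (measurable_form alpha mu mB mVv).
apply: le_lt_trans (lt (form_integrable mVv Vvoo)).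
rewrite le_eqVlt; apply/orP; left; apply/eqP; apply: eq_integral => x _.
have mFx : measurable_fun setT (fun y : 'rV[R]_n => `|(u x * K (x, y - v)%R * V y)%:E|).
  exact: (measurableT_comp (@abse_measurable _ _) (measurableT_comp mF (pair1_measurable x))).
by rewrite -(integral_rV_shift v mFx); apply: eq_integral => y _ /=; rewrite addrK.
Qed.

Lemma commutator_form_shift V v : measurable_fun setT V -> 'Nm_s%:E [V] < +oo ->
  J (fun y => V (y + v)%R) = \int[M]_xy (u xy.1 * K (xy.1, xy.2 - v)%R * V xy.2)%:E.
Proof.
move=> mV Voo; have iF := form_shift_integrable v mV Voo.
rewrite -(integral12_prod_meas1 iF); apply: eq_integral => x _ /=.
have mFx := measurableT_comp (measurable_int _ iF) (pair1_measurable x).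
rewrite -[RHS](integral_rV_shift v mFx).
by apply: eq_integral => y _ /=; rewrite addrK.
Qed.

Lemma commutator_form_lipschitz V (h : R) i : measurable_fun setT V ->
  'Nm_s%:E [V] < +oo -> (0 < h <= Num.sqrt alpha)%R ->
  `|J (fun y => V (y + h *: e_ i)%R) - J V| <=
    (h * (@gauss_const R n + 1))%:E * (NUV V * NB).
Proof.
move=> mV Voo hh; have i1 := form_shift_integrable (h *: e_ i)%R mV Voo.
have i2 := form_integrable mV Voo.
rewrite commutator_form_shift// commutator_formE// -integralB//.
have mD : measurable_fun setT (fun xy : 'rV[R]_n * 'rV[R]_n => (u xy.1 * K (xy.1, xy.2 - h *: e_ i)%R * V xy.2)%:E -
    (u xy.1 * K xy * V xy.2)%:E).
  by apply: emeasurable_funB; [exact: (measurable_int _ i1)|exact: (measurable_int _ i2)].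
apply: (le_trans (le_abse_integral M measurableT mD)).
rewrite fubini_tonelli1//; last exact: measurableT_comp.
apply: le_trans (increment_kernel_shift_le r1 s1 q1 qrs alpha0 mu mB BD i mV hh).
rewrite le_eqVlt; apply/orP; left; apply/eqP.
apply: eq_integral => x _; apply: eq_integral => y _ /=.
by rewrite mulrBr mulrBl.
Qed.

Lemma measurable_form_segment g (h : R) i : measurable_fun setT g ->
  measurable_fun setT (fun xyl : ('rV[R]_n * 'rV[R]_n) * measurableTypeR R =>
    (u xyl.1.1 * K xyl.1 * g (xyl.1.2 + (xyl.2 * h) *: e_ i)%R)%:E).
Proof.
move=> mg; apply/measurable_EFinP; apply: measurable_funM.
  have mK : measurable_fun setT (fun xy => u xy.1 * K xy)%R.
    apply: measurable_funM; first exact: (measurableT_comp mu measurable_fst).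
    exact: measurable_increment_kernel.
  exact: (measurableT_comp mK measurable_fst).
apply: (measurableT_comp mg); apply: measurable_addv.
  exact: (measurableT_comp measurable_snd measurable_fst).
by apply: measurable_scalev => //; apply: measurable_funM => //; exact: measurable_snd.
Qed.

(** The form is linear, so the fundamental theorem of calculus for f along segments
    passes through it. *)
Lemma commutator_form_mean f g (h : R) i : is_weak_partial i f g ->
  'Nm_s%:E [f] < +oo -> 'Nm_s%:E [g] < +oo ->
  J (fun y => f (y + h *: e_ i)%R) - J f =
    h%:E * \int[I01]_l J (fun y => g (y + (l * h) *: e_ i)%R).
Proof.
move=> fg foo goo; have [lf lg _] := fg.
have mf : measurable_fun setT f by case: lf.
have mg : measurable_fun setT g by case: lg.
have mfh := measurable_fun_shift (h *: e_ i)%R mf.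
have fhoo : 'Nm_s%:E [fun y => f (y + h *: e_ i)%R] < +oo by rewrite Lnorm_shift.
pose Psi (xyl : ('rV[R]_n * 'rV[R]_n) * measurableTypeR R) :=
  (u xyl.1.1 * K xyl.1 * g (xyl.1.2 + (xyl.2 * h) *: e_ i)%R)%:E.
have mPsi : measurable_fun setT Psi by exact: measurable_form_segment.
have gloo (l : R) : 'Nm_s%:E [fun y => g (y + (l * h) *: e_ i)%R] < +oo.
  by rewrite Lnorm_shift.
have mgl (l : R) := measurable_fun_shift ((l * h) *: e_ i)%R mg.
have [iF swap] : M.-integrable setT (fun xy => \int[I01]_l Psi (xy, l)) /\
    \int[M]_xy \int[I01]_l Psi (xy, l) = \int[I01]_l \int[M]_xy Psi (xy, l).
  apply: integrable_prod_swap => //.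
  apply: (@le_lt_trans _ _ (2%:E * (NUV g * 'Nm_q [B]))); last first.
    by rewrite ltey_eq !fin_numM// fin_norm.
  apply: ge0_unit_le.
  - exact: (measurable_integral_prod m m (measurableT_comp (@abse_measurable _ _) mPsi)).
  - by move=> l; apply: integral_ge0 => xy _; exact: abse_ge0.
  - move=> l _; have := form_abs_le r1 s1 q1 qrs alpha0 mu mB (mgl l).
    rewrite Lnorm_shift//; apply: le_trans.
    rewrite (fubini_tonelli1 (fun xy => `|Psi (xy, l)|))//.
    exact: (measurableT_comp (@abse_measurable _ _) (measurableT_comp mPsi (pair2_measurable l))).
transitivity (\int[M]_xy (h%:E * \int[I01]_l Psi (xy, l))); last first.
  rewrite integralZl// swap; congr (_ * _); apply: eq_integral => l _.
  by rewrite commutator_formE.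
have iPF := integrableZl measurableT h iF.
have i1 := form_integrable mfh fhoo; have i2 := form_integrable mf foo.
rewrite !commutator_formE// -integralB//.
rewrite -(integral12_prod_meas1 iPF).
rewrite -integral12_prod_meas1; last exact: integrableB.
apply: eq_integral => x _; apply: ae_eq_integral => //.
- have := measurable_form alpha mu mB mfh; have := measurable_form alpha mu mB mf.
  move=> m1 m2; apply: emeasurable_funB.
    exact: (measurableT_comp m2 (pair1_measurable x)).
  exact: (measurableT_comp m1 (pair1_measurable x)).
- exact: (measurableT_comp (measurable_int _ iPF) (pair1_measurable x)).
have := ae_segment_integrable h i lg; have := weak_difference h fg.
apply: filterS2 => y fy iy _ /=.
rewrite -EFinB -mulrBr fy /segment_mean EFinM [(h * _)%:E]EFinM fineK; last exact: integrable_fin_num.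
by rewrite muleCA -integralZl.
Qed.

(** Averaging J over translates of g costs a multiple of h; the average itself is
    a difference quotient of J at f, which the Lipschitz bound controls by f alone. *)
Lemma commutator_form_le f g i : is_weak_partial i f g ->
  'Nm_s%:E [f] < +oo -> 'Nm_s%:E [g] < +oo ->
  `|J g| <= (@gauss_const R n + 1)%:E * (NUV f * NB).
Proof.
move=> fg foo goo; have [lf lg _] := fg.
have mf : measurable_fun setT f by case: lf.
have mg : measurable_fun setT g by case: lg.
set C := (@gauss_const R n + 1)%R.
have C0 : (0 <= C)%R by rewrite addr_ge0// gauss_const_ge0.
have a0 : (0 < Num.sqrt alpha)%R by rewrite sqrtr_gt0.
pose Jl h (l : measurableTypeR R) := J (fun y => g (y + (l * h) *: e_ i)%R).
have NUVfin V : 'Nm_s%:E [V] < +oo -> NUV V * NB \is a fin_num.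
  by move=> Voo; rewrite !fin_numM// fin_norm.
have main (h : R) : (0 < h <= Num.sqrt alpha)%R ->
    `|J g| <= (h * C)%:E * (NUV g * NB) + C%:E * (NUV f * NB).
  move=> hh; have /andP[h0 ha] := hh.
  have mJl : measurable_fun setT (Jl h).
    rewrite (_ : Jl h = fun l => \int[M]_xy (u xy.1 * K xy * g (xy.2 + (l * h) *: e_ i)%R)%:E).
      exact: (measurable_integral_prod m m (measurable_form_segment h i mg)).
    apply/funext => l; rewrite /Jl commutator_formE//; first exact: measurable_fun_shift.
    by rewrite Lnorm_shift.
  have Jg := commutator_form_fin_num mg goo.
  pose bnd := (h * C)%:E * (NUV g * NB).
  have bnd0 : 0 <= bnd.
    by rewrite mule_ge0 ?lee_fin ?mulr_ge0 ?(ltW h0)// !mule_ge0 ?Lnorm_ge0// sum_Lnorm_ge0.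
  have Jl_le l : l \in `[0%R, 1%R] -> `|Jl h l - J g| <= bnd.
    rewrite in_itv/= => /andP[l0 l1]; have [->|ln0] := eqVneq l 0%R.
      rewrite /Jl; under [X in J X]eq_fun do rewrite mul0r scale0r addr0.
      by rewrite subee// abse0.
    have lh0 : (0 < l * h)%R by rewrite mulr_gt0// lt_neqAle eq_sym ln0.
    have lhh : (l * h <= h)%R by rewrite ler_piMl// ltW.
    apply: (le_trans (commutator_form_lipschitz i mg goo _)).
      by rewrite lh0 (le_trans lhh).
    apply: lee_wpmul2r; first by rewrite !mule_ge0 ?Lnorm_ge0// sum_Lnorm_ge0.
    by rewrite lee_fin ler_wpM2r.
  have mDl : measurable_fun setT (fun l => Jl h l - J g).
    exact: (emeasurable_funB mJl (measurable_cst (J g))).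
  have iD : I01.-integrable setT (fun l => Jl h l - J g).
    apply/integrableP; split => //.
    apply: (@le_lt_trans _ _ bnd); last by rewrite ltey_eq /bnd fin_numM// NUVfin.
    apply: ge0_unit_le => //; exact: (measurableT_comp (@abse_measurable _ _) mDl).
  have iJg : I01.-integrable setT (fun=> J g).
    rewrite -(fineK Jg).
    exact: (finite_measure_integrable_cst I01 (fine (J g)) measurableT).
  have iJl : I01.-integrable setT (Jl h).
    apply: (eq_integrable measurableT (fun l => (Jl h l - J g) + J g)).
      by move=> l _; rewrite subeK.
    exact: integrableD.
  have meanE : \int[I01]_l Jl h l - J g = \int[I01]_l (Jl h l - J g).
    have cstE : \int[I01]_l J g = J g.
      by rewrite integral_cst// [X in _ * X]probability_setT mule1.
    by rewrite -[in LHS]cstE -integralB.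
  have mean_le : `|\int[I01]_l Jl h l - J g| <= bnd.
    rewrite meanE; apply: (le_trans (le_abse_integral I01 measurableT mDl)).
    apply: ge0_unit_le => //; exact: (measurableT_comp (@abse_measurable _ _) mDl).
  have meanfin : \int[I01]_l Jl h l \is a fin_num by exact: integrable_fin_num.
  have mean_f : `|\int[I01]_l Jl h l| <= C%:E * (NUV f * NB).
    have := commutator_form_lipschitz i mf foo hh.
    rewrite (commutator_form_mean h fg foo goo) abseM [`|h%:E|]gee0_abs ?lee_fin ?(ltW h0)//.
    by rewrite EFinM -muleA lee_pmul2l.
  rewrite -[J g](subeK _ meanfin); apply: (le_trans (lee_abs_add _ _)).
  apply: leeD => //; apply: le_trans mean_le.
  by rewrite -[leLHS]abseN fin_num_oppeB// addeC.
have gfin := NUVfin _ goo.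
set X := NUV g * NB in main gfin.
have X0 : 0 <= X by rewrite !mule_ge0 ?Lnorm_ge0// sum_Lnorm_ge0.
apply/lee_addgt0Pr => e e0.
pose x := fine X; have x0 : (0 <= x)%R by rewrite fine_ge0.
have xc : (0 < C * x + 1)%R by rewrite ltr_wpDl// mulr_ge0.
(* Adding 1 keeps the denominator positive when x = 0. *)
pose h := Num.min (Num.sqrt alpha) (e / (C * x + 1))%R.
have h0 : (0 < h)%R by rewrite lt_min a0 divr_gt0.
apply: (le_trans (main h _)); first by rewrite h0 ge_min lexx.
rewrite addeC leeD2l// -(fineK gfin) -EFinM lee_fin -/x.
apply: (@le_trans _ _ (e / (C * x + 1) * (C * x))%R).
  by rewrite -[leLHS]mulrA ler_wpM2r ?mulr_ge0// ge_min lexx orbT.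
by rewrite mulrAC ler_pdivrMr// ler_pM2l// lerDl.
Qed.

End commutator_form_bound.

(** * Norms of gradients *)

Section norms.
Context {R : realType} {n : nat}.
Implicit Types (f g : 'rV[R]_n -> R).
Local Notation m := (@lebesgue_rV R n).
Local Notation "'Nm_ p [ F ]" := (Lnorm (@lebesgue_rV R n) p (EFin \o F))
  (at level 8, p at level 2).

Lemma weak_partialP (i : 'I_n) f : weakly_differentiable f ->
  is_weak_partial i f (weak_partial i f).
Proof. by move=> /(_ i)[g fg]; apply: (getPex (P := is_weak_partial i f)); exists g. Qed.

Lemma measurable_weak_partial (i : 'I_n) f : weakly_differentiable f ->
  measurable_fun setT (weak_partial i f).
Proof. by move=> /(weak_partialP i)[_ []]. Qed.

Lemma lebesgue_cube_fin_num M : m (@cube R n M) \is a fin_num.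
Proof.
rewrite (_ : cube M = [set x | forall i, (`[(- M)%R, M]%classic : set R) (x ord0 i)]); last first.
  apply/seteqP; split => x.
    by move/cubeP => h i /=; rewrite in_itv/= -ler_norml.
  by move=> h; apply/cubeP => i; have := h i; rewrite /= in_itv/= -ler_norml.
rewrite (@lebesgue_rV_box R n (fun=> `[(- M)%R, M]%classic))//; apply: prode_fin_num => i _.
by rewrite lebesgue_measure_itv /=; case: ifP.
Qed.

(** Pointwise |f| <= 1 + |f|^s, and the measure of a cube does not change under
    translation. *)
Lemma Lnorm_uloc_integrable (s : R) f : (1 < s)%R -> measurable_fun setT f ->
  'Nm_s%:E [f] < +oo -> uloc_integrable f.
Proof.
move=> s1 mf foo; split => // M.
have s0 : (0 < s)%R by apply: lt_trans s1.
have Nf : 'Nm_s%:E [f] \is a fin_num by rewrite ge0_fin_numE// Lnorm_ge0.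
have mp : measurable_fun setT (fun x => (`|f x| `^ s)%:E).
  by apply/measurable_EFinP; apply: (measurableT_comp (measurable_powR s)); exact: measurableT_comp.
have powE : \int[m]_x (`|f x| `^ s)%:E = ('Nm_s%:E [f]) `^ s.
  by rewrite poweR_Lnorm ?gt_eqF//.
exists (fine (m (@cube R n M) + 'Nm_s%:E [f] `^ s)) => v.
have fins : 'Nm_s%:E [f] `^ s \is a fin_num.
  by rewrite ge0_fin_numE ?poweR_ge0//; apply: poweR_lty.
rewrite fineK; last by rewrite fin_numD lebesgue_cube_fin_num.
have mi : measurable_fun setT (\1_(@cube R n M) : 'rV[R]_n -> R).
  by apply: measurable_indic; exact: measurable_cube.
have miv : measurable_fun setT (fun y : 'rV[R]_n => (\1_(@cube R n M) (y + v)%R : R)).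
  by apply: (measurableT_comp mi); exact: measurable_addv.
apply: (@le_trans _ _ (\int[m]_y ((\1_(@cube R n M) (y + v)%R)%:E + (`|f y| `^ s)%:E))).
  apply: ge0_le_integral => //.
  - by apply/measurable_EFinP; apply: measurable_funM => //; exact: measurableT_comp.
  - by apply: emeasurable_funD => //; exact/measurable_EFinP.
  - move=> y _; rewrite -EFinD lee_fin indicE; case: (_ \in _); last first.
      by rewrite mulr0 add0r powR_ge0.
    rewrite mulr1; have [f1|f1] := leP `|f y|%R 1%R.
      by rewrite (le_trans f1)// lerDl powR_ge0.
    apply: (@le_trans _ _ (`|f y| `^ s)%R); last by rewrite lerDr.
    by rewrite -[leLHS]powRr1// ler_powR// ltW.
rewrite ge0_integralD//.
- rewrite powE leeD2r// (ge0_integral_rV_shift v (f := fun y => (\1_(@cube R n M) y)%:E))//.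
  + by rewrite integral_indic ?setIT//; exact: measurable_cube.
  + exact/measurable_EFinP.
- exact/measurable_EFinP.
Qed.

Lemma measurable_euclidean_norm k l (F : 'rV[R]_n -> 'M[R]_(k, l)) :
  (forall i j, measurable_fun setT (fun x => F x i j)) ->
  measurable_fun setT (fun x => euclidean_norm (F x)).
Proof.
move=> mF; have msqrt : measurable_fun setT (@Num.sqrt R).
  by apply: continuous_measurable_fun => x; exact: sqrt_continuous.
apply: (measurableT_comp msqrt).
by apply: measurable_sum => i; apply: measurable_sum => j; exact: measurable_funX.
Qed.

Lemma entry_le_euclidean_norm k l (A : 'M[R]_(k, l)) i j :
  (`|A i j| <= euclidean_norm A)%R.
Proof.
rewrite /euclidean_norm -sqrtr_sqr ler_wsqrtr//.
rewrite (bigD1 i)//= (bigD1 j)//= -addrA lerDl addr_ge0//.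
  by apply: sumr_ge0 => ? _; exact: sqr_ge0.
by apply: sumr_ge0 => ? _; apply: sumr_ge0 => ? _; exact: sqr_ge0.
Qed.

Lemma Lnorm_entry_le k l (p : \bar R) (F : 'rV[R]_n -> 'M[R]_(k, l)) i j : 0 < p ->
  (forall i j, measurable_fun setT (fun x => F x i j)) ->
  'Nm_p [fun x => F x i j] <= Lx_mxnorm p F.
Proof.
move=> p0 mF; apply: le_Lnorm => //; first exact: measurable_euclidean_norm.
move=> x; rewrite [leRHS]ger0_norm ?sqrtr_ge0//; exact: entry_le_euclidean_norm.
Qed.

End norms.

(** * The commutator at a fixed time *)

Section fixed_time_bound.
Context {R : realType} {n : nat}.
Implicit Types (x y : 'rV[R]_n) (i j : 'I_n).
Local Notation m := (@lebesgue_rV R n).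
Local Notation "'Nm_ p [ F ]" := (Lnorm (@lebesgue_rV R n) p (EFin \o F))
  (at level 8, p at level 2).

Context (q : \bar R) (r s : R) (r1 : (1 < r)%R) (s1 : (1 < s)%R) (q1 : 1 < q)
  (qrs : q^-1 + r%:E^-1 + s%:E^-1 = 1).
Context (alpha : R) (alpha0 : (0 < alpha)%R).
Context (b : 'rV[R]_n -> 'rV[R]_n) (u f : 'rV[R]_n -> R).
Hypotheses (bW : vW1x q b) (uL : Lx r%:E u) (fW : W1x s%:E f).
Local Notation p := (@heat_kernel R n alpha).
Local Notation b_ i := (fun x => b x ord0 i).
Local Notation g_ i := (weak_partial i f).
Local Notation K_ i := (increment_kernel alpha (b_ i)).

Let s0 : (0 < s)%R. Proof. by apply: lt_trans s1. Qed.
Let q0 : 0 < q. Proof. by apply: lt_trans q1; rewrite lte_fin. Qed.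

Let mu : measurable_fun setT u. Proof. by case: uL. Qed.
Let uoo : 'Nm_r%:E [u] < +oo. Proof. by case: uL. Qed.
Let mf : measurable_fun setT f. Proof. by case: fW => -[]. Qed.
Let foo : 'Nm_s%:E [f] < +oo. Proof. by case: fW => -[]. Qed.
Let wf : weakly_differentiable f. Proof. by case: fW. Qed.
Let mb i : measurable_fun setT (b_ i). Proof. by case: (bW i) => -[]. Qed.
Let boo i : 'Nm_q [b_ i] < +oo. Proof. by case: (bW i) => -[]. Qed.
Let wb i : weakly_differentiable (b_ i). Proof. by case: (bW i). Qed.
Let mg i : measurable_fun setT (g_ i). Proof. exact: measurable_weak_partial. Qed.

Let goo i : 'Nm_s%:E [g_ i] < +oo.
Proof.
have [_ _] := fW; apply: le_lt_trans.
have mgrad (k : 'I_1) (j : 'I_n) : measurable_fun setT (fun x => gradient f x k j).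
  by under eq_fun do rewrite mxE; exact: mg.
have := @Lnorm_entry_le R n 1 n s%:E (gradient f) ord0 i s0 mgrad.
by under [X in 'Nm_s%:E [X]]eq_fun do rewrite mxE.
Qed.

Let uloc_f : uloc_integrable f. Proof. exact: Lnorm_uloc_integrable s1 mf foo. Qed.
Let uloc_g i : uloc_integrable (g_ i).
Proof. exact: Lnorm_uloc_integrable s1 (mg i) (goo i). Qed.

(** The chosen representative of the weak derivative is only determined up to null
    sets. *)
Lemma weak_partial_heat_ae i :
  {ae m, forall x, weak_partial i (heat alpha f) x = heat alpha (g_ i) x}.
Proof.
have hw j := is_weak_partial_heat alpha0 uloc_f (uloc_g j) (weak_partialP j wf).
by apply: weak_partial_unique (hw i); apply: weak_partialP => j; exists (heat alpha (g_ j)).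
Qed.

(** Commuting the semigroup with the derivatives turns both terms of the commutator
    into integrals of the same d_i f against p(x - y), with b evaluated at y in one
    and at x in the other. *)
Lemma heat_commutator_ae : {ae m, forall x,
  (u x * heat_commutator alpha b f x)%:E =
  \sum_i \int[m]_y (u x * K_ i (x, y) * g_ i y)%:E}.
Proof.
have intF i := ae_integrable1 (form_integrable r1 s1 q1 qrs alpha0 mu (mb i)
  uoo (boo i) (mg i) (goo i)).
have intH i := ae_heat_integrable alpha0 (uloc_g i).
have := filter_forall (ae_filter_ringOfSetsType m) weak_partial_heat_ae.
have := filter_forall (ae_filter_ringOfSetsType m) intH.
have := filter_forall (ae_filter_ringOfSetsType m) intF.
apply: filterS3 => x iF iH hE.
have [ux0|ux0] := eqVneq (u x) 0%R.
  rewrite ux0 mul0r big1// => i _.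
  by rewrite integral0_eq// => y _; rewrite !mul0r.
have iP i : m.-integrable setT (fun y => (p (x - y) * b_ i y * g_ i y)%:E).
  have iK := integrableZl measurableT (u x)^-1%R (iF i).
  have ib := integrableZl measurableT (b_ i x) (iH i).
  apply: eq_integrable (integrableD measurableT iK ib) => // y _.
  by rewrite -!EFinM -EFinD /increment_kernel /=; congr EFin; field.
pose a i := fine (\int[m]_y (p (x - y) * b_ i y * g_ i y)%:E).
pose c i := fine (\int[m]_y (p (x - y) * g_ i y)%:E).
have aE : heat alpha (advect b f) x = (\sum_i a i)%R.
  apply: EFin_inj; rewrite heatE// -sumEFin.
  have E : \int[m]_y (p (x - y) * advect b f y)%:E =
      \sum_i \int[m]_y (p (x - y) * b_ i y * g_ i y)%:E.
    rewrite -integral_sum//; apply: eq_integral => y _.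
    rewrite sumEFin /advect /dotv mulr_sumr; congr EFin; apply: eq_bigr => i _.
    by rewrite mxE mulrA.
  have fina i : \int[m]_y (p (x - y) * b_ i y * g_ i y)%:E \is a fin_num.
    exact: integrable_fin_num.
  rewrite E fineK; last by apply/sum_fin_numP => i _ _; exact: fina.
  by apply: eq_bigr => i _; rewrite /a fineK.
rewrite /heat_commutator aE /advect /dotv mulrBr !mulr_sumr -sumrB -sumEFin.
apply: eq_bigr => i _; rewrite mxE hE heatE// -/(c i).
transitivity ((u x)%:E * ((a i)%:E - (b_ i x)%:E * (c i)%:E)).
  by rewrite -[X in _ - X]EFinM -EFinB -[RHS]EFinM; congr EFin; ring.
rewrite /a /c !fineK; [|exact: integrable_fin_num..].
rewrite -integralZl// -integralB//; last exact: integrableZl.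
rewrite -integralZl//; last by apply: integrableB => //; exact: integrableZl.
apply: eq_integral => y _.
rewrite -[X in _ - X]EFinM -EFinB -[RHS]EFinM /increment_kernel /=; congr EFin; ring.
Qed.


Let measurable_advect (v : 'rV[R]_n -> R) : weakly_differentiable v ->
  measurable_fun setT (advect b v).
Proof.
move=> wv; rewrite /advect /dotv; apply: measurable_sum => i.
apply: measurable_funM; first exact: mb.
by under eq_fun do rewrite mxE; exact: measurable_weak_partial.
Qed.

Lemma integral_heat_commutator :
  \int[m]_x (u x * heat_commutator alpha b f x)%:E =
  \sum_i commutator_form alpha u (b_ i) (g_ i).
Proof.
have iF i := integrable_fubini_F (form_integrable r1 s1 q1 qrs alpha0 mu (mb i)
  uoo (boo i) (mg i) (goo i)).
rewrite /commutator_form -integral_sum//; apply: ae_eq_integral => //.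
- apply/measurable_EFinP; apply: measurable_funM => //.
  apply: measurable_funB; first by apply: measurable_heat => //; exact: measurable_advect.
  apply: measurable_advect => i; exists (heat alpha (g_ i)).
  by apply: is_weak_partial_heat => //; exact: weak_partialP.
- by apply: emeasurable_sum => i; exact: (measurable_int _ (iF i)).
- by apply: filterS heat_commutator_ae => x hx _.
Qed.

(** The n components of b contribute one form each, and in each form the n partial
    derivatives of that component are estimated by the norm of the full gradient. *)
Lemma integral_heat_commutator_le :
  `|\int[m]_x (u x * heat_commutator alpha b f x)%:E| <=
  (n%:R * n%:R * (@gauss_const R n + 1))%:E * Lx_mxnorm q (vgradient b) *
    Lx_norm r%:E u * Lx_norm s%:E f.
Proof.
set G := Lx_mxnorm q _; set c := (@gauss_const R n + 1)%R.
have c0 : 0 <= c%:E by rewrite lee_fin addr_ge0// gauss_const_ge0.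
have DG i j : 'Nm_q [weak_partial j (b_ i)] <= G.
  have mD (k l : 'I_n) : measurable_fun setT (fun x => vgradient b x k l).
    by under eq_fun do rewrite mxE; exact: measurable_weak_partial.
  have := @Lnorm_entry_le R n n n q (vgradient b) i j q0 mD.
  by under [X in 'Nm_q [X]]eq_fun do rewrite mxE.
have Doo i j : 'Nm_q [weak_partial j (b_ i)] < +oo.
  have [_ _] := bW i; apply: le_lt_trans.
  have mD (k : 'I_1) (l : 'I_n) : measurable_fun setT (fun x => gradient (b_ i) x k l).
    by under eq_fun do rewrite mxE; exact: measurable_weak_partial.
  have := @Lnorm_entry_le R n 1 n q (gradient (b_ i)) ord0 j q0 mD.
  by under [X in 'Nm_q [X]]eq_fun do rewrite mxE.
have G0 : 0 <= G by exact: Lnorm_ge0.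
have U0 : 0 <= Lx_norm r%:E u by exact: Lnorm_ge0.
have F0 : 0 <= Lx_norm s%:E f by exact: Lnorm_ge0.
rewrite integral_heat_commutator; apply: (le_trans (lee_abs_sum _ _ _)).
apply: (@le_trans _ _ (\sum_(i < n)
    c%:E * (Lx_norm r%:E u * Lx_norm s%:E f * \sum_(j < n) G))).
  apply: lee_sum => i _.
  have sDoo : \sum_j 'Nm_q [weak_partial j (b_ i)] < +oo by exact: lte_sum_pinfty.
  apply: (le_trans (commutator_form_le r1 s1 q1 qrs alpha0 mu (mb i)
    (fun j => weak_partialP j (wb i)) uoo (boo i) sDoo (weak_partialP i wf) foo (goo i))).
  apply: lee_wpmul2l => //; apply: lee_wpmul2l; first exact: mule_ge0.
  exact: lee_sum.
have sumc (x : \bar R) : \sum_(i < n) x = n%:R%:E * x.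
  rewrite -[in LHS](mul1e x) -ge0_sume_distrl//; congr (_ * _).
  by rewrite sumEFin sumr_const card_ord.
rewrite !sumc !EFinM le_eqVlt; apply/orP; left; apply/eqP.
rewrite -!muleA; congr (_ * _); rewrite [in LHS]muleA.
by rewrite (muleC _ (n%:R%:E * G)) -(muleA _ G) (muleCA c%:E).
Qed.

End fixed_time_bound.

(** * Integration in time *)

Section time_integral.
Context d (T : measurableType d) (R : realType) (mu : {measure set T -> \bar R}).
Implicit Types (D : set T) (h A : T -> \bar R).
Import HBNNSimple.

(** The norm is 0 by convention when the measure is 0, and then every property holds
    almost everywhere. *)
Lemma ae_le_Lnorm_oo h : {ae mu, forall t, `|h t| <= 'N[mu]_+oo[h]}.
Proof.
have -> : 'N[mu]_+oo[h] = if 0 < mu setT then ess_sup mu (abse \o h) else 0.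
  by rewrite unlock.
case: ifPn => [_|]; first exact: ess_sup_ge.
by rewrite -leNgt measure_le0 => /eqP mu0; exists setT.
Qed.

Lemma le_Lnorm_oo h A : (forall t, `|h t| <= `|A t|) ->
  'N[mu]_+oo[h] <= 'N[mu]_+oo[A].
Proof.
by move=> hA; rewrite unlock; case: ifPn => // _; apply/le_ess_sup/nearW.
Qed.

Lemma sintegral_mrestr D (mD : measurable D) (phi : {nnsfun T >-> R}) :
  (forall t, ~ D t -> phi t = 0%R) ->
  sintegral mu phi = sintegral (mrestr mu mD) phi.
Proof.
move=> phi0; rewrite !sintegralEnnsfun; apply: eq_fsbigr => x; rewrite inE/= => x0.
rewrite /mrestr/= setIidl// => t /= tx.
by apply: contrapT => /phi0; rewrite tx => x00; rewrite x00 ltxx in x0.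
Qed.

(** Neither integrand need be measurable in time, so the comparison is made on the
    simple functions below them. *)
Lemma ae_ge0_le_integral_mrestr D (mD : measurable D) h A (k : R) : (0 <= k)%R ->
  (forall t, 0 <= h t) -> (forall t, 0 <= A t) ->
  {ae mrestr mu mD, forall t, h t <= k%:E * A t} ->
  \int[mu]_(t in D) h t <= k%:E * \int[mrestr mu mD]_t A t.
Proof.
move=> k0 h0 A0 [N [mN N0 hN]]; rewrite ge0_integralE//.
apply: ge_ereal_sup => _ [phi /= phih <-].
have phiD t : ~ D t -> phi t = 0%R.
  move=> nDt; apply/eqP; rewrite eq_le fun_ge0 andbT -lee_fin (le_trans (phih t))//.
  by rewrite patchE memNset.
rewrite (sintegral_mrestr mD phiD); set nu := mrestr mu mD.
have mNc : measurable (~` N) by exact: measurableC.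
pose psi : {nnsfun T >-> R} := proj_nnsfun phi mNc.
have psiE t : psi t = (phi t * \1_(~` N) t)%R by [].
have -> : sintegral nu phi = sintegral nu psi.
  rewrite -!integralT_nnsfun; apply: ae_eq_integral => //.
  - exact/measurable_EFinP.
  - exact/measurable_EFinP.
  exists N; split => // t /= nt; apply: contrapT => nNt; apply: nt => _.
  by rewrite -[mindic _ _ _]/(\1_(~` N) t) indicE mem_set// mulr1.
have psiA t : (psi t)%:E <= k%:E * A t.
  rewrite psiE indicE; have [Nt|nNt] := pselect (N t).
    by rewrite memNset ?mulr0 ?mule_ge0//; exact.
  rewrite mem_set// mulr1; apply: (le_trans (phih t)); rewrite patchE.
  case: ifPn => _; last by rewrite mule_ge0.
  by apply: contrapT => nhA; apply: nNt; apply: hN.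
have psi0 t : 0 <= (psi t)%:E by rewrite lee_fin; exact: fun_ge0.
have [kz|kn0] := eqVneq k 0%R.
  rewrite kz mul0e -integralT_nnsfun integral0_eq// => t _; apply/eqP.
  by rewrite eq_le psi0 andbT (le_trans (psiA t))// kz mul0e.
have {}k0 : (0 < k)%R by rewrite lt_neqAle eq_sym kn0.
have ki0 : (0 <= k^-1)%R by rewrite invr_ge0 ltW.
rewrite -lee_pdivrMl// -integralT_nnsfun -ge0_integralZl//; last exact/measurable_EFinP.
rewrite [leRHS]ge0_integralTE//; apply: ereal_sup_ubound.
exists (scale_nnsfun psi ki0) => [t|]; last by rewrite -integralT_nnsfun.
by rewrite (_ : (scale_nnsfun psi ki0 t)%:E = k^-1%:E * (psi t)%:E)// lee_pdivrMl.
Qed.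

End time_integral.

Lemma Lx_norm_ge0 (R : realType) n p (f : 'rV[R]_n -> R) : 0 <= Lx_norm p f.
Proof. exact: Lnorm_ge0. Qed.

Lemma Lx_mxnorm_ge0 (R : realType) n k l p (F : 'rV[R]_n -> 'M[R]_(k, l)) :
  0 <= Lx_mxnorm p F.
Proof. exact: Lnorm_ge0. Qed.

Theorem lemma3p4 (R : realType) (d : nat) (hd : (1 <= d)%N) :
  exists c : R, forall (T : R) (q : \bar R) (r s : R)
    (b : R -> 'rV[R]_d -> 'rV[R]_d) (u f : R -> 'rV[R]_d -> R),
    (0 <= T)%R -> 1 < q -> (1 < r)%R -> (1 < s)%R ->
    q^-1 + r%:E^-1 + s%:E^-1 = 1 ->
    LtE T 1 (vW1x q) (vW1x_norm q) b ->
    LtE T +oo (Lx r%:E) (Lx_norm r%:E) u ->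
    LtE T +oo (W1x s%:E) (W1x_norm s%:E) f ->
    forall alpha : R, (0 < alpha < 1)%R ->
      \int[lebesgue_measure]_(t in `]0%R, T[)
        `| \int[lebesgue_rV d]_x
             (u t x * heat_commutator alpha (b t) (f t) x)%:E |
      <= c%:E * Lt_norm T 1 (fun t => Lx_mxnorm q (vgradient (b t)))
              * Lt_norm T +oo (fun t => Lx_norm r%:E (u t))
              * Lt_norm T +oo (fun t => Lx_norm s%:E (f t)).
Proof.
pose c := (d%:R * d%:R * (@gauss_const R d + 1))%R.
have c0 : (0 <= c)%R by rewrite !mulr_ge0// addr_ge0// gauss_const_ge0.
exists c => T q r s b u f _ q1 r1 s1 qrs [_ bW _] [_ uL Uoo] [_ fW Foo] alpha /andP[alpha0 _].
set A := fun t => Lx_mxnorm q (vgradient (b t)).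
set U := fun t => Lx_norm r%:E (u t).
set F := fun t => Lx_norm s%:E (f t).
set NU := Lt_norm T +oo U; set NF := Lt_norm T +oo F.
have A0 t : 0 <= A t by exact: Lx_mxnorm_ge0.
have U0 t : 0 <= U t by exact: Lx_norm_ge0.
have F0 t : 0 <= F t by exact: Lx_norm_ge0.
have NU0 : 0 <= NU by exact: Lnorm_ge0.
have NF0 : 0 <= NF by exact: Lnorm_ge0.
have NUfin : NU \is a fin_num by rewrite ge0_fin_numE.
have NFfin : NF \is a fin_num.
  rewrite ge0_fin_numE//; apply: le_lt_trans Foo; apply: le_Lnorm_oo => t.
  by rewrite !gee0_abs// ?leeDl ?adde_ge0 ?Lx_norm_ge0 ?Lx_mxnorm_ge0.
pose k := (c * fine NU * fine NF)%R.
have k0 : (0 <= k)%R by exact: (mulr_ge0 (mulr_ge0 c0 (fine_ge0 NU0)) (fine_ge0 NF0)).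
have kE X : c%:E * X * NU * NF = k%:E * X.
  by rewrite (EFinM _ (fine NF)) (EFinM c) !fineK// -[LHS]muleA -[LHS]muleA -[in RHS](muleA _ NU) -[RHS]muleA (muleC X).
have -> : Lt_norm T 1 A = \int[time_measure T]_t A t.
  by rewrite /Lt_norm Lnorm1; apply: eq_integral => t _; rewrite gee0_abs.
rewrite kE; apply: ae_ge0_le_integral_mrestr => //.
have aeF : Filter (almost_everywhere (time_measure T)).
  exact: ae_filter_ringOfSetsType.
have Ule := ae_le_Lnorm_oo (time_measure T) U.
have Fle := ae_le_Lnorm_oo (time_measure T) F.
have bound : \forall t \ae time_measure T,
    `|\int[lebesgue_rV d]_x (u t x * heat_commutator alpha (b t) (f t) x)%:E| <=
      c%:E * A t * U t * F t.
  move: bW uL fW; apply: filterS3 => t bt ut ft.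
  exact: (integral_heat_commutator_le r1 s1 q1 qrs alpha0 bt ut ft).
move: bound Ule Fle; apply: filterS3 => t /le_trans + Ut Ft; apply.
rewrite -kE; apply: lee_pmul => //; rewrite ?mule_ge0//.
  by apply: lee_wpmul2l; rewrite ?mule_ge0// -(gee0_abs (U0 t)).
by rewrite -(gee0_abs (F0 t)).
Qed.
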